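(* Let $\Gamma$ be a Fuchsian group, $\rho$ a finite-dimensional representation, $k\in\mathbb{Z}$, $m\geq1$, $*\in\{an,sing\}$, and let $F\in\mathcal{M}_{k-m}^{*}(V_{m}\otimes\rho)$ be associated with the quasi-modular form $f\in\widetilde{\mathcal{M}}_{k}^{*,\leq m}(\rho)$. Then: (i) $\delta_{k-m}F$ is associated with $\delta_{k-m}f$; (ii) if $F=i_{m-1}(G)$ for some $G\in\mathcal{M}_{k+1-m}^{*}(V_{m-1}\otimes\rho)$ (equivalently $f\in\widetilde{\mathcal{M}}_{k}^{*,\leq m-1}(\rho)$), then $\frac{\overline{i}_{m-1}(G)}{-2iy}\in\mathcal{M}_{k+2-m}^{*}(V_{m}\otimes\rho)$ is associated with $\frac{f}{-2iy}$; (iii) under the assumption of (ii), for every number $l$ the function $\delta_{k-m}F+(k-m-l)\frac{\overline{i}_{m-1}(G)}{-2iy}$ is associated with $\delta_{l}f$ (in particular, with $l=0$, with $\partial_{\tau}f$); (iv) $y^{2}\partial_{\overline{\tau}}F$ is associated with $y^{2}\partial_{\overline{\tau}}f$; (v) $i_{m-1}(D_{m}F)$ is associated with $f_{1}$.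
   Context: Notation: $\mathcal{H}$ upper half-plane, $\tau=x+iy$; for $\gamma=\begin{pmatrix}a&b\\c&d\end{pmatrix}\in SL_{2}(\mathbb{R})$, $j(\gamma,\tau)=c\tau+d$, $j_{\gamma}'=c$. $\Gamma$ is a discrete finite-covolume subgroup of $SL_{2}(\mathbb{R})$, $\rho$ a representation on $V_{\rho}$. Quasi-modular forms $f\in\widetilde{\mathcal{M}}_{k}^{*,\leq m}(\rho)$: functions $f:\mathcal{H}\to V_{\rho}$ (real-analytic for $*=an$, real-analytic off a discrete set for $*=sing$) with functions $f_{0}=f,\ldots,f_{m}$ such that $f(\gamma\tau)=\sum_{r}j(\gamma,\tau)^{k-r}(j_{\gamma}')^{r}\rho(\gamma)f_{r}(\tau)$; $\mathcal{M}^{*}_{k}(\rho)$ is the depth-$0$ case. $V_{m}=\mathrm{Sym}^{m}\mathbb{C}^{2}$ with $SL_{2}(\mathbb{R})$ acting through the standard action on column vectors; elements are written as products of vectors of $\mathbb{C}^{2}$. $\mathcal{M}_{k-m}^{*}(V_{m}\otimes\rho)$ is the space of $F:\mathcal{H}\to V_{m}\otimes V_{\rho}$ of the corresponding regularity with $F(\gamma\tau)=j(\gamma,\tau)^{k-m}(\mathrm{Sym}^{m}\gamma\otimes\rho(\gamma))F(\tau)$. Put $X=\binom{\tau}{1}$, $\overline{X}=\binom{\overline{\tau}}{1}$, $e=\binom{1}{0}$. The form $F$ associated with $f$ is $F(\tau)=\sum_{r=0}^{m}f_{r}(\tau)X^{m-r}e^{r}$; this is a bijection $\widetilde{\mathcal{M}}_{k}^{*,\leq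 m}(\rho)\to\mathcal{M}_{k-m}^{*}(V_{m}\otimes\rho)$. Operators: $\delta_{w}=\partial_{\tau}+\frac{w}{2iy}$, where $\partial_{\tau}$ also differentiates $X$; $i_{m-1}:\mathcal{M}_{k+1-m}^{*}(V_{m-1}\otimes\rho)\to\mathcal{M}_{k-m}^{*}(V_{m}\otimes\rho)$ is multiplication by $X$, and $\overline{i}_{m-1}$ is multiplication by $\overline{X}$; writing uniquely $F=\sum_{m_{+}+m_{-}=m}\tilde{f}^{m_{+},m_{-}}X^{m_{+}}\overline{X}^{m_{-}}$, define $D_{m}F=-2iy\sum m_{-}\tilde{f}^{m_{+},m_{-}}X^{m_{+}}\overline{X}^{m_{-}-1}$, which lies in $\mathcal{M}_{k-m-1}^{*}(V_{m-1}\otimes\rho)$. *)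

(* Defs.v *)
(* [mpoly] is imported without its notations, which clash with those of
   MathComp-Analysis. *)
From HB Require Import structures.
From mathcomp Require Import all_boot all_order all_algebra.
From mathcomp Require Import complex.
From mathcomp Require Import -(notations) mpoly.
From mathcomp Require Import all_classical all_reals all_analysis.

Set Implicit Arguments.
Unset Strict Implicit.
Unset Printing Implicit Defensive.

Import Order.TTheory GRing.Theory Num.Theory.
Import numFieldNormedType.Exports.

Local Open Scope classical_set_scope.
Local Open Scope complex_scope.
Local Open Scope ring_scope.

Notation upper_half_plane R := [set tau : R[i] | 0 < complex.Im tau].

Section FuchsianGroups.
Variable R : realType.
Implicit Types (g : 'M[R]_2) (tau : R[i]).

Definition jfactor g tau : R[i] := (g 1 0)%:C * tau + (g 1 1)%:C.
Definition jprime g : R[i] := (g 1 0)%:C.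
Definition mobius g tau : R[i] :=
  ((g 0 0)%:C * tau + (g 0 1)%:C) / jfactor g tau.

Definition SL2_subgroup (Gamma : set 'M[R]_2) : Prop :=
  [/\ forall g, Gamma g -> \det g = 1,
      Gamma 1%:M,
      forall g h, Gamma g -> Gamma h -> Gamma (g *m h)
    & forall g, Gamma g -> Gamma (invmx g)].

Definition discrete_subset (Gamma : set 'M[R]_2) : Prop :=
  forall g, Gamma g -> exists2 eps : R, 0 < eps &
    forall h, Gamma h -> (forall i j, `|h i j - g i j| < eps) -> h = g.

Definition hyperbolic_area (D : set (R * R)) : \bar R :=
  (\int[(@lebesgue_measure R \x @lebesgue_measure R)%E]_(p in D)
     (p.2 ^- 2)%:E)%E.

(* [D] contains exactly one point of each Gamma-orbit in the half-plane; the
   pair (x, y) stands for x + iy. *)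
Definition fundamental_domain (Gamma : set 'M[R]_2) (D : set (R * R)) : Prop :=
  [/\ measurable D,
      D `<=` [set p | 0 < p.2]
    & forall tau, upper_half_plane R tau ->
        exists! p : R * R, D p /\
          exists2 g, Gamma g & p.1 +i* p.2 = mobius g tau].

Definition fuchsian (Gamma : set 'M[R]_2) : Prop :=
  [/\ SL2_subgroup Gamma, discrete_subset Gamma
    & exists2 D, fundamental_domain Gamma D & (hyperbolic_area D < +oo)%E].

Definition representation (Gamma : set 'M[R]_2) (n : nat)
    (rho : 'M[R]_2 -> 'M[R[i]]_n) : Prop :=
  rho 1%:M = 1%:M /\
  forall g h, Gamma g -> Gamma h -> rho (g *m h) = rho g *m rho h.

End FuchsianGroups.

Section RealAnalyticity.
Variable R : realType.

(* [u] is, on a neighbourhood of (x, y), the sum of an absolutely convergent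
   power series in the two real increments. *)
Definition real_analytic2 (u : R -> R -> R) (x y : R) : Prop :=
  exists (a : nat -> nat -> R) (r : R), 0 < r /\
    forall h k : R, `|h| < r -> `|k| < r ->
      (exists M : R, forall N : nat,
         \sum_(i < N) \sum_(j < N) `|a i j * h ^+ i * k ^+ j| <= M) /\
      (fun N : nat => \sum_(i < N) \sum_(j < N) a i j * h ^+ i * k ^+ j)
        @ \oo --> u (x + h) (y + k).

Definition real_analytic (u : R[i] -> R[i]) (tau : R[i]) : Prop :=
  real_analytic2 (fun x y => complex.Re (u (x +i* y)))
    (complex.Re tau) (complex.Im tau) /\
  real_analytic2 (fun x y => complex.Im (u (x +i* y)))
    (complex.Re tau) (complex.Im tau).

Definition partial_x (u : R[i] -> R[i]) (tau : R[i]) : R[i] :=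
  derive1 (fun x : R => complex.Re (u (x +i* complex.Im tau)))
    (complex.Re tau) +i*
  derive1 (fun x : R => complex.Im (u (x +i* complex.Im tau)))
    (complex.Re tau).

Definition partial_y (u : R[i] -> R[i]) (tau : R[i]) : R[i] :=
  derive1 (fun y : R => complex.Re (u (complex.Re tau +i* y)))
    (complex.Im tau) +i*
  derive1 (fun y : R => complex.Im (u (complex.Re tau +i* y)))
    (complex.Im tau).

Definition partial_tau (u : R[i] -> R[i]) (tau : R[i]) : R[i] :=
  (partial_x u tau - 'i%C * partial_y u tau) / 2%:R.

Definition partial_taubar (u : R[i] -> R[i]) (tau : R[i]) : R[i] :=
  (partial_x u tau + 'i%C * partial_y u tau) / 2%:R.

End RealAnalyticity.

(* The symmetric algebra of C^2 is the polynomial ring in two variables, which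
   stand for the standard basis vectors; Sym^m C^2 is its homogeneous part of
   degree m. With V_rho = C^n, elements of V_m (x) V_rho are columns of n
   homogeneous polynomials of degree m. *)
Notation SymAlg R := (mpoly 2 R[i]).

Section SymmetricPowers.
Variable R : realType.
Implicit Types (tau : R[i]) (g : 'M[R]_2) (m n : nat).

Definition symvec (v : 'cV[R[i]]_2) : SymAlg R :=
  \sum_(i < 2) v i 0 *: mpolyX R[i] (mnm1 i).

(* Each basis vector is replaced by its image under g, i.e. by a column of g. *)
Definition symact g (p : SymAlg R) : SymAlg R :=
  comp_mpoly [tuple symvec (map_mx (real_complex R) (col i g)) | i < 2] p.

Definition tensor_act n g (rho_g : 'M[R[i]]_n) (v : 'cV[SymAlg R]_n) :
    'cV[SymAlg R]_n :=
  map_mx (@mpolyC 2 R[i]) rho_g *m map_mx (symact g) v.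

Definition pure_tensor n (p : SymAlg R) (v : 'cV[R[i]]_n) : 'cV[SymAlg R]_n :=
  p *: map_mx (@mpolyC 2 R[i]) v.

Definition scale_tensor n (c : R[i]) (v : 'cV[SymAlg R]_n) : 'cV[SymAlg R]_n :=
  mpolyC 2 c *: v.

Definition vecX tau : SymAlg R := symvec (\col_i if i == 0 then tau else 1).
Definition vecXbar tau : SymAlg R :=
  symvec (\col_i if i == 0 then conjc tau else 1).
Definition vece : SymAlg R := symvec (\col_i if i == 0 then 1 else 0).

Definition in_tensor m n (v : 'cV[SymAlg R]_n) : Prop :=
  forall i, v i 0 \is @ishomog1 2 R[i] m mdeg.

(* A differential operator on scalar functions, applied entrywise, resp. to all
   coordinates with respect to the monomials of degree at most m. *)
Definition entrywise n (d : (R[i] -> R[i]) -> R[i] -> R[i])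
    (f : R[i] -> 'cV[R[i]]_n) (tau : R[i]) : 'cV[R[i]]_n :=
  \col_i d (fun t => f t i 0) tau.
Definition coefwise m n (d : (R[i] -> R[i]) -> R[i] -> R[i])
    (F : R[i] -> 'cV[SymAlg R]_n) (tau : R[i]) : 'cV[SymAlg R]_n :=
  \col_i \sum_(mu : bmultinom 2 m.+1)
    d (fun t => mcoeff mu (F t i 0)) tau *: mpolyX R[i] mu.

Definition two_i_y tau : R[i] := 2%:R * 'i%C * (complex.Im tau)%:C.

Definition delta (w : R[i]) (u : R[i] -> R[i]) (tau : R[i]) : R[i] :=
  partial_tau u tau + w / two_i_y tau * u tau.

(* The coefficients of v on the products X^(m - j) Xbar^j, j being the exponent
   m_- of Xbar; the choice is unique when tau is not real and v lies in
   V_m (x) V_rho. *)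
Definition Xbar_coefs m n tau (v : 'cV[SymAlg R]_n) :
    {ffun 'I_m.+1 -> 'cV[R[i]]_n} :=
  xget [ffun=> 0] [set c : {ffun 'I_m.+1 -> 'cV[R[i]]_n} |
    v = \sum_(j < m.+1)
          pure_tensor (vecX tau ^+ (m - j) * vecXbar tau ^+ j) (c j)].

Definition Dop m n (F : R[i] -> 'cV[SymAlg R]_n) (tau : R[i]) : 'cV[SymAlg R]_n :=
  \sum_(j < m.+1)
    pure_tensor (vecX tau ^+ (m - j) * vecXbar tau ^+ j.-1)
      ((- two_i_y tau * j%:R) *: Xbar_coefs m tau (F tau) j).

Definition mulX n (F : R[i] -> 'cV[SymAlg R]_n) tau := vecX tau *: F tau.
Definition mulXbar n (F : R[i] -> 'cV[SymAlg R]_n) tau := vecXbar tau *: F tau.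

End SymmetricPowers.

Variant regularity := an | sing.

Section QuasiModularForms.
Variables (R : realType) (star : regularity) (Gamma : set 'M[R]_2).
Variables (n : nat) (rho : 'M[R]_2 -> 'M[R[i]]_n).

(* The set where a form may be undefined: empty, resp. without accumulation
   points in the half-plane. Functions are total, but nothing is required of
   their values on such a set. *)
Definition exceptional (S : set R[i]) : Prop :=
  match star with
  | an => S = set0
  | sing => forall tau, upper_half_plane R tau ->
      exists2 eps : R, 0 < eps &
        forall sigma, S sigma -> `|sigma - tau| < eps%:C -> sigma = tau
  end.

Definition generically (P : R[i] -> Prop) : Prop :=
  exists2 S, exceptional S &
    forall tau, upper_half_plane R tau -> ~ S tau -> P tau.

Definition generically_equivariant (P : 'M[R]_2 -> R[i] -> Prop) : Prop :=
  exists2 S, exceptional S &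
    forall g tau, Gamma g -> upper_half_plane R tau ->
      ~ S tau -> ~ S (mobius g tau) -> P g tau.

Definition quasimodular_via (k : int) (m : nat)
    (f_ : nat -> R[i] -> 'cV[R[i]]_n) : Prop :=
  generically (fun tau => forall i, real_analytic (fun t => f_ 0%N t i 0) tau) /\
  generically_equivariant (fun g tau =>
    f_ 0%N (mobius g tau) =
    \sum_(r < m.+1) (jfactor g tau ^ (k - r%:Z) * jprime g ^+ r) *:
      (rho g *m f_ r tau)).

Definition quasimodular (k : int) (m : nat) (f : R[i] -> 'cV[R[i]]_n) : Prop :=
  exists2 f_, f_ 0%N = f & quasimodular_via k m f_.

Definition modular (w : int) (m : nat) (F : R[i] -> 'cV[SymAlg R]_n) : Prop :=
  generically (fun tau => in_tensor m (F tau)) /\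
  generically (fun tau => forall i mu,
    real_analytic (fun t => mcoeff mu (F t i 0)) tau) /\
  generically_equivariant (fun g tau =>
    F (mobius g tau) =
    scale_tensor (jfactor g tau ^ w) (tensor_act g (rho g) (F tau))).

Definition associated_via (k : int) (m : nat) (F : R[i] -> 'cV[SymAlg R]_n)
    (f_ : nat -> R[i] -> 'cV[R[i]]_n) : Prop :=
  [/\ quasimodular_via k m f_,
      modular (k - m%:Z) m F
    & generically (fun tau => F tau =
        \sum_(r < m.+1) pure_tensor (vecX tau ^+ (m - r) * vece R ^+ r)
                                    (f_ r tau))].

Definition associated (k : int) (m : nat) (F : R[i] -> 'cV[SymAlg R]_n)
    (f : R[i] -> 'cV[R[i]]_n) : Prop :=
  exists2 f_, f_ 0%N = f & associated_via k m F f_.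

End QuasiModularForms.

(* Main.v *)
Require Import Defs.
From HB Require Import structures.
From mathcomp Require Import all_boot all_order all_algebra.
From mathcomp Require Import complex.
From mathcomp Require Import -(notations) mpoly.
From mathcomp Require Import all_classical all_reals all_analysis.
From mathcomp Require Import measurable_realfun.
From mathcomp Require Import ring lra.

Import Order.TTheory GRing.Theory Num.Theory.
Import numFieldNormedType.Exports.

Set Implicit Arguments.
Unset Strict Implicit.
Unset Printing Implicit Defensive.

Local Open Scope classical_set_scope.
Local Open Scope complex_scope.
Local Open Scope ring_scope.

(** A form F with values in Sym^m C^2 (x) V is a polynomial in two variables, and the quasi-modular
    form associated with it is its value at (0, 1): there X = tau E1 + E2 becomes 1 and e becomes 0,
    while the equivariance of F evaluated at (0, 1) is the quasi-modularity of that value. Hence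
    an operator sends F to a form associated with f' as soon as its result is modular and takes the
    value f' at (0, 1). Modularity of the derivatives of F is obtained by differentiating
    F(g tau) = j^w g F(tau) by the chain rule for Wirtinger derivatives, and D_m is the derivation
    d/dE1 - tau d/dE2, which kills X.

    That f of depth at most m - 1 forces F to be divisible by X amounts to f_m = 0. Two expansions
    of f(g tau) differ by a polynomial of degree m in c / (c tau + d), so this follows if Gamma has
    elements with m + 1 distinct bottom rows up to scalars. Were there only finitely many, the
    triangular subgroup of Gamma would have finite index; but a discrete triangular group moves
    some strip or band of infinite hyperbolic area off itself, which contradicts finite covolume. *)

(** Three obstacles shape the proof. Real analyticity is defined by absolutely convergent double
    series, so its stability under products and partial derivatives is proved on the series; the
    same series give the second-order expansion that makes an analytic function Wirtinger
    differentiable. Equalities between forms hold only off exceptional sets; these do not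
    accumulate, so a point outside has a whole neighbourhood outside, and the equalities may be
    differentiated there. The invariance of hyperbolic area is obtained without a change of
    variables in the plane: SL_2(R) acts through translations and maps z -> -r/z, and in the
    coordinates (x/y, y) the latter are one-dimensional substitutions. The point (0, 1) does not
    depend on tau, so evaluation there commutes with the derivatives; and X and Xbar both take the
    value 1 at it, which is why Xbar can replace X in (ii) and (iii) without changing the function
    read off. *)

Section SymAlgebra.
Variable R : realType.
Implicit Types (g : 'M[R]_2) (p q : SymAlg R) (tau a b : R[i]) (m : nat).

Local Notation E1 := (mpolyX R[i] (mnm1 (0 : 'I_2))).
Local Notation E2 := (mpolyX R[i] (mnm1 (1 : 'I_2))).

Lemma symvecE (v : 'cV[R[i]]_2) : symvec v = v 0 0 *: E1 + v 1 0 *: E2.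
Proof. by rewrite /symvec big_ord_recl big_ord1; congr (_ + v _ _ *: mpolyX _ (mnm1 _)); apply/val_inj. Qed.

Lemma vecXE tau : vecX tau = tau *: E1 + E2.
Proof. by rewrite /vecX symvecE !mxE /= scale1r. Qed.

Lemma vecXbarE tau : vecXbar tau = conjc tau *: E1 + E2.
Proof. by rewrite /vecXbar symvecE !mxE /= scale1r. Qed.

Lemma veceE : vece R = E1.
Proof. by rewrite /vece symvecE !mxE /= scale1r scale0r addr0. Qed.

Definition eval2 a b p : R[i] := meval (fun i : 'I_2 => if i == 0 then a else b) p.

Lemma eval2D a b p q : eval2 a b (p + q) = eval2 a b p + eval2 a b q.
Proof. exact: mevalD. Qed.
Lemma eval2M a b p q : eval2 a b (p * q) = eval2 a b p * eval2 a b q.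
Proof. exact: mevalM. Qed.
Lemma eval2Z a b c p : eval2 a b (c *: p) = c * eval2 a b p.
Proof. exact: mevalZ. Qed.
Lemma eval2X a b p n : eval2 a b (p ^+ n) = eval2 a b p ^+ n.
Proof. by rewrite /eval2 rmorphXn. Qed.
Lemma eval2_sum a b (I : Type) (s : seq I) (P : pred I) (G : I -> SymAlg R) :
  eval2 a b (\sum_(i <- s | P i) G i) = \sum_(i <- s | P i) eval2 a b (G i).
Proof. by rewrite /eval2 raddf_sum. Qed.
Lemma eval2_E1 a b : eval2 a b E1 = a.
Proof. by rewrite /eval2 mevalXU. Qed.
Lemma eval2_E2 a b : eval2 a b E2 = b.
Proof. by rewrite /eval2 mevalXU. Qed.
Lemma eval2_vecX a b tau : eval2 a b (vecX tau) = tau * a + b.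
Proof. by rewrite vecXE eval2D eval2Z eval2_E1 eval2_E2. Qed.
Lemma eval2_vecXbar a b tau : eval2 a b (vecXbar tau) = conjc tau * a + b.
Proof. by rewrite vecXbarE eval2D eval2Z eval2_E1 eval2_E2. Qed.
Lemma eval2_vece a b : eval2 a b (vece R) = a.
Proof. by rewrite veceE eval2_E1. Qed.

Lemma symactD g p q : symact g (p + q) = symact g p + symact g q.
Proof. exact: comp_mpolyD. Qed.
Lemma symactM g p q : symact g (p * q) = symact g p * symact g q.
Proof. exact: rmorphM. Qed.
Lemma symactX g p n : symact g (p ^+ n) = symact g p ^+ n.
Proof. exact: rmorphXn. Qed.
Lemma symactZ g c p : symact g (c *: p) = c *: symact g p.
Proof. exact: comp_mpolyZ. Qed.
Lemma symact_E1 g : symact g E1 = (g 0 0)%:C *: E1 + (g 1 0)%:C *: E2.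
Proof. by rewrite /symact comp_mpolyXU -tnth_nth tnth_mktuple symvecE !mxE. Qed.
Lemma symact_E2 g : symact g E2 = (g 0 1)%:C *: E1 + (g 1 1)%:C *: E2.
Proof. by rewrite /symact comp_mpolyXU -tnth_nth tnth_mktuple symvecE !mxE. Qed.

(** The point is a row vector that [g] multiplies on the right. At (0, 1) it becomes the bottom row
    (c, d), where X takes the value c tau + d and e the value c: this is how the automorphy factors
    arise. *)
Lemma eval2_symact a b g p :
  eval2 a b (symact g p) =
  eval2 ((g 0 0)%:C * a + (g 1 0)%:C * b) ((g 0 1)%:C * a + (g 1 1)%:C * b) p.
Proof.
rewrite /eval2 /symact comp_mpoly_meval; apply: meval_eq => i.
rewrite tnth_mktuple symvecE mevalD !mevalZ !mevalXU !mxE /=.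
by case: i => [[|[|//]]] Hi; rewrite /=; congr (_%:C * _ + _%:C * _);
  congr (g _ _); apply/val_inj.
Qed.

Lemma symact_vecX g tau : jfactor g tau != 0 ->
  symact g (vecX tau) = jfactor g tau *: vecX (mobius g tau).
Proof.
move=> j0; rewrite !vecXE symactD symactZ symact_E1 symact_E2 !scalerDr !scalerA.
rewrite addrACA -!scalerDl; congr (_ *: _ + _ *: _).
  by rewrite /mobius mulrCA mulfV // mulr1 mulrC.
by rewrite mulrC.
Qed.

Lemma homog_E1 : E1 \is @ishomog1 2 R[i] 1 mdeg.
Proof. by rewrite dhomogX; apply/eqP; exact: mdeg1. Qed.
Lemma homog_E2 : E2 \is @ishomog1 2 R[i] 1 mdeg.
Proof. by rewrite dhomogX; apply/eqP; exact: mdeg1. Qed.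
Lemma homog_lin a b : a *: E1 + b *: E2 \is @ishomog1 2 R[i] 1 mdeg.
Proof. by apply: rpredD; apply: rpredZ; [exact: homog_E1|exact: homog_E2]. Qed.
Lemma homog_vecX tau : vecX tau \is @ishomog1 2 R[i] 1 mdeg.
Proof. by rewrite vecXE -[E2]scale1r; exact: homog_lin. Qed.
Lemma homog_vecXbar tau : vecXbar tau \is @ishomog1 2 R[i] 1 mdeg.
Proof. by rewrite vecXbarE -[E2]scale1r; exact: homog_lin. Qed.
Lemma homog_vece : vece R \is @ishomog1 2 R[i] 1 mdeg.
Proof. by rewrite veceE homog_E1. Qed.

Lemma homog_exp p n : p \is @ishomog1 2 R[i] 1 mdeg ->
  p ^+ n \is @ishomog1 2 R[i] n mdeg.
Proof. by move/dhomogMn => /(_ n); rewrite mul1n. Qed.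

Lemma mpolyX2 (mu : multinom 2) : mpolyX R[i] mu = E1 ^+ mu 0 * E2 ^+ mu 1.
Proof.
rewrite mpolyXE_id big_ord_recl big_ord1.
by congr (_ * mpolyX _ (mnm1 _) ^+ (mu _)); apply/val_inj.
Qed.

Lemma mdeg2 (mu : multinom 2) : mdeg mu = (mu 0%R + mu 1%R)%N.
Proof. by rewrite mdegE big_ord_recl big_ord1; congr (_ + mu _)%N; apply/val_inj. Qed.

Lemma homog_expansion m p : p \is @ishomog1 2 R[i] m mdeg ->
  p = \sum_(mu <- msupp p) mcoeff mu p *: (E1 ^+ mu 0 * E2 ^+ mu 1)
  /\ forall mu, mu \in msupp p -> (mu 0%R + mu 1%R)%N = m.
Proof.
move=> hp; split; last by move=> mu hmu; rewrite -mdeg2; exact: (dhomog_mf hp hmu).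
by rewrite {1}[p]mpolyE; apply: eq_bigr => mu _; rewrite mpolyX2.
Qed.

(** The coefficients form a total sequence, of which only the terms up to m are read. It is used
    with Y = X and with Z = e or Z = Xbar. *)
Definition form_comb m (Y Z : SymAlg R) (c : nat -> R[i]) : SymAlg R :=
  \sum_(r < m.+1) c r *: (Y ^+ (m - r) * Z ^+ r).

Lemma form_combD m Y Z c d :
  form_comb m Y Z c + form_comb m Y Z d = form_comb m Y Z (fun r => c r + d r).
Proof. by rewrite -big_split; apply: eq_bigr => r _ /=; rewrite scalerDl. Qed.

Lemma form_combMl m Y Z a b c : exists d,
  (a *: Y + b *: Z) * form_comb m Y Z c = form_comb m.+1 Y Z d.
Proof.
(* Pascal's rule: multiplication by Y keeps the exponent of Z, multiplication by Z raises it. The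
   guard removes [c m.+1], which may be nonzero but is not part of the combination. *)
exists (fun r => (if (r <= m)%N then a * c r else 0) + (if r is s.+1 then b * c s else 0)).
rewrite -form_combD /form_comb mulrDl !mulr_sumr; congr (_ + _).
  rewrite [RHS]big_ord_recr /= ltnn scale0r addr0; apply: eq_bigr => r _ /=.
  have rm : (r <= m)%N by rewrite -ltnS.
  by rewrite rm subSn // exprS -scalerAl -scalerAr scalerA mulrA.
rewrite [RHS]big_ord_recl /= scale0r add0r; apply: eq_bigr => r _ /=.
by rewrite subSS exprS -scalerAl -scalerAr scalerA mulrCA.
Qed.

Lemma form_comb_exp m n Y Z a b c : exists d,
  (a *: Y + b *: Z) ^+ n * form_comb m Y Z c = form_comb (n + m) Y Z d.
Proof.
elim: n => [|n [d Hd]]; first by exists c; rewrite mul1r.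
have [e He] := form_combMl (n + m) Y Z a b d.
by exists e; rewrite exprS -mulrA Hd He addSn.
Qed.

(** Expanding every monomial in E1 and E2 after the linear substitution leaves products of Y and Z
    of the same degree. *)
Lemma homog_form_comb m p Y Z a b c d : p \is @ishomog1 2 R[i] m mdeg ->
  E1 = a *: Y + b *: Z -> E2 = c *: Y + d *: Z ->
  exists e, p = form_comb m Y Z e.
Proof.
move=> /homog_expansion [hE hs] h1 h2; rewrite {1}hE big_seq.
apply: (big_ind (fun q => exists e, q = form_comb m Y Z e)).
- exists (fun=> 0); rewrite /form_comb big1 // => r _; exact: scale0r.
- by move=> _ _ [e1 ->] [e2 ->]; exists (fun r => e1 r + e2 r); rewrite form_combD.
- move=> mu hmu; rewrite -(hs _ hmu); have e0 : 1 = form_comb 0 Y Z (fun=> 1).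
    by rewrite /form_comb big_ord1 scale1r !expr0 mulr1.
  rewrite h1 h2; have [e1 he1] := form_comb_exp 0 (mu 1%R) Y Z c d (fun=> 1).
  have [e2 he2] := form_comb_exp (mu 1%R + 0) (mu 0%R) Y Z a b e1.
  exists (fun r => mcoeff mu p * e2 r).
  rewrite -[X in _ * X]mulr1 e0 he1 he2 addn0 /form_comb scaler_sumr.
  by apply: eq_bigr => r _; rewrite scalerA.
Qed.

Lemma homog_X_e m p tau : p \is @ishomog1 2 R[i] m mdeg ->
  exists e, p = form_comb m (vecX tau) (vece R) e.
Proof.
move=> hp; apply: (@homog_form_comb m p _ _ 0 1 1 (- tau) hp); rewrite veceE vecXE.
  by rewrite scale0r add0r scale1r.
by rewrite scale1r scaleNr addrAC subrr add0r.
Qed.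

Lemma two_i_yE tau : two_i_y tau = tau - conjc tau.
Proof.
case: tau => x y; rewrite /two_i_y -mulrA mulr_natl mulr2n; simpc.
by [].
Qed.

Lemma two_i_y_neq0 tau : upper_half_plane R tau -> two_i_y tau != 0.
Proof.
case: tau => x y /= hy; rewrite two_i_yE; simpc.
by rewrite eq_complex /= negb_and; apply/orP; right; apply: lt0r_neq0; lra.
Qed.

(** The base change from (E1, E2) to (X, Xbar) has determinant tau - conj(tau) = 2iy, which is
    invertible in the upper half-plane; the coefficients below are those of the inverse matrix. *)
Lemma homog_X_Xbar m p tau : upper_half_plane R tau -> p \is @ishomog1 2 R[i] m mdeg ->
  exists e, p = form_comb m (vecX tau) (vecXbar tau) e.
Proof.
move=> ht hp; set u := two_i_y tau; have u0 : u != 0 := two_i_y_neq0 ht.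
apply: (@homog_form_comb m p _ _ u^-1 (- u^-1) (- conjc tau / u) (tau / u) hp);
  rewrite vecXE vecXbarE !scalerDr !scalerA addrACA -2!(@scalerDl _ (SymAlg R)).
  by rewrite subrr scale0r addr0 mulNr -mulrBr -two_i_yE mulVf // scale1r.
have -> : - conjc tau / u * tau + tau / u * conjc tau = 0 by field.
have -> : - conjc tau / u + tau / u = 1 by rewrite -mulrDl addrC -two_i_yE mulfV.
by rewrite scale0r add0r scale1r.
Qed.

Definition derX tau p : SymAlg R := mderiv 0 p - tau *: mderiv 1 p.

Lemma derXD tau p q : derX tau (p + q) = derX tau p + derX tau q.
Proof. by rewrite /derX !mderivD scalerDr opprD addrACA. Qed.
Lemma derXZ tau c p : derX tau (c *: p) = c *: derX tau p.
Proof. by rewrite /derX !mderivZ scalerBr !scalerA [c * _]mulrC. Qed.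
Lemma derXM tau p q : derX tau (p * q) = derX tau p * q + p * derX tau q.
Proof.
rewrite /derX !mderivM scalerDr mulrBl mulrBr -!scalerAl -!scalerAr opprD.
by rewrite addrACA.
Qed.
Lemma derX_sum tau (I : Type) (s : seq I) (P : pred I) (G : I -> SymAlg R) :
  derX tau (\sum_(i <- s | P i) G i) = \sum_(i <- s | P i) derX tau (G i).
Proof.
apply: (big_morph (derX tau)); first exact: derXD.
by rewrite -[X in derX _ X](scale0r 0) derXZ scale0r.
Qed.
Lemma derX1 tau : derX tau 1 = 0.
Proof. by rewrite /derX -mpolyC1 !mderivC scaler0 subr0. Qed.
Lemma derX_exp tau p n : derX tau (p ^+ n) = n%:R *: (p ^+ n.-1 * derX tau p).
Proof.
elim: n => [|n IH]; first by rewrite expr0 derX1 scale0r.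
rewrite exprS derXM IH /= -scalerAr -natr1 scalerDl scale1r addrC [derX tau p * _]mulrC.
congr (_ + _); case: n {IH} => [|n] /=; first by rewrite !scale0r.
by rewrite mulrA -exprS.
Qed.
Lemma derX_E1 tau : derX tau E1 = 1.
Proof.
rewrite /derX !mderivX !mnm1E /= scale1r scale0r scaler0 subr0.
have -> : forall u : multinom 2, mnm_sub u u = mnm0 by move=> u; apply/mnmP => i; rewrite mnmBE subnn mnm0E.
by rewrite mpolyX0.
Qed.
Lemma derX_E2 tau : derX tau E2 = - tau%:A.
Proof.
rewrite /derX !mderivX !mnm1E /= scale1r scale0r sub0r.
have -> : forall u : multinom 2, mnm_sub u u = mnm0 by move=> u; apply/mnmP => i; rewrite mnmBE subnn mnm0E.
by rewrite mpolyX0.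
Qed.
Lemma derX_vecX tau : derX tau (vecX tau) = 0.
Proof. by rewrite vecXE derXD derXZ derX_E1 derX_E2 subrr. Qed.
Lemma derX_vece tau : derX tau (vece R) = 1.
Proof. by rewrite veceE derX_E1. Qed.
(** This value is the source of the factor -2iy in the definition of D_m. *)
Lemma derX_vecXbar tau : derX tau (vecXbar tau) = (- two_i_y tau)%:A.
Proof. by rewrite vecXbarE derXD derXZ derX_E1 derX_E2 -scalerBl two_i_yE opprB. Qed.

End SymAlgebra.

(** * Double power series: convergence over squares, Taylor estimates, termwise differentiation *)

Section DoubleSeries.
Variable R : realType.
Implicit Types (a b t : nat -> nat -> R) (u v : R -> R -> R) (x y h k r : R).

Definition square_sum t (N : nat) : R := \sum_(i < N) \sum_(j < N) t i j.

Lemma square_sum_widen t (N M : nat) : (N <= M)%N ->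
  square_sum t N =
  \sum_(i < M) \sum_(j < M) (if (i < N)%N && (j < N)%N then t i j else 0).
Proof.
move=> NM; rewrite /square_sum (big_ord_widen M (fun i => \sum_(j < N) t i j) NM).
rewrite big_mkcond; apply: eq_bigr => i _; case: ifP => iN /=; last by rewrite big1.
by rewrite (big_ord_widen M (fun j => t i j) NM) big_mkcond.
Qed.

Lemma square_sum_nondecreasing t : (forall i j, 0 <= t i j) ->
  nondecreasing_seq (square_sum t).
Proof.
move=> t0 N M NM; rewrite (square_sum_widen t NM); apply: ler_sum => i _.
by apply: ler_sum => j _; case: ifP.
Qed.

Lemma square_sumD t t' N :
  square_sum (fun i j => t i j + t' i j) N = square_sum t N + square_sum t' N.
Proof. by rewrite -big_split; apply: eq_bigr => i _; rewrite -big_split. Qed.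

Lemma square_sumZ c t N : square_sum (fun i j => c * t i j) N = c * square_sum t N.
Proof. by rewrite /square_sum mulr_sumr; apply: eq_bigr => i _; rewrite mulr_sumr. Qed.

Lemma square_sum_le t t' N : (forall i j, t i j <= t' i j) ->
  square_sum t N <= square_sum t' N.
Proof. by move=> H; apply: ler_sum => i _; apply: ler_sum => j _. Qed.

Lemma square_sum_norm t N : `|square_sum t N| <= square_sum (fun i j => `|t i j|) N.
Proof.
apply: (le_trans (ler_norm_sum _ _ _)); apply: ler_sum => i _; exact: ler_norm_sum.
Qed.

Definition abs_summable t := exists M, forall N, square_sum (fun i j => `|t i j|) N <= M.

Lemma ge0_square_sum_cvg t : (forall i j, 0 <= t i j) ->
  (exists M, forall N, square_sum t N <= M) -> cvgn (square_sum t).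
Proof.
move=> t0 [M HM]; apply: nondecreasing_is_cvgn; first exact: square_sum_nondecreasing.
by exists M => _ [N _ <-].
Qed.

(** The array is the difference of [t + |t|] and [|t|], both nonnegative with bounded square
    sums. *)
Lemma abs_summable_cvg t : abs_summable t -> cvgn (square_sum t).
Proof.
move=> [M HM].
have c1 : cvgn (square_sum (fun i j => `|t i j|)).
  by apply: ge0_square_sum_cvg => //; exists M.
have c2 : cvgn (square_sum (fun i j => t i j + `|t i j|)).
  apply: ge0_square_sum_cvg => [i j|]; first by rewrite -lerBlDl sub0r -normrN ler_norm.
  exists (M + M) => N; rewrite square_sumD lerD //.
  apply: le_trans (HM N); apply: square_sum_le => i j; exact: ler_norm.
have -> : square_sum t =
    (fun N => square_sum (fun i j => t i j + `|t i j|) N - square_sum (fun i j => `|t i j|) N).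
  by apply/funext => N; rewrite square_sumD addrK.
exact: is_cvgB.
Qed.

Lemma abs_summable_le t t' : (forall i j, `|t i j| <= t' i j) ->
  (exists M, forall N, square_sum t' N <= M) -> abs_summable t.
Proof. by move=> H [M HM]; exists M => N; apply: le_trans (HM N); exact: square_sum_le. Qed.

(** The extra row is bounded by the increment from N to N + 1 of the absolute square sums, which
    tends to 0. Such rectangles appear because differentiation in x shifts the row index by one. *)
Lemma abs_summable_rect t (l : R) : abs_summable t -> square_sum t @ \oo --> l ->
  (fun N => \sum_(i < N.+1) \sum_(j < N) t i j) @ \oo --> l.
Proof.
move=> [M HM] tl; have c1 : cvgn (square_sum (fun i j => `|t i j|)).
  by apply: ge0_square_sum_cvg => //; exists M.
set A := square_sum (fun i j => `|t i j|) in c1.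
have AS : (fun N => A N.+1 - A N) @ \oo --> (0 : R).
  rewrite -(subrr (limn A)); apply: cvgB => //.
  by rewrite -cvg_shiftS in c1 |- *; apply: c1.
have -> : (fun N => \sum_(i < N.+1) \sum_(j < N) t i j) =
    (fun N => square_sum t N + (\sum_(j < N) t N j)).
  by apply/funext => N; rewrite big_ord_recr.
rewrite -[l]addr0; apply: cvgD => //.
apply/cvgr0Pnorm_le => e e0; move/cvgr0Pnorm_le : AS => /(_ e e0).
apply: filterS => N; apply: le_trans; rewrite [X in _ <= X]ger0_norm; last first.
  by rewrite subr_ge0 square_sum_nondecreasing.
rewrite /A /square_sum lerBrDl [X in _ <= X]big_ord_recr /=; apply: lerD.
  by apply: ler_sum => i _; rewrite big_ord_recr lerDl.
by rewrite [X in _ <= X]big_ord_recr /= ler_wpDr // ler_norm_sum.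
Qed.

Lemma norm_lim_le (f : nat -> R) (l B : R) : f @ \oo --> l ->
  (forall N, `|f N| <= B) -> `|l| <= B.
Proof.
move=> fl fB; have /cvg_norm nfl := fl.
rewrite -(cvg_lim (@Rhausdorff R) nfl); apply: limr_le; first by apply/cvg_ex; exists `|l|.
exact: nearW.
Qed.

Lemma small_o_derive1 (f : R -> R) x W :
  (forall e : R, 0 < e -> exists2 d : R, 0 < d & forall s, `|s| < d ->
    `|f (x + s) - f x - s * W| <= e * `|s|) -> derive1 f x = W.
Proof.
move=> H; rewrite derive1E; apply: cvg_lim; first exact: Rhausdorff.
apply/cvgrPdist_le => e e0; have [d d0 Hd] := H e e0.
near=> s; have s0 : s != 0 by near: s; exact: nbhs_dnbhs_neq.
have sd : `|s| < d.
  near: s; apply: dnbhs0_lt => //.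
have := Hd _ sd; rewrite /shift /=.
have -> : s *: (1 : R) + x = x + s by rewrite [_ *: _]mulr1 addrC.
rewrite [_ *: _]/(_ * _) => Hs.
rewrite -(ler_pM2r (x := `|s|)) ?normr_gt0 //; apply: le_trans Hs.
rewrite -normrM -normrN; have -> // : - ((W - s^-1 * (f (x + s) - f x)) * s) = f (x + s) - f x - s * W.
by field.
Unshelve. all: by end_near.
Qed.

Definition monom2 a h k : nat -> nat -> R := fun i j => a i j * h ^+ i * k ^+ j.

Lemma real_analytic2_ext u v x y r : 0 < r ->
  (forall h k, `|h| < r -> `|k| < r -> u (x + h) (y + k) = v (x + h) (y + k)) ->
  real_analytic2 u x y -> real_analytic2 v x y.
Proof.
move=> r0 uv [a [s [s0 H]]]; exists a, (Num.min r s); split; first by rewrite lt_min r0.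
move=> h k; rewrite !lt_min => /andP[hr hs] /andP[kr ks].
by rewrite -uv //; exact: H.
Qed.

Lemma real_analytic2_swap u x y : real_analytic2 u x y ->
  real_analytic2 (fun y' x' => u x' y') y x.
Proof.
move=> [a [r [r0 H]]]; exists (fun i j => a j i), r; split => // h k hr kr.
have [[M HM] Hc] := H k h kr hr; split.
  exists M => N; rewrite exchange_big /=; apply: le_trans (HM N).
  by apply: ler_sum => i _; apply: ler_sum => j _; rewrite mulrAC.
have -> : (fun N => \sum_(i < N) \sum_(j < N) a j i * h ^+ i * k ^+ j) =
  (fun N => \sum_(i < N) \sum_(j < N) a i j * k ^+ i * h ^+ j); last exact: Hc.
apply/funext => N; rewrite exchange_big /=; apply: eq_bigr => i _.
by apply: eq_bigr => j _; rewrite mulrAC.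
Qed.

Lemma real_analytic2D u v x y : real_analytic2 u x y -> real_analytic2 v x y ->
  real_analytic2 (fun x y => u x y + v x y) x y.
Proof.
move=> [a [r [r0 Ha]]] [b [s [s0 Hb]]]; exists (fun i j => a i j + b i j), (Num.min r s).
split; first by rewrite lt_min r0.
move=> h k; rewrite !lt_min => /andP[hr hs] /andP[kr ks].
have [[M HM] Hac] := Ha h k hr kr; have [[L HL] Hbc] := Hb h k hs ks; split.
  exists (M + L) => N; apply: le_trans (lerD (HM N) (HL N)).
  rewrite -big_split; apply: ler_sum => i _; rewrite -big_split; apply: ler_sum => j _ /=.
  by rewrite !mulrDl ler_normD.
have -> : (fun N => \sum_(i < N) \sum_(j < N) (a i j + b i j) * h ^+ i * k ^+ j) =
  (fun N => \sum_(i < N) \sum_(j < N) a i j * h ^+ i * k ^+ j +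
            \sum_(i < N) \sum_(j < N) b i j * h ^+ i * k ^+ j); last exact: cvgD.
apply/funext => N; rewrite -big_split; apply: eq_bigr => i _.
by rewrite -big_split; apply: eq_bigr => j _; rewrite !mulrDl.
Qed.

Lemma real_analytic2_y_series u x y (c : nat -> R) r : 0 < r ->
  (forall k, `|k| < r -> (exists M, forall N, \sum_(j < N) `|c j * k ^+ j| <= M)) ->
  (forall h k, `|h| < r -> `|k| < r ->
    (fun N => \sum_(j < N) c j * k ^+ j) @ \oo --> u (x + h) (y + k)) ->
  real_analytic2 u x y.
Proof.
move=> r0 HM Hc; exists (fun i j => if i == 0%N then c j else 0), r; split => // h k hr kr.
(* A general [F] with [F 0 = 0] serves both the terms and their absolute values. The side is N + 1
   because the empty square misses row 0, the only nonzero row. *)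
have E N (F : R -> R) : F 0 = 0 ->
    \sum_(i < N.+1) \sum_(j < N.+1)
      F ((if val i == 0%N then c j else 0) * h ^+ i * k ^+ j) =
    \sum_(j < N.+1) F (c j * k ^+ j).
  move=> F0; rewrite big_ord_recl /= [X in _ + X]big1 ?addr0.
    by apply: eq_bigr => j _; rewrite mulr1.
  by move=> i _; rewrite big1 // => j _; rewrite /= !mul0r.
split.
  have [M HM'] := HM k kr; exists M; case => [|N].
    by rewrite big_ord0; have := HM' 0%N; rewrite big_ord0.
  by rewrite (E _ (fun z => `|z|)) ?normr0.
rewrite -cvg_shiftS /=; under eq_fun do rewrite (E _ id) //.
by have := Hc h k hr kr; rewrite -cvg_shiftS.
Qed.

Lemma real_analytic2_cst c x y : real_analytic2 (fun _ _ => c) x y.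
Proof.
have E N k : \sum_(j < N.+1) (if val j == 0%N then c else 0) * k ^+ j = c.
  rewrite big_ord_recl /= mulr1 big1 ?addr0 // => j _; exact: mul0r.
apply: (@real_analytic2_y_series _ _ _ (fun j => if j == 0%N then c else 0) 1) => //.
  move=> k _; exists `|c|; case => [|N]; first by rewrite big_ord0.
  rewrite big_ord_recl /= mulr1 big1 ?addr0 // => j _; by rewrite mul0r normr0.
move=> h k _ _; rewrite -cvg_shiftS /=; under eq_fun do rewrite E; exact: cvg_cst.
Qed.

Lemma real_analytic2_y x y : real_analytic2 (fun _ y => y) x y.
Proof.
pose c j := if j == 0%N then y else if j == 1%N then 1 else 0 : R.
have E N k : \sum_(j < N.+2) c j * k ^+ j = y + k.
  rewrite !big_ord_recl /= /c /= mulr1 mul1r expr1 big1 ?addr0 // => j _; exact: mul0r.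
have E' N k : \sum_(j < N.+2) `|c j * k ^+ j| = `|y| + `|k|.
  rewrite !big_ord_recl /= /c /= mulr1 mul1r expr1 big1 ?addr0 // => j _.
  by rewrite mul0r normr0.
apply: (@real_analytic2_y_series _ _ _ c 1) => //.
  move=> k _; exists (`|y| + `|k|); case => [|[|N]]; last by rewrite E'.
    by rewrite big_ord0 addr_ge0.
  by rewrite big_ord1 /c /= mulr1 lerDl.
move=> h k _ _; rewrite -(cvg_shiftn 2) /=; under eq_fun do rewrite addn2 E.
exact: cvg_cst.
Qed.

Lemma real_analytic2_x x y : real_analytic2 (fun x _ => x) x y.
Proof. exact: real_analytic2_swap (real_analytic2_y y x). Qed.

(** Geometric series in -k/y, convergent for |k| < y. *)
Lemma real_analytic2_invy x y : 0 < y -> real_analytic2 (fun _ y => y^-1) x y.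
Proof.
move=> y0; pose z k : R := - k / y.
have E N k : \sum_(j < N) y^-1 * (- y^-1) ^+ j * k ^+ j = series (geometric y^-1 (z k)) N.
  rewrite /series /= big_mkord; apply: eq_bigr => j _.
  by rewrite -mulrA -exprMn /= /z !mulNr [k / y]mulrC.
have z1 k : `|k| < y -> `|z k| < 1.
  by move=> ky; rewrite /z normrM normrN normfV (gtr0_norm y0) ltr_pdivrMr ?mul1r.
apply: (@real_analytic2_y_series _ _ _ (fun j => y^-1 * (- y^-1) ^+ j) y) => //.
  move=> k ky; exists (y^-1 / (1 - `|z k|)) => N.
  have -> : \sum_(j < N) `|y^-1 * (- y^-1) ^+ j * k ^+ j| =
      series (geometric y^-1 `|z k|) N.
    rewrite /series /= big_mkord; apply: eq_bigr => j _.
    rewrite -mulrA -exprMn normrM normrX (gtr0_norm (_ : 0 < y^-1)) ?invr_gt0 //.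
    by rewrite /= /z !mulNr [k / y]mulrC.
  rewrite geometric_seriesE ?lt_eqF ?z1 //= ler_pM2r ?invr_gt0 ?subr_gt0 ?z1 //.
  by rewrite ler_piMr ?invr_ge0 ?(ltW y0) // lerBlDr lerDl exprn_ge0.
move=> h k _ ky; under eq_fun do rewrite E.
have -> : (y + k)^-1 = y^-1 * (1 - z k)^-1.
  by rewrite -invfM /z mulNr opprK mulrDr mulr1 mulrCA mulfV ?gt_eqF // mulr1.
exact: (cvg_geometric_series (z1 k ky)).
Qed.

End DoubleSeries.

Section DoubleSeries2.
Variable R : realType.
Implicit Types (a b t : nat -> nat -> R) (u v : R -> R -> R) (x y h k r : R).

(** Absolute convergence at (rho, rho) controls the tail: with s = |h| + |k| <= rho, a term of total
    degree i + j >= 2 is at most (s / rho)^2 times its size at (rho, rho). *)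
Lemma real_analytic2_diff u x y : real_analytic2 u x y ->
  exists p q C d : R, [/\ 0 < d, 0 <= C & forall h k, `|h| < d -> `|k| < d ->
    `|u (x + h) (y + k) - u x y - p * h - q * k| <= C * (`|h| + `|k|) ^+ 2].
Proof.
move=> [a [r [r0 H]]]; have [rho rho0 rE] : exists2 rho : R, 0 < rho & r = 2 * rho by exists (r / 2); lra.
have rhor : `|rho| < r by rewrite gtr0_norm //; lra.
have [[M HM'] _] := H rho rho rhor rhor.
have HM N : square_sum (fun i j => `|monom2 a rho rho i j|) N <= M by exact: HM'.
have M0 : 0 <= M by have := HM' 0%N; rewrite big_ord0.
have key h k : `|h| < rho / 2 -> `|k| < rho / 2 ->
    `|u (x + h) (y + k) - (a 0%N 0%N + a 0%N 1%N * k + a 1%N 0%N * h)| <=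
    M / rho ^+ 2 * (`|h| + `|k|) ^+ 2.
  move=> hd kd; set s : R := `|h| + `|k|.
  have s0 : 0 <= s by rewrite addr_ge0.
  have sr : s <= rho by rewrite /s; lra.
  have hr : `|h| < r by lra.
  have kr : `|k| < r by lra.
  have [_ Hc] := H h k hr kr.
  (* The affine part of the series. Every square of side at least 2 contains all of it, hence the
     shift of the partial sums by 2. *)
  pose lo i j := if (i + j < 2)%N then monom2 a h k i j else 0.
  have El N : square_sum lo N.+2 = a 0%N 0%N + a 0%N 1%N * k + a 1%N 0%N * h.
    rewrite /square_sum big_ord_recl big_ord_recl /= [X in _ + (_ + X)]big1; last first.
      by move=> i _; rewrite big1 // => j _; rewrite /lo /= ltnNge.
    have lo2 i j : (2 <= j)%N -> lo i j = 0.
      by move=> j2; rewrite /lo ltnNge (leq_trans j2 (leq_addl _ _)).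
    rewrite !big_ord_recl /= [X in _ + (_ + X) + _]big1; last by move=> j _; exact: lo2.
    rewrite [X in _ + (_ + (_ + X) + _)]big1; last by move=> j _; exact: lo2.
    by rewrite /lo /monom2 /= /bump /= !expr0 !expr1 !mulr1 !addr0.
  have Hc2 : (fun N => square_sum (fun i j => monom2 a h k i j + - 1 * lo i j) N.+2)
      @ \oo --> u (x + h) (y + k) - (a 0%N 0%N + a 0%N 1%N * k + a 1%N 0%N * h).
    under eq_fun do rewrite square_sumD square_sumZ El mulN1r.
    apply: cvgB; last exact: cvg_cst.
    have -> : (fun N => square_sum (monom2 a h k) N.+2) =
      (fun N => square_sum (monom2 a h k) (N + 2)) by apply/funext => N; rewrite addn2.
    by move: Hc; rewrite -(cvg_shiftn 2).
  apply: (norm_lim_le Hc2) => N; apply: (le_trans (square_sum_norm _ _)).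
  rewrite mulrAC -mulrA mulrC -expr_div_n.
  apply: le_trans (ler_wpM2l (exprn_ge0 2 (divr_ge0 s0 (ltW rho0))) (HM N.+2)).
  rewrite -square_sumZ; apply: square_sum_le => i j; rewrite /lo.
  case: ifP => [_|ij]; first by rewrite mulN1r subrr normr0 mulr_ge0 // exprn_ge0 // divr_ge0 // ltW.
  have ij2 : (2 <= i + j)%N by rewrite leqNgt ij.
  have -> : `|monom2 a rho rho i j| = `|a i j| * rho ^+ (i + j).
    by rewrite /monom2 -mulrA -exprD normrM normrX (gtr0_norm rho0).
  have -> : `|monom2 a h k i j + -1 * 0| = `|a i j| * (`|h| ^+ i * `|k| ^+ j).
    by rewrite mulr0 addr0 /monom2 -mulrA !normrM !normrX.
  rewrite [X in _ <= X]mulrCA; apply: ler_wpM2l => //.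
  have -> : rho ^+ (i + j) = rho ^+ 2 * rho ^+ (i + j - 2) by rewrite -exprD subnKC.
  rewrite mulrA -exprMn divfK ?gt_eqF //.
  apply: (@le_trans _ _ (s ^+ i * s ^+ j)).
    by apply: ler_pM; rewrite ?exprn_ge0 // lerXn2r ?nnegrE // /s ?lerDl ?lerDr.
  rewrite -exprD -(subnKC ij2).
  by rewrite exprD addKn ler_wpM2l ?exprn_ge0 // lerXn2r ?nnegrE // ltW.
(* At h = k = 0 the right-hand side of [key] is 0, which identifies the constant coefficient. *)
have a00 : u x y = a 0%N 0%N.
  apply/eqP; rewrite -subr_eq0 -normr_le0.
  have := key 0 0; rewrite !normr0 !addr0 !mulr0 !addr0 expr0n mulr0 divr_gt0 //.
  by apply.
exists (a 1%N 0%N), (a 0%N 1%N), (M / rho ^+ 2), (rho / 2); split.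
- by rewrite divr_gt0.
- by rewrite divr_ge0 // exprn_ge0 // ltW.
- move=> h k hd kd; have := key h k hd kd; rewrite a00.
  by congr (`|_| <= _); ring.
Qed.

(** The remainder for i + 1 is (h + s) times the remainder for i, plus i s^2 h^(i-1). The constant
    i^2 survives the induction because i^2 + i <= (i + 1)^2. *)
Lemma pow_taylor (h s sg : R) i : 0 < sg -> `|h| <= sg -> `|h + s| <= sg ->
  `|(h + s) ^+ i - h ^+ i - i%:R * s * h ^+ i.-1| <= s ^+ 2 * (i%:R ^+ 2 * sg ^+ i) / sg ^+ 2.
Proof.
move=> sg0 hs hss; elim: i => [|i IH].
  by rewrite !expr0 subrr !mul0r subr0 normr0 expr0n /= mul0r mulr0 mul0r.
have -> : (h + s) ^+ i.+1 - h ^+ i.+1 - i.+1%:R * s * h ^+ i =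
    (h + s) * ((h + s) ^+ i - h ^+ i - i%:R * s * h ^+ i.-1) + i%:R * s ^+ 2 * h ^+ i.-1.
  by case: i {IH} => [|i] /=; rewrite ?exprS ?expr0 -?(natr1 i) -?(natr1 i.+1); ring.
apply: (le_trans (ler_normD _ _)).
have -> : s ^+ 2 * (i.+1%:R ^+ 2 * sg ^+ i.+1) / sg ^+ 2 =
  sg * (s ^+ 2 * (i%:R ^+ 2 * sg ^+ i) / sg ^+ 2) +
  (2 * i%:R + 1) * s ^+ 2 * (sg ^+ i / sg).
  by rewrite (exprS sg i) -(natr1 i); field; rewrite gt_eqF.
apply: lerD; first by rewrite normrM; apply: ler_pM.
case: i {IH} => [|i] /=.
  rewrite !mul0r normr0 expr0 mul1r mulr0 add0r mul1r.
  by rewrite mulr_ge0 ?sqr_ge0 // invr_ge0 ltW.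
rewrite (exprS sg) [sg * _]mulrC mulfK ?gt_eqF // !normrM normr_nat normrX.
rewrite -[`|s| * `|s|]/(`|s| ^+ 2) real_normK ?num_real //.
apply: ler_pM; [by rewrite mulr_ge0 ?sqr_ge0|exact: exprn_ge0| |].
  by apply: ler_wpM2r; [exact: sqr_ge0|rewrite -(natr1 i); have : 0 <= i%:R :> R by []; lra].
by rewrite lerXn2r ?nnegrE // ltW.
Qed.

Lemma natr_le_exp2 i : i%:R <= 2 ^+ i :> R.
Proof. by rewrite -natrX ler_nat ltnW // ltn_expl. Qed.

(** Since i^2 <= 4^i, comparing with the series at 4 sg absorbs the factor i^2 of the Taylor
    estimate. *)
Lemma derx_term (h k s sg c : R) i j : 0 < sg -> `|h| <= sg -> `|h + s| <= sg ->
  `|k| <= 4 * sg ->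
  `|((h + s) ^+ i - h ^+ i - i%:R * s * h ^+ i.-1) * (c * k ^+ j)| <=
  s ^+ 2 / sg ^+ 2 * `|c * (4 * sg) ^+ i * (4 * sg) ^+ j|.
Proof.
move=> sg0 hsg hssg ksg; rewrite normrM.
apply: (le_trans (ler_wpM2r (normr_ge0 _) (pow_taylor i sg0 hsg hssg))).
have rho0 : 0 < 4 * sg by lra.
rewrite !normrM !normrX (gtr0_norm rho0).
have -> : s ^+ 2 * (i%:R ^+ 2 * sg ^+ i) / sg ^+ 2 * (`|c| * `|k| ^+ j) =
  s ^+ 2 / sg ^+ 2 * (`|c| * (i%:R ^+ 2 * sg ^+ i * `|k| ^+ j)) by field; rewrite gt_eqF.
apply: ler_wpM2l; first by apply: divr_ge0; exact: sqr_ge0.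
rewrite -[X in _ <= X]mulrA; apply: ler_wpM2l => //.
apply: ler_pM; [|exact: exprn_ge0| |by rewrite lerXn2r ?nnegrE // ltW].
  by apply: mulr_ge0; [exact: sqr_ge0|apply: exprn_ge0; exact: ltW].
rewrite exprMn ler_wpM2r ?exprn_ge0 ?(ltW sg0) //.
have -> : 4 = 2 * 2 :> R by ring.
by rewrite exprMn expr2 ler_pM ?natr_le_exp2.
Qed.

(** The termwise derivative converges absolutely on a smaller square, and the increments of the
    truncated sums differ from s times its truncations by O(s^2) uniformly in N; so its sum is the
    derivative. *)
Lemma real_analytic2_derx u x y : real_analytic2 u x y ->
  real_analytic2 (fun x y => derive1 (fun x' => u x' y) x) x y.
Proof.
move=> [a [r [r0 H]]]; have [rho rho0 rE] : exists2 rho : R, 0 < rho & r = 2 * rho by exists (r / 2); lra.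
have rhor : `|rho| < r by rewrite gtr0_norm //; lra.
have [[M HM'] _] := H rho rho rhor rhor.
have HM N : square_sum (fun i j => `|monom2 a rho rho i j|) N <= M by exact: HM'.
have M0 : 0 <= M by have := HM' 0%N; rewrite big_ord0.
(* Now r = 8 sg: with |h|, |s| < sg / 2 both h and h + s stay within sg, while the absolute series
   is bounded at rho = 4 sg, as [derx_term] requires. *)
have [sg sg0 rhoE] : exists2 sg : R, 0 < sg & rho = 4 * sg by exists (rho / 4); lra.
pose b i j := i.+1%:R * a i.+1 j.
exists b, (sg / 2); split; first by lra.
move=> h k hr kr.
have hsg : `|h| <= sg by lra.
have ksg : `|k| <= rho by lra.
have shift_le (t : nat -> nat -> R) N : (forall i j, 0 <= t i j) ->
    square_sum (fun i j => t i.+1 j) N <= square_sum t N.+1.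
  move=> t0; rewrite [X in _ <= X]/square_sum big_ord_recl /= ler_wpDl //.
    by apply: sumr_ge0 => j _.
  by apply: ler_sum => i _; rewrite big_ord_recr /= lerDl.
have sumb : abs_summable (monom2 b h k).
  (* From i + 1 <= 2^(i+1) follows (i + 1) |h|^i <= (2 sg)^(i+1) / sg <= rho^(i+1) / sg. *)
  apply: (@abs_summable_le _ _ (fun i j => sg^-1 * `|monom2 a rho rho i.+1 j|)); last first.
    exists (sg^-1 * M) => N; rewrite square_sumZ ler_pM2l ?invr_gt0 //.
    apply: le_trans (HM N.+1); exact: (shift_le (fun i j => `|monom2 a rho rho i j|)).
  move=> i j; rewrite /monom2 /b !normrM !normrX normr_nat (gtr0_norm rho0).
  rewrite -!mulrA mulrCA [X in _ <= X]mulrCA; apply: ler_wpM2l => //.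
  rewrite !mulrA; apply: ler_pM; rewrite ?mulr_ge0 ?exprn_ge0 ?lerXn2r ?nnegrE ?(ltW rho0) //.
  rewrite ler_pdivlMl // mulrCA.
  apply: (@le_trans _ _ (2 ^+ i.+1 * sg ^+ i.+1)).
    apply: ler_pM; rewrite ?mulr_ge0 ?exprn_ge0 ?(ltW sg0) ?natr_le_exp2 //.
    by rewrite (exprS sg); apply: ler_pM; rewrite ?exprn_ge0 ?lerXn2r ?nnegrE // ltW.
  by rewrite -exprMn lerXn2r ?nnegrE //; lra.
split; first exact: sumb.
have cb := abs_summable_cvg sumb; set W : R := limn (square_sum (monom2 b h k)) in cb.
suff -> : derive1 (fun x' => u x' (y + k)) (x + h) = W by exact: cb.
have key s : `|s| < sg / 2 ->
    `|u (x + h + s) (y + k) - u (x + h) (y + k) - s * W| <= M / sg ^+ 2 * s ^+ 2.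
  move=> ssg; have hssg : `|h + s| <= sg by apply: (le_trans (ler_normD _ _)); lra.
  have hr' : `|h| < r by lra.
  have kr' : `|k| < r by lra.
  have hsr' : `|h + s| < r by lra.
  have [S1 C1] := H h k hr' kr'; have [S2 C2] := H (h + s) k hsr' kr'.
  (* The derivative of row i + 1 is row i of [b], so N + 1 rows of [a] against N columns match the N
     by N square of [b]. *)
  have R1 := abs_summable_rect (t := monom2 a h k) S1 C1.
  have R2 := abs_summable_rect (t := monom2 a (h + s) k) S2 C2.
  rewrite -(addrA x); have RW : (fun N => s * square_sum (monom2 b h k) N) @ \oo --> s * W.
    by apply: cvgM => //; exact: cvg_cst.
  apply: (@norm_lim_le _ (fun N => \sum_(i < N.+1) \sum_(j < N) monom2 a (h + s) k i j -
    \sum_(i < N.+1) \sum_(j < N) monom2 a h k i j - s * square_sum (monom2 b h k) N)).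
    by apply: cvgB => //; exact: cvgB.
  move=> N.
  have -> : s * square_sum (monom2 b h k) N =
      \sum_(i < N.+1) \sum_(j < N) (i%:R * s * h ^+ i.-1) * (a i j * k ^+ j).
    rewrite big_ord_recl [X in X + _]big1 ?add0r; last by move=> j _; rewrite !mul0r.
    rewrite -square_sumZ; apply: eq_bigr => i _; apply: eq_bigr => j _.
    by rewrite !lift0 /monom2 /b /=; ring.
  rewrite -!sumrB; apply: (le_trans (ler_norm_sum _ _ _)).
  apply: (@le_trans _ _ (s ^+ 2 / sg ^+ 2 * square_sum (fun i j => `|monom2 a rho rho i j|) N.+1)).
    rewrite -square_sumZ; apply: ler_sum => i _; rewrite -!sumrB.
    apply: (le_trans (ler_norm_sum _ _ _)); rewrite [X in _ <= X]big_ord_recr /=.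
    rewrite ler_wpDr //; first by apply: mulr_ge0 => //; apply: divr_ge0; exact: sqr_ge0.
    apply: ler_sum => j _.
    have -> : monom2 a (h + s) k i j - monom2 a h k i j - i%:R * s * h ^+ i.-1 * (a i j * k ^+ j) =
      ((h + s) ^+ i - h ^+ i - i%:R * s * h ^+ i.-1) * (a i j * k ^+ j) by rewrite /monom2; ring.
    by rewrite /monom2 rhoE; apply: derx_term => //; rewrite -rhoE.
  rewrite mulrC -mulrA [_ * s ^+ 2]mulrC ler_wpM2r //.
  by apply: divr_ge0; exact: sqr_ge0.
apply: small_o_derive1 => e e0; pose K := M / sg ^+ 2 + 1.
have K0 : 0 < K by rewrite /K ltr_wpDl // divr_ge0 // exprn_ge0 // ltW.
exists (Num.min (sg / 2) (e / K)); first by rewrite lt_min !divr_gt0.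
move=> s; rewrite lt_min => /andP[s1 s2]; apply: (le_trans (key s s1)).
have -> : s ^+ 2 = `|s| * `|s| by rewrite -expr2 real_normK ?num_real.
rewrite mulrA ler_wpM2r //; apply: (@le_trans _ _ (K * `|s|)).
  by rewrite ler_wpM2r // /K lerDl.
by rewrite mulrC -ler_pdivlMr // ltW.
Qed.

Lemma real_analytic2_dery u x y : real_analytic2 u x y ->
  real_analytic2 (fun x y => derive1 (fun y' => u x y') y) x y.
Proof. by move=> /real_analytic2_swap /real_analytic2_derx /real_analytic2_swap. Qed.

End DoubleSeries2.

(** * Products of absolutely convergent double series *)

Section CauchyProduct.
Variable R : realType.
Implicit Types (A B : nat -> nat -> R) (u v : R -> R -> R) (x y h k r : R).

Lemma triangle_sum (F : nat -> nat -> R) N :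
  \sum_(i < N) \sum_(p < i.+1) F p (i - p)%N =
  \sum_(p < N) \sum_(q < N) (if (p + q < N)%N then F p q else 0).
Proof.
transitivity (\sum_(i < N) \sum_(p < N) (if (p <= i)%N then F p (i - p)%N else 0)).
  apply: eq_bigr => i _.
  by rewrite (big_ord_widen N (fun p => F p (i - p)%N) (ltn_ord i)) big_mkcond.
rewrite exchange_big /=; apply: eq_bigr => p _.
have pN := ltnW (ltn_ord p).
rewrite -(big_mkord xpredT (fun i => if (p <= i)%N then F p (i - p)%N else 0)).
rewrite (big_cat_nat (n := p)) //= [X in X + _]big_nat_cond big1 ?add0r; last first.
  by move=> i /andP[/andP[_ ip] _]; rewrite leqNgt ip.
rewrite -{1}[val p]add0n big_addn.
rewrite -(big_mkord xpredT (fun q => if (p + q < N)%N then F p q else 0)).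
rewrite [RHS](big_cat_nat (n := N - p)) ?leq_subr //= [X in _ = _ + X]big_nat_cond.
rewrite [X in _ = _ + X]big1 ?addr0; last first.
  by move=> i /andP[/andP[ip _] _]; rewrite ltnNge -leq_subLR ip.
rewrite !big_nat; apply: eq_bigr => q /andP[_ qN].
by rewrite leq_addl addnK -ltn_subRL qN.
Qed.

Definition conv2 A B : nat -> nat -> R := fun i j =>
  \sum_(p < i.+1) \sum_(q < j.+1) A p q * B (i - p)%N (j - q)%N.

Lemma square_sum_conv2 A B N : square_sum (conv2 A B) N =
  \sum_(p < N) \sum_(p' < N) \sum_(q < N) \sum_(q' < N)
    (if (p + p' < N)%N && (q + q' < N)%N then A p q * B p' q' else 0).
Proof.
pose G p p' := \sum_(q < N) \sum_(q' < N) (if (q + q' < N)%N then A p q * B p' q' else 0).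
transitivity (\sum_(i < N) \sum_(p < i.+1) G p (i - p)%N).
  apply: eq_bigr => i _; rewrite exchange_big /=; apply: eq_bigr => p _.
  exact: (triangle_sum (fun q q' => A p q * B (i - p)%N q')).
rewrite triangle_sum; apply: eq_bigr => p _; apply: eq_bigr => p' _.
case: ifP => _ //=; rewrite big1 // => q _; exact: big1.
Qed.

Lemma square_sumM A B N : square_sum A N * square_sum B N =
  \sum_(p < N) \sum_(p' < N) \sum_(q < N) \sum_(q' < N) A p q * B p' q'.
Proof.
rewrite /square_sum mulr_suml; apply: eq_bigr => p _; rewrite mulr_sumr.
apply: eq_bigr => p' _; rewrite mulr_suml; apply: eq_bigr => q _.
by rewrite mulr_sumr.
Qed.

Local Notation abs A := (fun i j => `|A i j|).

(** The products missing from the truncated convolution are those with p + p' >= N or q + q' >= N;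
    the triangle inequality applied to exactly these terms gives the bound. *)
Lemma conv2_diff_le A B N :
  `|square_sum A N * square_sum B N - square_sum (conv2 A B) N| <=
  square_sum (abs A) N * square_sum (abs B) N - square_sum (conv2 (abs A) (abs B)) N.
Proof.
rewrite !square_sumM !square_sum_conv2 -!sumrB.
apply: (le_trans (ler_norm_sum _ _ _)); apply: ler_sum => p _; rewrite -!sumrB.
apply: (le_trans (ler_norm_sum _ _ _)); apply: ler_sum => p' _; rewrite -!sumrB.
apply: (le_trans (ler_norm_sum _ _ _)); apply: ler_sum => q _; rewrite -!sumrB.
apply: (le_trans (ler_norm_sum _ _ _)); apply: ler_sum => q' _.
by case: ifP => _; rewrite ?subrr ?normr0 // !subr0 normrM.
Qed.

(** Two indices below N/2 add up to less than N, so the convolution already contains the full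
    product of the half-size squares. *)
Lemma conv2_lower A B N : (forall i j, 0 <= A i j) -> (forall i j, 0 <= B i j) ->
  square_sum A N./2 * square_sum B N./2 <= square_sum (conv2 A B) N.
Proof.
move=> A0 B0; have hN : (N./2 <= N)%N by rewrite -{2}(odd_double_half N) -addnn addnA leq_addl.
rewrite (square_sum_widen A hN) (square_sum_widen B hN) square_sum_conv2.
rewrite -!/(square_sum (fun i j => if (i < N./2)%N && (j < N./2)%N then _ i j else 0) N).
rewrite square_sumM; apply: ler_sum => p _; apply: ler_sum => p' _.
apply: ler_sum => q _; apply: ler_sum => q' _.
have sumlt i j : (i < N./2)%N -> (j < N./2)%N -> (i + j < N)%N.
  move=> hi hj; apply: (@leq_trans (N./2 + N./2)); last first.
    by rewrite addnn -{2}[N]odd_double_half leq_addl.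
  by rewrite -addSn leq_add // ltnW.
have AB0 : 0 <= A p q * B p' q' by exact: mulr_ge0.
case: (boolP ((p < N./2)%N && _)) => [/andP[h1 h2]|_]; last first.
  by rewrite mul0r; case: ifP.
case: (boolP ((p' < N./2)%N && _)) => [/andP[h3 h4]|_]; last first.
  by rewrite mulr0; case: ifP.
by rewrite !sumlt.
Qed.

Lemma conv2_upper A B N : (forall i j, 0 <= A i j) -> (forall i j, 0 <= B i j) ->
  square_sum (conv2 A B) N <= square_sum A N * square_sum B N.
Proof.
move=> A0 B0; rewrite square_sumM square_sum_conv2.
apply: ler_sum => p _; apply: ler_sum => p' _; apply: ler_sum => q _; apply: ler_sum => q' _.
by case: ifP => _ //; exact: mulr_ge0.
Qed.

Lemma cvg_half : half @ \oo --> \oo.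
Proof.
apply/cvgnyPge => n; exists n.*2 => //= k /= nk.
by rewrite -(doubleK n) half_leq.
Qed.

(** With P(N) the product of the absolute square sums, the error of the truncated convolution is at
    most P(N) - P(N/2), and both terms have the same limit. *)
Lemma conv2_cvg A B (alpha beta : R) : abs_summable A -> abs_summable B ->
  square_sum A @ \oo --> alpha -> square_sum B @ \oo --> beta ->
  abs_summable (conv2 A B) /\ square_sum (conv2 A B) @ \oo --> alpha * beta.
Proof.
move=> SA SB cA cB; have [M HM] := SA; have [L HL] := SB.
have cAa : cvgn (square_sum (abs A)) by apply: ge0_square_sum_cvg.
have cBa : cvgn (square_sum (abs B)) by apply: ge0_square_sum_cvg.
split.
  apply: (@abs_summable_le _ _ (conv2 (abs A) (abs B))).
    move=> i j; apply: (le_trans (ler_norm_sum _ _ _)); apply: ler_sum => p _.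
    apply: (le_trans (ler_norm_sum _ _ _)); apply: ler_sum => q _.
    by rewrite normrM.
  exists (M * L) => N; apply: (le_trans (conv2_upper _ _ _)) => //.
  apply: ler_pM => //; do 2 (apply: sumr_ge0 => ? _) => //.
have E0 : (fun N => square_sum (abs A) N * square_sum (abs B) N -
    square_sum (abs A) N./2 * square_sum (abs B) N./2) @ \oo --> (0 : R).
  have P1 : (fun N => square_sum (abs A) N * square_sum (abs B) N) @ \oo -->
    limn (square_sum (abs A)) * limn (square_sum (abs B)) by exact: cvgM.
  rewrite -(subrr (limn (square_sum (abs A)) * limn (square_sum (abs B)))).
  apply: cvgB => //; exact: (cvg_comp _ _ cvg_half P1).
have cAB : (fun N => square_sum A N * square_sum B N) @ \oo --> alpha * beta.
  exact: cvgM.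
have D0 : (fun N => square_sum A N * square_sum B N - square_sum (conv2 A B) N)
    @ \oo --> (0 : R).
  apply/cvgr0Pnorm_le => e e0; move/cvgr0Pnorm_le : E0 => /(_ e e0).
  apply: filterS => N; apply: le_trans; apply: (le_trans (conv2_diff_le _ _ _)).
  apply: le_trans (ler_norm _); rewrite lerD2l lerN2; exact: conv2_lower.
have -> : square_sum (conv2 A B) = (fun N => square_sum A N * square_sum B N -
    (square_sum A N * square_sum B N - square_sum (conv2 A B) N)).
  by apply/funext => N; rewrite subKr.
by rewrite -[alpha * beta]subr0; apply: cvgB.
Qed.

Lemma real_analytic2M u v x y : real_analytic2 u x y -> real_analytic2 v x y ->
  real_analytic2 (fun x y => u x y * v x y) x y.
Proof.
move=> [a [r [r0 Ha]]] [b [s [s0 Hb]]]; exists (conv2 a b), (Num.min r s).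
split; first by rewrite lt_min r0.
move=> h k; rewrite !lt_min => /andP[hr hs] /andP[kr ks].
have [Sa Ca] := Ha h k hr kr; have [Sb Cb] := Hb h k hs ks.
have E i j : conv2 a b i j * h ^+ i * k ^+ j = conv2 (monom2 a h k) (monom2 b h k) i j.
  rewrite /conv2 !mulr_suml; apply: eq_bigr => p _; rewrite !mulr_suml.
  apply: eq_bigr => q _; rewrite /monom2.
  have pi : (p <= i)%N by rewrite -ltnS.
  have qj : (q <= j)%N by rewrite -ltnS.
  have -> : h ^+ i = h ^+ p * h ^+ (i - p) by rewrite -exprD subnKC.
  have -> : k ^+ j = k ^+ q * k ^+ (j - q) by rewrite -exprD subnKC.
  ring.
have [[M HM] HC] := conv2_cvg (A := monom2 a h k) (B := monom2 b h k) Sa Sb Ca Cb; split.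
  exists M => N; apply: le_trans (HM N); apply: ler_sum => i _; apply: ler_sum => j _.
  by rewrite E.
by under eq_fun do (under eq_bigr do (under eq_bigr do rewrite E)).
Qed.

End CauchyProduct.

(** * Wirtinger differentiability and its calculus *)

Section Wirtinger.
Variables (K : numFieldType) (cj : {rmorphism K -> K}).
Hypothesis norm_cj : forall z, `|cj z| = `|z|.
Implicit Types (u v : K -> K) (t p q a b : K).

(* Naming the filter keeps unification from comparing the two canonical ways of
   equipping a numeric field with a topology. *)
Definition N0 : set_system K := nbhs (0 : K).

Global Instance N0_filter : ProperFilter N0.
Proof. exact: nbhs_pfilter. Qed.

Lemma N0P (P : K -> Prop) :
  (\forall h \near N0, P h) <-> exists2 e : K, 0 < e & forall h, `|h| < e -> P h.
Proof.
split=> [/nbhs_ballP[e e0 He]|[e e0 He]].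
  by exists e => // h he; apply: He; rewrite -ball_normE /= sub0r normrN.
apply/nbhs_ballP; exists e => // h; rewrite -ball_normE /= sub0r normrN; exact: He.
Qed.

Lemma N0_lt e : 0 < e -> \forall h \near N0, `|h| < e.
Proof. by move=> e0; apply/N0P; exists e. Qed.

Lemma N0_id : h @[h --> N0] --> (0 : K).
Proof. exact: cvg_id. Qed.

(* The coefficient functions of Carathéodory's definition of differentiability:
   u(t + h) = u(t) + A(h) h + B(h) conj(h) with A, B continuous at 0. *)
Definition wirtinger u t p q : Prop := exists A B : K -> K,
  [/\ forall h, u (t + h) = u t + A h * h + B h * cj h,
      A h @[h --> N0] --> p & B h @[h --> N0] --> q].

Lemma conj_cvg (A : K -> K) p : A h @[h --> N0] --> p ->
  cj (A h) @[h --> N0] --> cj p.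
Proof.
move=> /cvgrPdist_le H; apply/cvgrPdist_le => e e0; apply: filterS (H e e0) => h.
by rewrite -rmorphB norm_cj.
Qed.

Lemma wirtinger_cont u t p q : wirtinger u t p q ->
  u (t + h) @[h --> N0] --> u t.
Proof.
move=> [A [B [E cA cB]]]; have hc : cj h @[h --> N0] --> cj (0 : K) by apply: conj_cvg; exact: N0_id.
rewrite rmorph0 in hc.
have -> : (fun h => u (t + h)) = (fun h => u t + A h * h + B h * cj h).
  by apply/funext => h; exact: E.
suff : (fun h => u t + A h * h + B h * cj h) @ N0 --> u t + p * 0 + q * 0.
  by rewrite !mulr0 !addr0.
apply: cvgD; last exact: cvgM.
by apply: cvgD; [exact: cvg_cst|apply: cvgM => //; exact: N0_id].
Qed.

Lemma wirtinger_cst c t : wirtinger (fun=> c) t 0 0.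
Proof. by exists (fun=> 0), (fun=> 0); split => [h||]; [rewrite !mul0r !addr0|exact: cvg_cst..]. Qed.

Lemma wirtinger_id t : wirtinger id t 1 0.
Proof.
exists (fun=> 1), (fun=> 0); split => [h||]; [|exact: cvg_cst..].
by rewrite mul0r addr0 mul1r.
Qed.

Lemma wirtingerD u v t p q a b : wirtinger u t p q -> wirtinger v t a b ->
  wirtinger (fun z => u z + v z) t (p + a) (q + b).
Proof.
move=> [A [B [E cA cB]]] [A' [B' [E' cA' cB']]].
exists (fun h => A h + A' h), (fun h => B h + B' h); split; [|exact: cvgD..].
by move=> h; rewrite E E'; ring.
Qed.

Lemma wirtingerM u v t p q a b : wirtinger u t p q -> wirtinger v t a b ->
  wirtinger (fun z => u z * v z) t (p * v t + u t * a) (q * v t + u t * b).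
Proof.
move=> Hu Hv; have cv := wirtinger_cont Hv.
move: Hu Hv => [A [B [E cA cB]]] [A' [B' [E' cA' cB']]].
exists (fun h => A h * v (t + h) + u t * A' h), (fun h => B h * v (t + h) + u t * B' h); split.
- by move=> h; rewrite E E'; ring.
- by apply: cvgD; apply: cvgM => //; exact: cvg_cst.
- by apply: cvgD; apply: cvgM => //; exact: cvg_cst.
Qed.

Lemma wirtinger_sum (I : Type) (s : seq I) (f : I -> K -> K) t (p q : I -> K) :
  (forall i, wirtinger (f i) t (p i) (q i)) ->
  wirtinger (fun z => \sum_(i <- s) f i z) t (\sum_(i <- s) p i) (\sum_(i <- s) q i).
Proof.
move=> H; elim: s => [|i s IH].
  by rewrite !big_nil; under eq_fun do rewrite big_nil; exact: wirtinger_cst.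
by rewrite !big_cons; under eq_fun do rewrite big_cons; exact: wirtingerD.
Qed.

Lemma wirtingerV u t p : wirtinger u t p 0 -> u t != 0 ->
  wirtinger (fun z => (u z)^-1) t (- p / u t ^+ 2) 0.
Proof.
move=> Hu ut0; have cu := wirtinger_cont Hu; move: Hu => [A [B [E cA cB]]].
have cV : (u (t + h))^-1 @[h --> N0] --> (u t)^-1 by exact: cvgV.
have un0 : \forall h \near N0, u (t + h) != 0 by move: cu => /cvgr_neq0 /(_ ut0).
(* The defining identity is required for every h. Where [u (t + h)] vanishes, its inverse is 0 by
   convention and the coefficient of h is the one forced by the identity; h is nonzero there, and
   near 0 this case does not occur. *)
exists (fun h => if u (t + h) == 0 then - (u t)^-1 / h else - A h * (u (t + h))^-1 * (u t)^-1),
       (fun h => if u (t + h) == 0 then 0 else - B h * (u (t + h))^-1 * (u t)^-1); split.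
- move=> h; case: eqVneq => [w0|w0].
    have h0 : h != 0 by apply: contraNneq ut0 => h0; rewrite -w0 h0 addr0.
    by rewrite w0 invr0 mul0r addr0 divfK // subrr.
  have := E h; set w := u (t + h) in w0 * => Ew.
  have Hd : w - u t = A h * h + B h * cj h by rewrite Ew; ring.
  transitivity ((u t)^-1 - (w - u t) * (w^-1 / u t)); first by field; rewrite w0 ut0.
  by rewrite Hd; ring.
- suff : (fun h => - A h * (u (t + h))^-1 * (u t)^-1) @ N0 --> - p / u t ^+ 2.
    apply: cvg_trans; apply: near_eq_cvg; near=> h; rewrite ifN //.
    by near: h.
  rewrite expr2 invfM mulrA; apply: cvgM; last exact: cvg_cst.
  by apply: cvgM => //; exact: cvgN.
- suff : (fun h => - B h * (u (t + h))^-1 * (u t)^-1) @ N0 --> - 0 / u t / u t.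
    rewrite oppr0 !mul0r; apply: cvg_trans; apply: near_eq_cvg; near=> h; rewrite ifN //.
    by near: h.
  apply: cvgM; last exact: cvg_cst.
  by apply: cvgM => //; exact: cvgN.
Unshelve. all: by end_near.
Qed.

Lemma wirtinger_comp u f t p q a (s : K -> K) :
  (forall h, f (t + h) = f t + s h * h) -> s h @[h --> N0] --> a ->
  wirtinger u (f t) p q -> wirtinger (fun z => u (f z)) t (p * a) (q * cj a).
Proof.
move=> Ef cs [A [B [E cA cB]]].
have ch : s h * h @[h --> N0] --> (0 : K).
  by rewrite -(mulr0 a); apply: cvgM => //; exact: N0_id.
exists (fun h => A (s h * h) * s h), (fun h => B (s h * h) * cj (s h)); split.
- by move=> h; rewrite Ef E rmorphM /=; ring.
- by apply: cvgM => //; apply: (cvg_comp _ _ ch cA).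
- by apply: cvgM; [apply: (cvg_comp _ _ ch cB)|exact: conj_cvg].
Qed.

(** The conjugate term is absorbed into the slope as B(h) conj(h) / h, which has the modulus of B(h)
    for nonzero h and therefore tends to 0. *)
Lemma wirtinger_holo f t a : wirtinger f t a 0 ->
  exists2 s : K -> K, forall h, f (t + h) = f t + s h * h & s h @[h --> N0] --> a.
Proof.
move=> [A [B [E cA cB]]].
exists (fun h => A h + B h * (cj h / h)).
  move=> h; have [->|h0] := eqVneq h 0; first by rewrite addr0 !mulr0 addr0.
  by rewrite mulrDl -mulrA divfK // E addrA.
rewrite -[a]addr0; apply: cvgD => //.
apply/cvgr0Pnorm_le => e e0; move/cvgr0Pnorm_le : cB => /(_ e e0).
apply: filterS => h; apply: le_trans; rewrite normrM.
have [->|h0] := eqVneq h 0; first by rewrite invr0 mulr0 normr0 mulr0.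
by rewrite normrM normfV norm_cj mulfV ?normr_eq0 // mulr1.
Qed.

Lemma wirtinger_comp_holo u f t p q a : wirtinger f t a 0 -> wirtinger u (f t) p q ->
  wirtinger (fun z => u (f z)) t (p * a) (q * cj a).
Proof. by move=> /wirtinger_holo[s Es cs] Hu; exact: (wirtinger_comp Es cs Hu). Qed.

(** The quadratic remainder divided by h is put into the coefficient of h; the coefficient of
    conj(h) is constant. *)
Lemma wirtinger_bound u t p q (C e : K) : 0 < e -> 0 <= C ->
  (forall h, `|h| < e -> `|u (t + h) - u t - p * h - q * cj h| <= C * `|h| ^+ 2) ->
  wirtinger u t p q.
Proof.
move=> e0 C0 H.
pose r h := u (t + h) - u t - p * h - q * cj h.
exists (fun h => p + r h / h), (fun=> q); split; last exact: cvg_cst.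
  move=> h; have [->|h0] := eqVneq h 0.
    by rewrite addr0 rmorph0 !mulr0 !addr0.
  by rewrite mulrDl divfK // /r; ring.
rewrite -[X in _ --> X]addr0; apply: cvgD; first exact: cvg_cst.
apply/cvgr0Pnorm_le => d d0.
have C1 : 0 < C + 1 by rewrite ltr_wpDl.
near=> h; have [->|h0] := eqVneq h 0; first by rewrite invr0 mulr0 normr0 ltW.
have he : `|h| < e by near: h; apply: N0_lt.
have hd : `|h| < d / (C + 1) by near: h; apply: N0_lt; exact: divr_gt0.
rewrite normrM normfV ler_pdivrMr ?normr_gt0 //; apply: (le_trans (H h he)).
rewrite expr2 mulrA; apply: ler_wpM2r => //.
apply: (@le_trans _ _ ((C + 1) * `|h|)); first by rewrite ler_wpM2r // lerDl.
by rewrite mulrC -ler_pdivlMr // ltW.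
Unshelve. all: by end_near.
Qed.

Lemma wirtinger_smallo u t p q e : wirtinger u t p q -> 0 < e ->
  exists2 d : K, 0 < d & forall h, `|h| < d ->
    `|u (t + h) - u t - p * h - q * cj h| <= e * `|h|.
Proof.
move=> Hu e0; suff /N0P[d d0 Hd] : \forall h \near N0,
    `|u (t + h) - u t - p * h - q * cj h| <= e * `|h|.
  by exists d.
move: Hu e0 => [A [B [E cA cB]]] e0; have e2 : 0 < e / 2 by rewrite divr_gt0.
move/cvgrPdist_le : cA => /(_ _ e2) cA; move/cvgrPdist_le : cB => /(_ _ e2) cB.
near=> h; have -> : u (t + h) - u t - p * h - q * cj h = - ((p - A h) * h + (q - B h) * cj h).
  by rewrite E; ring.
rewrite normrN (le_trans (ler_normD _ _)) // !normrM norm_cj -mulrDl.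
apply: ler_wpM2r => //; rewrite [X in _ <= X](splitr e); apply: lerD; near: h.
  exact: cA.
exact: cB.
Unshelve. all: by end_near.
Qed.

Lemma wirtinger_ext u v t p q : (exists2 e : K, 0 < e & forall h, `|h| < e -> u (t + h) = v (t + h)) ->
  wirtinger u t p q -> wirtinger v t p q.
Proof.
move=> [e e0 He] [A [B [E cA cB]]].
have uv : \forall h \near N0, u (t + h) = v (t + h).
  by near=> h; apply: He; near: h; exact: N0_lt.
have u0 : u t = v t by have := He 0; rewrite normr0 addr0; apply.
(* Where the functions differ h is nonzero, and the whole increment of [v] is charged to the
   coefficient of h. *)
exists (fun h => if u (t + h) == v (t + h) then A h else (v (t + h) - v t) / h),
       (fun h => if u (t + h) == v (t + h) then B h else 0); split.
- move=> h; case: eqVneq => [<-|neq]; first by rewrite -u0 E.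
  have h0 : h != 0 by apply: contraNneq neq => ->; rewrite addr0 u0.
  by rewrite divfK // mul0r addr0 subrKC.
- apply: cvg_trans cA; apply: near_eq_cvg; near=> h; rewrite ifT //.
  by apply/eqP; near: h.
- apply: cvg_trans cB; apply: near_eq_cvg; near=> h; rewrite ifT //.
  by apply/eqP; near: h.
Unshelve. all: by end_near.
Qed.

End Wirtinger.

(** * Real-analytic functions of a complex variable and the operators on them *)

Section ComplexAnalytic.
Variable R : realType.
Implicit Types (u v : R[i] -> R[i]) (t tau z p q : R[i]).

Lemma norm_conjc z : `|conjc z| = `|z|.
Proof. by case: z => x y; rewrite !normc_def /= sqrrN. Qed.

Lemma norm_complex_le (x y : R) : `|x +i* y| <= (`|x| + `|y|)%:C.
Proof.
have -> : x +i* y = x%:C + 'i%C * y%:C by simpc.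
apply: (le_trans (ler_normD _ _)); rewrite normrM.
have -> : `|'i%C : R[i]| = 1 by rewrite normc_def /= expr0n /= add0r expr1n sqrtr1.
rewrite mul1r !normc_def /= expr0n /= !addr0 !sqrtr_sqr.
by rewrite rmorphD.
Qed.

Lemma norm_Re_le z : `|complex.Re z|%:C <= `|z|.
Proof. exact: normc_ge_Re. Qed.

Lemma norm_Im_le z : `|complex.Im z|%:C <= `|z|.
Proof.
case: z => x y; rewrite normc_def /= lecR -sqrtr_sqr ler_wsqrtr //.
by rewrite lerDr sqr_ge0.
Qed.

Definition locally tau (P : R[i] -> Prop) : Prop :=
  exists2 e : R, 0 < e & forall sigma, `|sigma - tau| < e%:C -> P sigma.

Lemma locally_and tau P Q : locally tau P -> locally tau Q ->
  locally tau (fun s => P s /\ Q s).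
Proof.
move=> [e e0 He] [d d0 Hd]; exists (Num.min e d); first by rewrite lt_min e0.
move=> s; rewrite /Num.min; case: ifP => ed hs; split; try exact: He; try exact: Hd.
  by apply: Hd; apply: lt_trans hs _; rewrite ltcR.
by apply: He; apply: lt_le_trans hs _; rewrite lecR leNgt ed.
Qed.

Lemma locallyW tau (P Q : R[i] -> Prop) : (forall s, P s -> Q s) ->
  locally tau P -> locally tau Q.
Proof. by move=> PQ [e e0 He]; exists e => // s /He /PQ. Qed.

Lemma real_complex_gt0P (e : R[i]) : 0 < e -> exists2 r : R, 0 < r & e = r%:C.
Proof. by case: e => x y; rewrite ltcE /= => /andP[/eqP y0 x0]; exists x; rewrite // y0. Qed.

Lemma locally_upper tau : upper_half_plane R tau -> locally tau (upper_half_plane R).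
Proof.
move=> /= t0; exists (complex.Im tau) => // s hs; rewrite /mkset.
have := le_lt_trans (norm_Im_le (s - tau)) hs; rewrite ltcR raddfB /= => H.
by move: H; rewrite ltr_norml => /andP[]; lra.
Qed.

Lemma real_analytic_ext u v tau : locally tau (fun s => u s = v s) ->
  real_analytic u tau -> real_analytic v tau.
Proof.
move=> [e e0 He] [H1 H2]; have e2 : 0 < e / 2 by lra.
have near (h k : R) : `|h| < e / 2 -> `|k| < e / 2 ->
    u ((complex.Re tau + h) +i* (complex.Im tau + k)) =
    v ((complex.Re tau + h) +i* (complex.Im tau + k)).
  move=> hh hk; apply: He.
  have -> : ((complex.Re tau + h) +i* (complex.Im tau + k)) - tau = h +i* k.
    by case: tau {H1 H2} => a b /=; simpc; congr (_ +i* _); ring.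
  by apply: (le_lt_trans (norm_complex_le _ _)); rewrite ltcR; lra.
split; [apply: real_analytic2_ext H1|apply: real_analytic2_ext H2]; try exact: e2;
  by move=> h k hh hk /=; rewrite near.
Qed.

Lemma real_analytic_cst c tau : real_analytic (fun=> c) tau.
Proof. by split; exact: real_analytic2_cst. Qed.

Lemma real_analytic_id tau : real_analytic id tau.
Proof. by split; [exact: real_analytic2_x|exact: real_analytic2_y]. Qed.

Lemma real_analyticD u v tau : real_analytic u tau -> real_analytic v tau ->
  real_analytic (fun z => u z + v z) tau.
Proof.
move=> [u1 u2] [v1 v2]; split.
  have -> : (fun x y => complex.Re (u (x +i* y) + v (x +i* y))) =
    (fun x y => complex.Re (u (x +i* y)) + complex.Re (v (x +i* y))).
    by apply/funext => x; apply/funext => y; rewrite raddfD.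
  exact: real_analytic2D.
have -> : (fun x y => complex.Im (u (x +i* y) + v (x +i* y))) =
  (fun x y => complex.Im (u (x +i* y)) + complex.Im (v (x +i* y))).
  by apply/funext => x; apply/funext => y; rewrite raddfD.
exact: real_analytic2D.
Qed.

Lemma real_analyticM u v tau : real_analytic u tau -> real_analytic v tau ->
  real_analytic (fun z => u z * v z) tau.
Proof.
move=> [u1 u2] [v1 v2]; split.
  have -> : (fun x y => complex.Re (u (x +i* y) * v (x +i* y))) =
    (fun x y => complex.Re (u (x +i* y)) * complex.Re (v (x +i* y)) +
       (- 1) * (complex.Im (u (x +i* y)) * complex.Im (v (x +i* y)))).
    apply/funext => x; apply/funext => y.
    by case: (u _) => a b; case: (v _) => c d; rewrite mulN1r.
  apply: real_analytic2D; first exact: real_analytic2M.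
  by apply: real_analytic2M; [exact: real_analytic2_cst|exact: real_analytic2M].
have -> : (fun x y => complex.Im (u (x +i* y) * v (x +i* y))) =
  (fun x y => complex.Re (u (x +i* y)) * complex.Im (v (x +i* y)) +
     complex.Im (u (x +i* y)) * complex.Re (v (x +i* y))).
  apply/funext => x; apply/funext => y.
  by case: (u _) => a b; case: (v _) => c d.
by apply: real_analytic2D; exact: real_analytic2M.
Qed.

Lemma real_analyticZ c u tau : real_analytic u tau -> real_analytic (fun z => c * u z) tau.
Proof. by move=> Hu; apply: real_analyticM => //; exact: real_analytic_cst. Qed.

Lemma real_analytic_sum (I : Type) (s : seq I) (f : I -> R[i] -> R[i]) tau :
  (forall i, real_analytic (f i) tau) ->
  real_analytic (fun z => \sum_(i <- s) f i z) tau.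
Proof.
move=> H; elim: s => [|i s IH].
  by under eq_fun do rewrite big_nil; exact: real_analytic_cst.
by under eq_fun do rewrite big_cons; exact: real_analyticD.
Qed.

Lemma real_analytic_conj tau : real_analytic (@conjc R) tau.
Proof.
split; first exact: real_analytic2_x.
have -> : (fun x y : R => complex.Im (conjc (x +i* y))) = (fun x y => (- 1) * y).
  by apply/funext => x; apply/funext => y; rewrite mulN1r.
by apply: real_analytic2M; [exact: real_analytic2_cst|exact: real_analytic2_y].
Qed.

Lemma real_analytic_Im tau : real_analytic (fun z => (complex.Im z)%:C) tau.
Proof. by split; [exact: real_analytic2_y|exact: real_analytic2_cst]. Qed.

Lemma real_analytic_invIm tau : upper_half_plane R tau ->
  real_analytic (fun z => ((complex.Im z)^-1)%:C) tau.
Proof. by move=> t0; split; [exact: real_analytic2_invy|exact: real_analytic2_cst]. Qed.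

Lemma real_analytic_inv_two_i_y tau : upper_half_plane R tau ->
  real_analytic (fun z => (two_i_y z)^-1) tau.
Proof.
move=> t0; have -> : (fun z : R[i] => (two_i_y z)^-1) =
    (fun z => (2%:R * 'i%C)^-1 * ((complex.Im z)^-1)%:C).
  by apply/funext => z; rewrite /two_i_y invfM fmorphV.
by apply: real_analyticZ; exact: real_analytic_invIm.
Qed.

Lemma real_analytic_partial_x u tau : real_analytic u tau -> real_analytic (partial_x u) tau.
Proof.
move=> [H1 H2]; split; [exact: (real_analytic2_derx H1)|exact: (real_analytic2_derx H2)].
Qed.

Lemma real_analytic_partial_y u tau : real_analytic u tau -> real_analytic (partial_y u) tau.
Proof.
move=> [H1 H2]; split; [exact: (real_analytic2_dery H1)|exact: (real_analytic2_dery H2)].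
Qed.

Lemma real_analytic_partial_tau u tau : real_analytic u tau ->
  real_analytic (partial_tau u) tau.
Proof.
move=> Hu; apply: real_analyticM; last exact: real_analytic_cst.
apply: real_analyticD; first exact: real_analytic_partial_x.
have -> : (fun z => - ('i%C * partial_y u z)) = (fun z => - 'i%C * partial_y u z).
  by apply/funext => z; rewrite mulNr.
by apply: real_analyticZ; exact: real_analytic_partial_y.
Qed.

Lemma real_analytic_partial_taubar u tau : real_analytic u tau ->
  real_analytic (partial_taubar u) tau.
Proof.
move=> Hu; apply: real_analyticM; last exact: real_analytic_cst.
apply: real_analyticD; first exact: real_analytic_partial_x.
by apply: real_analyticZ; exact: real_analytic_partial_y.
Qed.

Lemma real_analytic_delta w u tau : upper_half_plane R tau -> real_analytic u tau ->
  real_analytic (delta w u) tau.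
Proof.
move=> t0 Hu; apply: real_analyticD; first exact: real_analytic_partial_tau.
apply: real_analyticM => //; apply: real_analyticZ; exact: real_analytic_inv_two_i_y.
Qed.

Definition wirt u t p q := wirtinger (@conjc R) u t p q.

(** Increments along the real and the imaginary axis give partial_x = p + q and partial_y = i (p -
    q). In particular the coefficients are unique, which is how two expressions of one derivative
    are compared later. *)
Lemma wirt_partial u t p q : wirt u t p q ->
  partial_tau u t = p /\ partial_taubar u t = q.
Proof.
move=> Hu; have small (e : R) : 0 < e -> exists2 d : R, 0 < d & forall h, `|h| < d%:C ->
    `|u (t + h) - u t - p * h - q * conjc h| <= e%:C * `|h|.
  move=> e0; have e0' : 0 < e%:C by rewrite ltcR.
  have [_ /real_complex_gt0P[d d0 ->] Hd] := wirtinger_smallo norm_conjc Hu e0'.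
  by exists d.
have norm_real (s : R) : `|s%:C| = `|s|%:C.
  by rewrite normc_def /= expr0n addr0 sqrtr_sqr.
have norm_imag (s : R) : `|'i%C * s%:C| = `|s|%:C.
  by rewrite normc_def /=; simpc; rewrite /= expr0n add0r sqrtr_sqr.
have tE : t = complex.Re t +i* complex.Im t by case: (t).
(* [pr] stands for the real and the imaginary part at once: both are additive, real-homogeneous and
   bounded by the modulus. *)
have dx (pr : {additive R[i] -> R}) : (forall z, `|pr z|%:C <= `|z|) ->
    (forall (s : R) z, pr (s%:C * z) = s * pr z) ->
    derive1 (fun x : R => pr (u (x +i* complex.Im t))) (complex.Re t) = pr (p + q).
  move=> prle prZ; apply: small_o_derive1 => e e0; have [d d0 Hd] := small e e0.
  exists d => // s sd.
  have -> : pr (u ((complex.Re t + s) +i* complex.Im t)) -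
      pr (u (complex.Re t +i* complex.Im t)) - s * pr (p + q) =
      pr (u (t + s%:C) - u t - p * s%:C - q * conjc s%:C).
    have -> : (complex.Re t + s) +i* complex.Im t = t + s%:C by rewrite {3}tE; simpc.
    have -> : conjc s%:C = s%:C :> R[i] by exact: conjc_real.
    by rewrite -tE -prZ -!raddfB; congr (pr _); ring.
  rewrite -lecR (le_trans (prle _)) // rmorphM /= -norm_real.
  by apply: Hd; rewrite norm_real ltcR.
have dy (pr : {additive R[i] -> R}) : (forall z, `|pr z|%:C <= `|z|) ->
    (forall (s : R) z, pr (s%:C * z) = s * pr z) ->
    derive1 (fun y : R => pr (u (complex.Re t +i* y))) (complex.Im t) =
    pr ('i%C * (p - q)).
  move=> prle prZ; apply: small_o_derive1 => e e0; have [d d0 Hd] := small e e0.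
  exists d => // s sd.
  have -> : pr (u (complex.Re t +i* (complex.Im t + s))) -
      pr (u (complex.Re t +i* complex.Im t)) - s * pr ('i%C * (p - q)) =
      pr (u (t + 'i%C * s%:C) - u t - p * ('i%C * s%:C) - q * conjc ('i%C * s%:C)).
    have -> : complex.Re t +i* (complex.Im t + s) = t + 'i%C * s%:C by rewrite {3}tE; simpc.
    have -> : conjc ('i%C * s%:C) = - ('i%C * s%:C) :> R[i].
      by apply/eqP; rewrite eq_complex /=; apply/andP; split; apply/eqP; ring.
    by rewrite -tE -prZ -!raddfB; congr (pr _); ring.
  rewrite -lecR (le_trans (prle _)) //.
  have -> : (e * `|s|)%:C = e%:C * `|'i%C * s%:C| by rewrite norm_imag -rmorphM.
  by apply: Hd; rewrite norm_imag ltcR.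
have ReZ (s : R) z : complex.Re (s%:C * z) = s * complex.Re z.
  by case: z => a b; rewrite /=; ring.
have ImZ (s : R) z : complex.Im (s%:C * z) = s * complex.Im z.
  by case: z => a b; rewrite /=; ring.
have X : partial_x u t = p + q.
  rewrite /partial_x (dx (@complex.Re R) (@norm_Re_le) ReZ).
  by rewrite (dx (@complex.Im R) (@norm_Im_le) ImZ); case: (p + q).
have Y : partial_y u t = 'i%C * (p - q).
  rewrite /partial_y (dy (@complex.Re R) (@norm_Re_le) ReZ).
  by rewrite (dy (@complex.Im R) (@norm_Im_le) ImZ); case: ('i%C * (p - q)).
have ii : 'i%C * 'i%C = -1 :> R[i] by simpc.
rewrite /partial_tau /partial_taubar X Y !mulrA ii.
by split; field.
Qed.

Lemma complex_expand (P Q : R[i]) (h k : R) :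
  (P - 'i%C * Q) / 2%:R * (h +i* k) + (P + 'i%C * Q) / 2%:R * conjc (h +i* k) =
  P * h%:C + Q * k%:C.
Proof.
have n2 : (2%:R : R[i]) != 0 by rewrite pnatr_eq0.
have -> : h +i* k = h%:C + 'i%C * k%:C by simpc.
have -> : conjc (h%:C + 'i%C * k%:C) = h%:C - 'i%C * k%:C by simpc.
have ii : 'i%C * 'i%C = -1 :> R[i] by simpc.
transitivity (P * h%:C - 'i%C * 'i%C * Q * k%:C); first by field.
by rewrite ii; ring.
Qed.

Lemma real_analytic_wirt u t : real_analytic u t ->
  wirt u t (partial_tau u t) (partial_taubar u t).
Proof.
move=> [/real_analytic2_diff [p1 [q1 [C1 [d1 [d10 C10 H1]]]]]
        /real_analytic2_diff [p2 [q2 [C2 [d2 [d20 C20 H2]]]]]].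
pose P := p1 +i* p2; pose Q := q1 +i* q2.
suff Hw : wirt u t ((P - 'i%C * Q) / 2%:R) ((P + 'i%C * Q) / 2%:R).
  by have [-> ->] := wirt_partial Hw.
have [e [e0 ed1 ed2]] : exists e : R, [/\ 0 < e, e <= d1 & e <= d2].
  by exists (Num.min d1 d2); rewrite lt_min d10 ge_min lexx ge_min lexx orbT.
(* The factor 4 comes from |h| + |k| <= 2 |h + ik|, squared. *)
apply: (@wirtinger_bound _ _ _ _ _ _ ((C1 + C2) * 4)%:C e%:C).
- by rewrite ltcR.
- by rewrite lecR mulr_ge0 // addr_ge0.
move=> [h k] hh.
have h1 : `|h| < e by have := le_lt_trans (norm_Re_le _) hh; rewrite ltcR.
have k1 : `|k| < e by have := le_lt_trans (norm_Im_le _) hh; rewrite ltcR.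
have B1 := H1 h k (lt_le_trans h1 ed1) (lt_le_trans k1 ed1).
have B2 := H2 h k (lt_le_trans h1 ed2) (lt_le_trans k1 ed2).
have tE : t = complex.Re t +i* complex.Im t by case: (t).
rewrite -addrA -opprD complex_expand.
have -> : t + (h +i* k) = (complex.Re t + h) +i* (complex.Im t + k) by rewrite {1}tE; simpc.
have -> : u t = u (complex.Re t +i* complex.Im t) by rewrite -tE.
move: B1 B2; rewrite -!/(complex.Re _) -!/(complex.Im _).
case: (u ((complex.Re t + h) +i* _)) => a b; case: (u (complex.Re t +i* _)) => c d /= B1 B2.
have -> : a +i* b - c +i* d - (P * h%:C + Q * k%:C) =
    (a - c - p1 * h - q1 * k) +i* (b - d - p2 * h - q2 * k).
  by rewrite /P /Q; simpc; congr (_ +i* _); ring.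
apply: (le_trans (norm_complex_le _ _)).
apply: (@le_trans _ _ ((C1 + C2) * (`|h| + `|k|) ^+ 2)%:C).
  by rewrite lecR mulrDl lerD.
rewrite !rmorphM /= -mulrA ler_wpM2l ?lecR ?addr_ge0 //.
have -> : 4%:C = 2%:R ^+ 2 :> R[i] by rewrite -natrX rmorph_nat.
rewrite -exprMn -expr2 lerXn2r ?nnegrE ?mulr_ge0 //; first by rewrite lecR addr_ge0.
rewrite rmorphD mulr_natl mulr2n; apply: lerD; [exact: (norm_Re_le (h +i* k))|exact: (norm_Im_le (h +i* k))].
Qed.

Lemma wirt_ext u v t p q : locally t (fun s => u s = v s) -> wirt u t p q -> wirt v t p q.
Proof.
move=> [e e0 He]; apply: wirtinger_ext; exists e%:C; first by rewrite ltcR.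
by move=> h hh; apply: He; rewrite addrC addKr.
Qed.

End ComplexAnalytic.

(** * The action of SL_2(R) on the half-plane *)

Section Mobius.
Variable R : realType.
Implicit Types (g h : 'M[R]_2) (tau : R[i]).

Lemma det2 g : \det g = g 0 0 * g 1 1 - g 0 1 * g 1 0.
Proof.
rewrite (expand_det_row _ 0) big_ord_recl big_ord1 /cofactor !det_mx11 !mxE /=.
rewrite expr0 mul1r expr1 mulN1r mulrN.
by congr (_ * g _ _ - g _ _ * g _ _); apply/val_inj.
Qed.

Lemma mul2E g h i j : (g *m h) i j = g i 0 * h 0 j + g i 1 * h 1 j.
Proof.
by rewrite !mxE big_ord_recl big_ord1; congr (_ + g _ _ * h _ _); apply/val_inj.
Qed.

Lemma mx2P g h : g 0 0 = h 0 0 -> g 0 1 = h 0 1 -> g 1 0 = h 1 0 -> g 1 1 = h 1 1 -> g = h.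
Proof.
move=> h00 h01 h10 h11; apply/matrixP => i j.
have two (k : 'I_2) : k = 0 \/ k = 1.
  by case: k => [[|[|//]]] Hk; [left|right]; apply/val_inj.
by case: (two i) => ->; case: (two j) => ->.
Qed.

Lemma jfactor_neq0 g tau : \det g = 1 -> upper_half_plane R tau -> jfactor g tau != 0.
Proof.
rewrite det2; case: tau => x y /= dg y0; rewrite /jfactor; simpc.
apply/eqP => -[] e1 e2.
have c0 : g 1 0 = 0 by apply/eqP; move/eqP: e2; rewrite mulf_eq0 (gt_eqF y0) orbF.
move: e1 dg; rewrite c0 mul0r add0r => ->; rewrite !mulr0 subr0 => /eqP.
by rewrite eq_sym oner_eq0.
Qed.

Lemma conjc_affine (a b : R) tau : conjc (a%:C * tau + b%:C) = a%:C * conjc tau + b%:C.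
Proof. by case: tau => x y; simpc. Qed.

Lemma jfactor_conj g tau : conjc (jfactor g tau) = jfactor g (conjc tau).
Proof. exact: conjc_affine. Qed.

Lemma mobius_conj g tau : conjc (mobius g tau) = mobius g (conjc tau).
Proof. by rewrite /mobius -jfactor_conj rmorphM fmorphV; congr (_ / _); exact: conjc_affine. Qed.

(** This expresses c, the derivative of the automorphy factor, through j, conj(j) and y; it is what
    makes the weight term of [delta] cancel the derivative of j^w. *)
Lemma jfactor_two_i_y g tau : jfactor g tau - conjc (jfactor g tau) = jprime g * two_i_y tau.
Proof. by rewrite jfactor_conj two_i_yE /jfactor /jprime; ring. Qed.

Lemma two_i_y_mobius g tau : \det g = 1 -> upper_half_plane R tau ->
  two_i_y (mobius g tau) = two_i_y tau / (jfactor g tau * conjc (jfactor g tau)).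
Proof.
move=> dg t0; have j0 := jfactor_neq0 dg t0.
have j0' : conjc (jfactor g tau) != 0 by rewrite conjc_eq0.
rewrite two_i_yE mobius_conj /mobius -jfactor_conj two_i_yE.
have dgC : (g 0 0)%:C * (g 1 1)%:C - (g 0 1)%:C * (g 1 0)%:C = 1 :> R[i].
  by rewrite -!rmorphM -rmorphB -det2 dg.
rewrite -[X in _ = X / _]mul1r -dgC.
move: j0 j0'; rewrite jfactor_conj /jfactor => j0 j0'.
by field; rewrite j0 j0'.
Qed.

Lemma mobius_upper g tau : \det g = 1 -> upper_half_plane R tau ->
  upper_half_plane R (mobius g tau).
Proof.
move=> dg t0; have := two_i_y_mobius dg t0; have j0 := jfactor_neq0 dg t0.
have n0 : 0 < jfactor g tau * conjc (jfactor g tau).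
  by rewrite -sqr_normc exprn_gt0 // normr_gt0.
have [r r0 ->] := real_complex_gt0P n0.
have nz : 2%:R * 'i%C != 0 :> R[i].
  by rewrite mulf_neq0 ?pnatr_eq0 // eq_complex /= oner_eq0 andbF.
rewrite /two_i_y -[RHS]mulrA => /(mulfI nz).
have -> : (complex.Im tau)%:C / r%:C = (complex.Im tau / r)%:C by rewrite rmorphM fmorphV.
by move=> /complexI E; rewrite /mkset E divr_gt0.
Qed.

Lemma jfactorM g h tau : \det h = 1 -> upper_half_plane R tau ->
  jfactor (g *m h) tau = jfactor g (mobius h tau) * jfactor h tau.
Proof.
move=> dh t0; have j0 := jfactor_neq0 dh t0.
rewrite {1 2}/jfactor mulrDl /mobius -mulrA divfK // !mul2E !rmorphD !rmorphM /=.
by rewrite /jfactor; ring.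
Qed.

Lemma mobiusM g h tau : \det g = 1 -> \det h = 1 -> upper_half_plane R tau ->
  mobius (g *m h) tau = mobius g (mobius h tau).
Proof.
move=> dg dh t0; have j0 := jfactor_neq0 dh t0.
have j1 := jfactor_neq0 dg (mobius_upper dh t0).
rewrite {1}/mobius jfactorM // [RHS]/mobius; apply: (mulIf (mulf_neq0 j1 j0)).
rewrite divfK ?mulf_neq0 // mulrA divfK // !mul2E !rmorphD !rmorphM /=.
have E : mobius h tau * jfactor h tau = (h 0 0)%:C * tau + (h 0 1)%:C.
  by rewrite /mobius divfK.
by rewrite [RHS]mulrDl -[(g 0 0)%:C * mobius h tau * _]mulrA E /jfactor; ring.
Qed.

Lemma mobius1 tau : mobius 1%:M tau = tau.
Proof. by rewrite /mobius /jfactor !mxE /= mul0r add0r mul1r addr0 divr1. Qed.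

Lemma det_inv1 g : \det g = 1 -> \det (invmx g) = 1.
Proof. by move=> dg; rewrite det_inv dg invr1. Qed.

Lemma mobiusK g tau : \det g = 1 -> upper_half_plane R tau ->
  mobius (invmx g) (mobius g tau) = tau.
Proof.
move=> dg t0; rewrite -mobiusM ?det_inv1 // mulVmx ?mobius1 //.
by rewrite unitmxE dg unitr1.
Qed.

End Mobius.

(** * Substitutions on the line, by uniqueness of Lebesgue measure *)

Section DensityPushforward.
Local Open Scope ereal_scope.
Context d d' (T : measurableType d) (T' : measurableType d') (R : realType).
Variables (m : {measure set T -> \bar R}) (phi : T -> T') (w : T -> \bar R).
Hypotheses (mphi : measurable_fun [set: T] phi) (mw : measurable_fun [set: T] w).
Hypothesis w0 : forall x, 0 <= w x.

(** The image under [phi] of the measure with density [w]. The proofs are carried as arguments so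
    that the measure structure can be attached to the expression. A substitution rule then amounts
    to comparing such a measure with Lebesgue measure on intervals. *)
Definition density_pushforward (_ : measurable_fun [set: T] phi)
    (_ : measurable_fun [set: T] w) (_ : forall x, 0 <= w x) (A : set T') : \bar R :=
  \int[m]_(x in phi @^-1` A) w x.

Local Notation M := (density_pushforward mphi mw w0).

Let M0 : M set0 = 0.
Proof. by rewrite /density_pushforward preimage_set0 integral_set0. Qed.

Let M_ge0 A : 0 <= M A.
Proof. by apply: integral_ge0 => x _; exact: w0. Qed.

Let M_sigma_additive : semi_sigma_additive M.
Proof.
move=> F mF tF mUF; rewrite /density_pushforward; apply: cvg_toP.
  apply: ereal_nondecreasing_is_cvgn => a b ab.
  by apply: lee_sum_nneg_natr => // k _ _; apply: integral_ge0.
rewrite preimage_bigcup ge0_integral_bigcup //=.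
- by move=> k; rewrite -[X in measurable X]setTI; exact: mphi.
- exact: measurable_funTS.
- apply/trivIsetP => i j _ _ ij; rewrite -preimage_setI.
  by move/trivIsetP : tF => /(_ _ _ _ _ ij) ->//; rewrite preimage_set0.
Qed.

HB.instance Definition _ := isMeasure.Build _ _ _ M M0 M_ge0 M_sigma_additive.

End DensityPushforward.

Section LineSubstitutions.
Local Open Scope ereal_scope.
Variable R : realType.
Local Notation mu := (@lebesgue_measure R).
Local Notation T := (measurableTypeR R).

Lemma measurable_affine (s b : R) : measurable_fun [set: R] (fun x : R => s * x + b)%R.
Proof. by apply: measurable_funD => //; exact: mulrl_measurable. Qed.

Lemma lebesgue_measure_affine (s b : R) (A : set R) : s != 0%R -> measurable A ->
  mu A = `|s|%:E * mu ((fun x => s * x + b)%R @^-1` A).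
Proof.
move=> s0 mA.
have maff : measurable_fun [set: T] ((fun x => s * x + b)%R : T -> T) := measurable_affine s b.
have mc : measurable_fun [set: T] (cst `|s|%:E : T -> \bar R) by exact: measurable_cst.
have c0 (x : T) : 0 <= (cst `|s|%:E : T -> \bar R) x by rewrite lee_fin.
have mpre B : measurable B -> measurable ((fun x => s * x + b)%R @^-1` B).
  by move=> mB; rewrite -[X in measurable X]setTI; exact: maff.
have ns0 : (`|s| > 0)%R by rewrite normr_gt0.
rewrite (@lebesgue_measure_unique _ (density_pushforward mu maff mc c0)) //; last first.
  move=> _ [[u v] _ <-] /=; rewrite /density_pushforward integral_cst; last exact: mpre.
  rewrite lebesgue_measure_itv /=.
  have [s_gt0|s_lt0|s_eq0] := ltgtP 0%R s; last by rewrite s_eq0 eqxx in s0.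
  - have -> : (fun x => s * x + b)%R @^-1` `]u, v]%classic =
        `]((u - b) / s)%R, ((v - b) / s)%R]%classic.
      apply/seteqP; split=> x /=; rewrite !in_itv /= ltr_pdivrMr // ler_pdivlMr //;
        by rewrite ltrBlDr lerBrDr [(x * s)%R]mulrC.
    rewrite lebesgue_measure_itv /= !lte_fin ltr_pM2r ?invr_gt0 // ltrD2r.
    case: ifP => _; last by rewrite mule0.
    by rewrite -!EFinB -EFinM gtr0_norm //; congr (_%:E); field.
  (* A negative slope reverses the interval and moves its open end to the right. *)
  - have -> : (fun x => s * x + b)%R @^-1` `]u, v]%classic =
        `[((v - b) / s)%R, ((u - b) / s)%R[%classic.
      apply/seteqP; split=> x /=; rewrite !in_itv /= ler_ndivrMr // ltr_ndivlMr //;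
        by rewrite ltrBlDr lerBrDr [(x * s)%R]mulrC andbC.
    rewrite lebesgue_measure_itv /= !lte_fin ltr_nM2r ?invr_lt0 // ltrD2r.
    case: ifP => _; last by rewrite mule0.
    by rewrite -!EFinB -EFinM ltr0_norm //; congr (_%:E); field.
exact: (integral_cst mu (mpre _ mA) `|s|%:E).
Qed.

Lemma integral_affine (s b : R) (f : R -> \bar R) : s != 0%R ->
  measurable_fun [set: R] f -> (forall x, 0 <= f x) ->
  \int[mu]_x f x = `|s|%:E * \int[mu]_x f (s * x + b)%R.
Proof.
move=> s0 mf f0.
have maff : measurable_fun [set: T] ((fun x => s * x + b)%R : T -> T) := measurable_affine s b.
have mT : measurable_fun [set: T] (f : T -> \bar R) := mf.
have := @ge0_integral_pushforward _ _ _ _ R _ maff mu setT f measurableT mT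
  (fun y _ => f0 y).
rewrite preimage_setT => <-.
pose P : {measure set T -> \bar R} := measure_function_pushforward__canonical__measure_function_Measure mu maff.
rewrite -(@ge0_integral_mscale _ _ R P setT measurableT (NngNum (normr_ge0 s)) f mT) //.
apply: eq_measure_integral => A mA _; exact: lebesgue_measure_affine.
Qed.

(** The function 1/y on the positive reals, extended by 0. Writing it with [expR] and [ln] makes it
    measurable on the whole line by composition. *)
Definition invpos (y : R) : R := (\1_(`]0%R, +oo[%classic : set R) y * expR (- ln y))%R.

Lemma invposE y : (0 < y)%R -> invpos y = (y^-1)%R.
Proof.
by move=> y0; rewrite /invpos indicE mem_set /= ?in_itv /= ?y0 // mul1r expRN lnK // posrE.
Qed.

Lemma invpos_le0 y : (y <= 0)%R -> invpos y = 0%R.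
Proof.
move=> y0; rewrite /invpos indicE memNset /= ?mul0r // in_itv /= andbT.
by apply/negP; rewrite -leNgt.
Qed.

Lemma invpos_ge0 y : (0 <= invpos y)%R.
Proof. by rewrite /invpos mulr_ge0 // expR_ge0. Qed.

Lemma measurable_invpos : measurable_fun [set: R] invpos.
Proof.
apply: measurable_funM; first exact: measurable_indic.
apply: (measurableT_comp (@measurable_expR R)); apply: measurableT_comp; first exact: oppr_measurable.
exact: measurable_ln.
Qed.

(** The logarithm carries dy/y to Lebesgue measure: on ]u, v] the fundamental theorem of calculus
    with primitive [ln] gives v - u. *)
Lemma integral_invpos_ln (B : set R) : measurable B ->
  \int[mu]_(y in (@ln R) @^-1` B) (invpos y)%:E = mu B.
Proof.
move=> mB; have mw : measurable_fun [set: T] (EFin \o invpos : T -> \bar R).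
  by apply/measurable_EFinP; exact: measurable_invpos.
have w0 (y : T) : 0 <= (EFin \o invpos : T -> \bar R) y by rewrite lee_fin invpos_ge0.
have mln : measurable_fun [set: T] (@ln R : T -> T) := @measurable_ln R.
rewrite (@lebesgue_measure_unique _ (density_pushforward mu mln mw w0)) //.
move=> _ [[u v] _ <-] /=; rewrite /density_pushforward lebesgue_measure_itv /= lte_fin.
have -> : \int[mu]_(y in (@ln R) @^-1` `]u, v]%classic) (EFin \o invpos) y =
    \int[mu]_(y in `]expR u, expR v]) (y^-1)%:E.
  rewrite [LHS]integral_mkcond [RHS]integral_mkcond; apply: eq_integral => y _.
  rewrite !patchE; have [y0|y0] := ltP 0%R y.
    have -> : (y \in (@ln R) @^-1` `]u, v]%classic) = (y \in `]expR u, expR v]%classic).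
      have yE : y = expR (ln y) by rewrite lnK // posrE.
      have E1 : (expR u < y)%R = (u < ln y)%R by rewrite {1}yE ltr_expR.
      have E2 : (y <= expR v)%R = (ln y <= v)%R by rewrite {1}yE ler_expR.
      by apply/idP/idP; rewrite !inE /= !in_itv /= E1 E2.
    by case: ifP => _ //=; rewrite invposE.
  rewrite /= invpos_le0 // if_same memNset //= in_itv /= => /andP[+ _].
  by apply/negP; rewrite -leNgt (le_trans y0) // expR_ge0.
case: ifP => uv; last first.
  rewrite set_itv_ge ?integral_set0 // bnd_simp -leNgt ler_expR leNgt uv //.
have mV : measurable_fun `]expR u, expR v]%classic (fun y : R => (y^-1)%:E).
  have : measurable_fun `]expR u, expR v]%classic (EFin \o invpos) by exact: measurable_funTS.
  apply: eq_measurable_fun => y; rewrite inE /= in_itv /= => /andP[y0 _].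
  by rewrite invposE // (lt_trans (expR_gt0 u)).
rewrite integral_itv_obnd_cbnd //.
have pos y : (expR u <= y)%R -> (0 < y)%R by exact: lt_le_trans (expR_gt0 u).
rewrite (@continuous_FTC2 _ (fun y => y^-1)%R (@ln R)) ?ltr_expR // ?expRK //.
- apply: continuous_in_subspaceT => y; rewrite inE /= in_itv /= => /andP[/pos y0 _].
  by apply: inv_continuous; rewrite gt_eqF.
- split.
  + move=> y; rewrite in_itv /= => /andP[/ltW/pos y0 _].
    by have [] := is_derive1_ln y0.
  + by apply: cvg_at_right_filter; apply: continuous_ln; exact: expR_gt0.
  + by apply: cvg_at_left_filter; apply: continuous_ln; exact: expR_gt0.
- move=> y; rewrite in_itv /= => /andP[/ltW/pos y0 _].
  by rewrite derive1E; have [_ ->] := is_derive1_ln y0.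
Qed.

Lemma integral_invpos (C : set R) : measurable C ->
  \int[mu]_(y in C) (invpos y)%:E = mu (expR @^-1` C).
Proof.
move=> mC; have mE : measurable (expR @^-1` C).
  by rewrite -[X in measurable X]setTI; exact: measurable_expR.
rewrite -integral_invpos_ln // [LHS]integral_mkcond [RHS]integral_mkcond.
apply: eq_integral => y _; rewrite !patchE; have [y0|y0] := ltP 0%R y.
  suff -> : (y \in (@ln R) @^-1` (expR @^-1` C)) = (y \in C) by [].
  by apply/idP/idP; rewrite !inE /= lnK // posrE.
by rewrite invpos_le0 // !if_same.
Qed.

(** In the coordinate s = ln y, the map y -> k/y is the reflection s -> ln k - s, which preserves
    length. *)
Lemma integral_invpos_inversion (k : R) (C C' : set R) : (0 < k)%R ->
  measurable C -> measurable C' -> (forall y, (0 < y)%R -> C' y <-> C (k / y)%R) ->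
  \int[mu]_(y in C') (invpos y)%:E = \int[mu]_(y in C) (invpos y)%:E.
Proof.
move=> k0 mC mC' CC'; rewrite !integral_invpos //.
have mE : measurable (expR @^-1` C).
  by rewrite -[X in measurable X]setTI; exact: measurable_expR.
rewrite [RHS](@lebesgue_measure_affine (-1)%R (ln k)) ?oppr_eq0 ?oner_eq0 //.
rewrite normrN1 mul1e; congr (mu _); apply/seteqP; split=> s /=.
  move/(CC' _ (expR_gt0 s)); congr C.
  by rewrite mulN1r expRD expRN lnK ?posrE // mulrC.
move=> H; apply/(CC' _ (expR_gt0 s)); move: H; congr C.
by rewrite mulN1r expRD expRN lnK ?posrE // mulrC.
Qed.

End LineSubstitutions.

(** * Hyperbolic area and the maps preserving it *)

Section HyperbolicArea.
Local Open Scope ereal_scope.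
Variable R : realType.
Local Notation mu := (@lebesgue_measure R).
Local Notation T := (measurableTypeR R).
Local Notation H := [set p : R * R | (0 < p.2)%R].

(** The density y^-2 extended by 0, so that Tonelli's theorem applies to integrals over the whole
    plane. *)
Definition area_density (p : R * R) : R := (invpos p.2 ^+ 2)%R.

Lemma area_density_ge0 p : (0 <= area_density p)%R.
Proof. exact: sqr_ge0. Qed.

Lemma measurable_snd_pos : measurable (H : set (T * T)).
Proof.
have -> : H = snd @^-1` (`]0%R, +oo[%classic : set R).
  by apply/seteqP; split=> p /=; rewrite in_itv /= andbT.
rewrite -[X in measurable X]setTI; apply: measurable_snd => //; exact: measurable_itv.
Qed.

Lemma hyperbolic_areaE (A : set (R * R)) :
  hyperbolic_area (H `&` A) =
  \int[mu \x mu]_p (\1_A p * area_density p)%:E.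
Proof.
rewrite /hyperbolic_area integral_mkcond; apply: eq_integral => -[x y] _.
rewrite patchE /area_density /= indicE; have [y0|y0] := ltP 0%R y.
  have -> : ((x, y) \in H `&` A) = ((x, y) \in A).
    by apply/idP/idP; rewrite !inE /=; [case|].
  rewrite invposE // -exprVn; case: ifP => _ /=; first by rewrite mul1r.
  by rewrite mul0r.
rewrite invpos_le0 // expr0n mulr0 memNset //= => -[/= + _].
by apply/negP; rewrite -leNgt.
Qed.

Lemma measurable_area_integrand (A : set (R * R)) (phi : R * R -> R * R) (w : R * R -> R) :
  measurable (A : set (T * T)) -> measurable_fun [set: T * T] (phi : T * T -> T * T) ->
  measurable_fun [set: T * T] (w : T * T -> R) ->
  measurable_fun [set: T * T] (fun p : T * T => (\1_A (phi p) * w p)%:E).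
Proof.
move=> mA mphi mw; apply/measurable_EFinP; apply: measurable_funM => //.
by apply: measurableT_comp mphi; exact: measurable_indic.
Qed.

Lemma measurable_area_density : measurable_fun [set: T * T] (area_density : T * T -> R).
Proof.
have mi : measurable_fun [set: T * T] ((fun p => invpos p.2) : T * T -> R).
  by apply: measurableT_comp; [exact: measurable_invpos|exact: measurable_snd].
by apply: (eq_measurable_fun (fun p : T * T => invpos p.2 * invpos p.2)%R);
  [move=> p _; rewrite /area_density expr2|exact: measurable_funM].
Qed.

Lemma measurable_area_row (A : set (R * R)) (y : R) : measurable (A : set (T * T)) ->
  measurable_fun [set: R] (fun x : R => (\1_A (x, y) * area_density (x, y))%:E).
Proof.
move=> mA.
have m2 := measurable_area_integrand mA (@measurable_id _ _ setT) measurable_area_density.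
exact: (measurableT_comp m2 (pair2_measurable (y : T))).
Qed.

Lemma hyperbolic_area_rows (A : set (R * R)) : measurable (A : set (T * T)) ->
  hyperbolic_area (H `&` A) =
  \int[mu]_y \int[mu]_x (\1_A (x, y) * area_density (x, y))%:E.
Proof.
move=> mA; rewrite hyperbolic_areaE.
have m2 := measurable_area_integrand mA (@measurable_id _ _ setT) measurable_area_density.
apply: (fubini_tonelli2 (fun p : T * T => (\1_A p * area_density p)%:E)) => //.
by move=> p; rewrite lee_fin mulr_ge0 ?area_density_ge0.
Qed.

(** Stated for preimages under a map measurable on the whole plane, so that it passes to
    compositions. *)
Definition area_invariant (phi : R * R -> R * R) :=
  measurable_fun [set: T * T] (phi : T * T -> T * T) /\
  forall A : set (R * R), measurable (A : set (T * T)) ->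
    hyperbolic_area (H `&` (phi @^-1` A)) = hyperbolic_area (H `&` A).

Lemma area_invariant_comp phi psi : area_invariant phi -> area_invariant psi ->
  area_invariant (phi \o psi).
Proof.
move=> [mp Ip] [mq Iq]; split; first exact: measurableT_comp.
move=> A mA; rewrite comp_preimage Iq ?Ip //.
by rewrite -[X in measurable X]setTI; exact: mp.
Qed.

Lemma area_invariant_shift (b : R) : area_invariant (fun p => (p.1 + b, p.2)%R).
Proof.
have mphi : measurable_fun [set: T * T] ((fun p => (p.1 + b, p.2)%R) : T * T -> T * T).
  apply: measurable_fun_pair; last exact: measurable_snd.
  by apply: measurable_funD; [exact: measurable_fst|exact: measurable_cst].
split => // A mA.
have mA' : measurable ((fun p => (p.1 + b, p.2)%R) @^-1` A : set (T * T)).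
  by rewrite -[X in measurable X]setTI; exact: mphi.
rewrite (hyperbolic_area_rows mA') (hyperbolic_area_rows mA); apply: eq_integral => y _.
rewrite [RHS](@integral_affine _ 1%R b (fun x => (\1_A (x, y) * area_density (x, y))%:E)) //.
- rewrite normr1 mul1e; apply: eq_integral => x _; rewrite mul1r.
  by congr (_ * _)%:E; rewrite !indicE; congr (_%:R); apply/idP/idP; rewrite !inE.
- exact: measurable_area_row.
- by move=> x; rewrite lee_fin mulr_ge0 ?area_density_ge0.
Qed.

(* In the coordinates (t, y) with t = x / y the hyperbolic area is dt dy / y. *)
Lemma area_slope_coordinates (A : set (R * R)) : measurable (A : set (T * T)) ->
  hyperbolic_area (H `&` A) =
  \int[mu]_t \int[mu]_(y in [set y : R | A (t * y, y)%R]) (invpos y)%:E.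
Proof.
move=> mA; rewrite (hyperbolic_area_rows mA).
pose phi (p : R * R) := (p.1 * p.2, p.2)%R.
have mphi : measurable_fun [set: T * T] (phi : T * T -> T * T).
  apply: measurable_fun_pair; last exact: measurable_snd.
  by apply: measurable_funM; [exact: measurable_fst|exact: measurable_snd].
have mi : measurable_fun [set: T * T] ((fun p => invpos p.2) : T * T -> R).
  by apply: measurableT_comp; [exact: measurable_invpos|exact: measurable_snd].
have m1 := measurable_area_integrand mA mphi mi.
have f0 (p : T * T) : 0 <= (\1_A (phi p) * invpos p.2)%:E.
  by rewrite lee_fin mulr_ge0 ?invpos_ge0.
transitivity (\int[mu]_y \int[mu]_t (\1_A (phi (t, y)) * invpos y)%:E).
  apply: eq_integral => y _; have [y0|y0] := ltP 0%R (y : R).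
    rewrite (@integral_affine _ (y : R) 0%R (fun x => (\1_A (x, y) * area_density (x, y))%:E)) ?gt_eqF //.
    + rewrite gtr0_norm // -ge0_integralZl //=.
      * apply: eq_integral => t _; rewrite -EFinM /phi /= addr0 [(y * t)%R]mulrC.
        by congr (_%:E); rewrite /area_density /= invposE // expr2; field; rewrite gt_eqF.
      * have mp : measurable_fun [set: T] ((fun x => (y * x + 0)%R) : T -> T) := measurable_affine y 0.
        exact: (measurableT_comp (measurable_area_row y mA) mp).
      * by move=> t _; rewrite lee_fin mulr_ge0 ?area_density_ge0.
      * by rewrite lee_fin ltW.
    + exact: measurable_area_row.
    + by move=> x; rewrite lee_fin mulr_ge0 ?area_density_ge0.
  by apply: eq_integral => t _; rewrite /area_density /= invpos_le0 // expr0n !mulr0.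
have E := @fubini_tonelli _ _ T T R mu mu (fun p => (\1_A (phi p) * invpos p.2)%:E) m1 f0.
rewrite -[LHS]E; apply: eq_integral => t _; rewrite /fubini_F /= [RHS]integral_mkcond.
apply: eq_integral => y _; rewrite patchE indicE /phi /=.
have -> : ((t * y, y)%R \in A) = (y \in [set y : R | A (t * y, y)%R]).
  by apply/idP/idP; rewrite !inE.
by case: ifP => _; rewrite ?mul1r ?mul0r.
Qed.

Lemma measurable_slope_section (A : set (R * R)) (t : R) : measurable (A : set (T * T)) ->
  measurable ([set y | A (t * y, y)%R] : set R).
Proof.
move=> mA; have mf : measurable_fun [set: T] ((fun y => (t * y, y)%R) : T -> T * T).
  by apply: measurable_fun_pair => //; exact: mulrl_measurable.
by have := mf measurableT _ mA; rewrite setTI.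
Qed.

Lemma measurable_slope_integral (A : set (R * R)) : measurable (A : set (T * T)) ->
  measurable_fun [set: R]
    (fun t => \int[mu]_(y in [set y : R | A (t * y, y)%R]) (invpos y)%:E).
Proof.
move=> mA.
pose phi (p : R * R) := (p.1 * p.2, p.2)%R.
have mp : measurable_fun [set: T * T] (phi : T * T -> T * T).
  apply: measurable_fun_pair; last exact: measurable_snd.
  by apply: measurable_funM; [exact: measurable_fst|exact: measurable_snd].
have mj : measurable_fun [set: T * T] ((fun p => invpos p.2) : T * T -> R).
  by apply: measurableT_comp; [exact: measurable_invpos|exact: measurable_snd].
have m1 := measurable_area_integrand mA mp mj.
have f0 (p : T * T) : 0 <= (\1_A (phi p) * invpos p.2)%:E.
  by rewrite lee_fin mulr_ge0 ?invpos_ge0.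
have mF := @measurable_fun_fubini_tonelli_F _ _ T T R mu _ m1 f0.
apply: (eq_measurable_fun (fubini_F mu (fun p : T * T => (\1_A (phi p) * invpos p.2)%:E))).
  move=> t _; rewrite /fubini_F /= [RHS]integral_mkcond.
  apply: eq_integral => y _; rewrite patchE indicE /phi /=.
  have -> : ((t * y, y)%R \in A) = (y \in [set y : R | A (t * y, y)%R]).
    by apply/idP/idP; rewrite !inE.
  by case: ifP => _; rewrite ?mul1r ?mul0r.
exact: mF.
Qed.

(** The map z -> -r/z in real coordinates. *)
Definition circle_inversion (r : R) (p : R * R) : R * R :=
  ((- r * p.1 * invpos (p.1 ^+ 2 + p.2 ^+ 2))%R, (r * p.2 * invpos (p.1 ^+ 2 + p.2 ^+ 2))%R).

(** In slope coordinates the map sends t to -t and, for fixed t, sends y to k/y with k = r / (1 +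
    t^2). Reflection preserves dt and the inversion preserves dy/y. *)
Lemma area_invariant_inversion (r : R) : (0 < r)%R -> area_invariant (circle_inversion r).
Proof.
move=> r0.
have mi : measurable_fun [set: T * T] ((fun p => invpos (p.1 ^+ 2 + p.2 ^+ 2)%R) : T * T -> R).
  apply: measurableT_comp; first exact: measurable_invpos.
  by apply: measurable_funD; apply: measurable_funX; [exact: measurable_fst|exact: measurable_snd].
have mphi : measurable_fun [set: T * T] (circle_inversion r : T * T -> T * T).
  apply: measurable_fun_pair; apply: measurable_funM => //; apply: measurable_funM => //.
split => // A mA.
have mA' : measurable (circle_inversion r @^-1` A : set (T * T)).
  by rewrite -[X in measurable X]setTI; exact: mphi.
rewrite (area_slope_coordinates mA') (area_slope_coordinates mA).
pose G (t : R) : \bar R := \int[mu]_(y in [set y : R | A (t * y, y)%R]) (invpos y)%:E.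
have G0 t : 0 <= G t by apply: integral_ge0 => y _; rewrite lee_fin invpos_ge0.
have mG : measurable_fun [set: R] G by exact: measurable_slope_integral.
rewrite (@integral_affine _ (-1)%R 0%R G) ?oppr_eq0 ?oner_eq0 // normrN1 mul1e.
apply: eq_integral => t _; rewrite /G mulN1r addr0.
have c0 : (0 < 1 + t ^+ 2)%R by rewrite ltr_wpDr ?sqr_ge0.
apply: (@integral_invpos_inversion _ (r / (1 + t ^+ 2))%R).
- by rewrite divr_gt0.
- exact: measurable_slope_section.
- exact: measurable_slope_section.
move=> y y0 /=; rewrite /circle_inversion /=.
have -> : invpos ((t * y) ^+ 2 + y ^+ 2) = ((1 + t ^+ 2) * y ^+ 2)^-1%R.
  by rewrite invposE; [congr (_^-1)%R; ring|rewrite ltr_wpDl ?sqr_ge0 ?exprn_gt0].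
have -> : (- r * (t * y) / ((1 + t ^+ 2) * y ^+ 2) = - t * (r / (1 + t ^+ 2) / y))%R.
  by field; rewrite !gt_eqF.
by have -> : (r * y / ((1 + t ^+ 2) * y ^+ 2) = r / (1 + t ^+ 2) / y)%R
  by field; rewrite !gt_eqF.
Qed.

End HyperbolicArea.

(** * The group action on areas, and unfolding over a fundamental domain *)

Section Covolume.
Variable R : realType.
Local Notation mu := (@lebesgue_measure R).
Local Notation T := (measurableTypeR R).
Local Notation H := [set p : R * R | 0 < p.2].
Implicit Types (g h : 'M[R]_2) (p : R * R) (Gamma : set 'M[R]_2).

Definition mobius2 g p : R * R :=
  (complex.Re (mobius g (p.1 +i* p.2)), complex.Im (mobius g (p.1 +i* p.2))).

Lemma mobius2_upper g p : \det g = 1 -> H p -> H (mobius2 g p).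
Proof. by move=> dg Hp; exact: (mobius_upper dg (_ : upper_half_plane R (p.1 +i* p.2))). Qed.

Lemma mobius2M g h p : \det g = 1 -> \det h = 1 -> H p ->
  mobius2 (g *m h) p = mobius2 g (mobius2 h p).
Proof.
move=> dg dh Hp; by rewrite /mobius2 mobiusM //=; case: (mobius h _).
Qed.

Lemma mobius2K g p : \det g = 1 -> H p -> mobius2 (invmx g) (mobius2 g p) = p.
Proof.
move=> dg Hp; rewrite -mobius2M ?det_inv1 // mulVmx ?unitmxE ?dg ?unitr1 //.
by rewrite /mobius2 mobius1 /=; case: p {Hp}.
Qed.

Lemma complex_circle_inversion (r : R) p : H p ->
  let q := circle_inversion r p in q.1 +i* q.2 = - r%:C / (p.1 +i* p.2).
Proof.
case: p => x y /= y0; have n0 : 0 < x ^+ 2 + y ^+ 2 by rewrite ltr_wpDl ?sqr_ge0 // exprn_gt0.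
have z0 : x +i* y != 0 by rewrite eq_complex /= negb_and (gt_eqF y0) orbT.
apply: (mulIf z0); rewrite divfK // invposE //; simpc.
by congr (_ +i* _); field; rewrite gt_eqF.
Qed.

Lemma circle_inversion_upper (r : R) p : 0 < r -> H p -> H (circle_inversion r p).
Proof.
case: p => x y r0 /= y0; rewrite invposE ?ltr_wpDl ?sqr_ge0 ?exprn_gt0 //.
by rewrite divr_gt0 ?mulr_gt0 // ltr_wpDl ?sqr_ge0 ?exprn_gt0.
Qed.

(** For c = 0 the map is z -> a^2 z + ab, and the scaling is z -> -1/z followed by z -> -a^2/z. For
    nonzero c it is z -> a/c - c^-2 / (z + d/c). Only translations and inversions occur. *)
Lemma mobius2_area_invariant g : \det g = 1 ->
  exists2 phi, area_invariant phi & forall p, H p -> mobius2 g p = phi p.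
Proof.
move=> dg; have [c0|c0] := eqVneq (g 1 0) 0.
  have ad : g 0 0 * g 1 1 = 1 by move: dg; rewrite det2 c0 mulr0 subr0.
  have a0 : g 0 0 != 0 by apply: contra_eqN ad => /eqP ->; rewrite mul0r eq_sym oner_eq0.
  have a2 : 0 < g 0 0 ^+ 2 by rewrite exprn_even_gt0.
  exists ((fun p => (p.1 + g 0 0 * g 0 1, p.2)) \o
    (circle_inversion (g 0 0 ^+ 2) \o circle_inversion 1)).
    apply: area_invariant_comp; first exact: area_invariant_shift.
    by apply: area_invariant_comp; exact: area_invariant_inversion.
  move=> p Hp; rewrite /comp; set q := circle_inversion (g 0 0 ^+ 2) _.
  have Eq : q.1 +i* q.2 = (g 0 0 ^+ 2)%:C * (p.1 +i* p.2).
    rewrite /q complex_circle_inversion; last exact: circle_inversion_upper.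
    rewrite complex_circle_inversion //.
    have z0 : p.1 +i* p.2 != 0 by rewrite eq_complex /= negb_and (gt_eqF Hp) orbT.
    by field.
  have -> : (q.1 + g 0 0 * g 0 1, q.2) =
      (complex.Re (q.1 +i* q.2 + (g 0 0 * g 0 1)%:C), complex.Im (q.1 +i* q.2 + (g 0 0 * g 0 1)%:C)).
    by rewrite /= addr0.
  rewrite Eq /mobius2; suff -> : mobius g (p.1 +i* p.2) =
      (g 0 0 ^+ 2)%:C * (p.1 +i* p.2) + (g 0 0 * g 0 1)%:C by [].
  rewrite /mobius /jfactor c0 mul0r add0r.
  have -> : g 1 1 = (g 0 0)^-1 by apply: (mulfI a0); rewrite ad mulfV.
  by rewrite fmorphV invrK rmorphXn !rmorphM /=; ring.
exists ((fun p => (p.1 + g 0 0 / g 1 0, p.2)) \o (circle_inversion (g 1 0 ^- 2) \o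
    (fun p => (p.1 + g 1 1 / g 1 0, p.2)))).
  apply: area_invariant_comp; first exact: area_invariant_shift.
  apply: area_invariant_comp; last exact: area_invariant_shift.
  by apply: area_invariant_inversion; rewrite invr_gt0 exprn_even_gt0.
move=> p Hp; rewrite /comp; set p' := (p.1 + g 1 1 / g 1 0, p.2).
set q := circle_inversion (g 1 0 ^- 2) _.
have Hp' : H p' by [].
have Eq : q.1 +i* q.2 = - (g 1 0 ^- 2)%:C / (p'.1 +i* p'.2).
  by rewrite /q complex_circle_inversion.
have -> : (q.1 + g 0 0 / g 1 0, q.2) =
    (complex.Re (q.1 +i* q.2 + (g 0 0 / g 1 0)%:C), complex.Im (q.1 +i* q.2 + (g 0 0 / g 1 0)%:C)).
  by rewrite /= addr0.
rewrite Eq /mobius2; suff -> : mobius g (p.1 +i* p.2) =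
    - (g 1 0 ^- 2)%:C / (p'.1 +i* p'.2) + (g 0 0 / g 1 0)%:C by [].
have -> : p'.1 +i* p'.2 = p.1 +i* p.2 + (g 1 1)%:C / (g 1 0)%:C.
  by rewrite -fmorphV -rmorphM /p' /=; simpc.
have j0 := jfactor_neq0 dg (Hp : upper_half_plane R (p.1 +i* p.2)).
have c0' : (g 1 0)%:C != 0 by rewrite eq_complex /= eqxx andbT.
have dgC : (g 0 0)%:C * (g 1 1)%:C - 1 = (g 0 1)%:C * (g 1 0)%:C :> R[i].
  by rewrite -!rmorphM -(rmorph1 (real_complex R)) -rmorphB -dg det2; congr (_%:C); ring.
rewrite /mobius; move: j0; rewrite /jfactor => j0.
set z := p.1 +i* p.2 in j0 *.
have -> : (g 1 0 ^- 2)%:C = ((g 1 0)%:C ^+ 2)^-1 by rewrite fmorphV rmorphXn.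
have -> : (g 0 0 / g 1 0)%:C = (g 0 0)%:C / (g 1 0)%:C by rewrite rmorphM fmorphV.
have z1 : z + (g 1 1)%:C / (g 1 0)%:C != 0.
  apply: contraNneq j0 => E.
  have -> : (g 1 0)%:C * z + (g 1 1)%:C = (g 1 0)%:C * (z + (g 1 1)%:C / (g 1 0)%:C) by field.
  by rewrite E mulr0.
have -> : (g 0 1)%:C = ((g 0 0)%:C * (g 1 1)%:C - 1) / (g 1 0)%:C.
  by rewrite dgC mulfK.
have -> : z + (g 1 1)%:C / (g 1 0)%:C = ((g 1 0)%:C * z + (g 1 1)%:C) / (g 1 0)%:C by field.
by field; rewrite ?c0' ?j0.
Qed.

Lemma mobius2_area g (A : set (R * R)) : \det g = 1 -> measurable (A : set (T * T)) ->
  measurable (H `&` mobius2 g @^-1` A : set (T * T)) /\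
  hyperbolic_area (H `&` mobius2 g @^-1` A) = hyperbolic_area (H `&` A).
Proof.
move=> dg mA; have [phi [mphi Iphi] E] := mobius2_area_invariant dg.
have -> : H `&` mobius2 g @^-1` A = H `&` phi @^-1` A.
  by apply/seteqP; split => p [Hp] /= Ap; split => //=; [rewrite -E|rewrite E].
split; last exact: Iphi.
apply: measurableI; first exact: measurable_snd_pos.
by rewrite -[X in measurable X]setTI; exact: mphi.
Qed.

(** Each element receives some N such that 1/(N + 1) isolates it in [Gamma], together with the
    integer parts of N + 1 times its entries. Two elements with the same code are closer than 1/(N +
    1), hence equal. *)
Lemma discrete_countable Gamma : discrete_subset Gamma -> countable Gamma.
Proof.
move=> dG; have /choice[N HN] : forall g, exists N : nat, Gamma g -> forall h, Gamma h ->
    (forall i j, `|h i j - g i j| < N.+1%:R^-1) -> h = g.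
  move=> g; have [Gg|nGg] := pselect (Gamma g); last by exists 0%N.
  have [e e0 He] := dG g Gg; exists (Num.truncn e^-1) => _ h Gh Hh.
  apply: He => // i j; apply: lt_trans (Hh i j) _.
  rewrite -[X in _ < X]invrK ltf_pV2 ?posrE ?invr_gt0 // truncnS_gt //.
apply/countable_injP.
pose fl (x : R) : int := Num.floor x.
exists (fun g => pickle (N g, fl ((N g).+1%:R * g 0 0), fl ((N g).+1%:R * g 0 1),
  fl ((N g).+1%:R * g 1 0), fl ((N g).+1%:R * g 1 1))).
move=> g h /set_mem Gg /set_mem Gh /(pcan_inj pickleK) [EN E00 E01 E10 E11].
rewrite -EN in E00 E01 E10 E11; apply/esym; apply: HN => // i j.
have n0 : 0 < (N g).+1%:R :> R by rewrite ltr0n.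
have key (x y : R) : fl ((N g).+1%:R * x) = fl ((N g).+1%:R * y) ->
    `|y - x| < (N g).+1%:R^-1.
  move=> E; rewrite -(ltr_pM2l n0) mulfV ?gt_eqF // -{1}(gtr0_norm n0) -normrM mulrBr.
  have h1 := floor_le_tmp ((N g).+1%:R * x); have h2 := floorD1_gt ((N g).+1%:R * x).
  have h3 := floor_le_tmp ((N g).+1%:R * y); have h4 := floorD1_gt ((N g).+1%:R * y).
  rewrite /fl in E; move: h1 h2 h3 h4; rewrite E intrD1 ltr_norml => *.
  by apply/andP; split; lra.
have two (k : 'I_2) : k = 0 \/ k = 1.
  by case: k => [[|[|//]]] Hk; [left|right]; apply/val_inj.
by case: (two i) => ->; case: (two j) => ->; exact: key.
Qed.

Lemma area_le_series (E : set (R * R)) (F : nat -> set (R * R)) :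
  measurable (E : set (T * T)) -> (forall n, measurable (F n : set (T * T))) ->
  H `&` E `<=` \bigcup_n F n ->
  (hyperbolic_area (H `&` E) <= \sum_(n <oo) hyperbolic_area (H `&` F n))%E.
Proof.
move=> mE mF EF; rewrite hyperbolic_areaE.
under eq_eseriesr do rewrite hyperbolic_areaE.
have mi A : measurable (A : set (T * T)) ->
    measurable_fun [set: T * T] (fun p : T * T => (\1_A p * area_density p)%:E).
  by move=> mA; exact: (measurable_area_integrand mA (@measurable_id _ _ setT) (@measurable_area_density R)).
have f0 A (p : T * T) : (0 <= (\1_A p * area_density p)%:E)%E.
  by rewrite lee_fin mulr_ge0 ?area_density_ge0.
rewrite -integral_nneseries //; last by move=> n; exact: mi.
apply: ge0_le_integral => //; first exact: mi.
- by apply: ge0_emeasurable_sum => // n _; exact: mi.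
move=> p _; have [Hp|nHp] := ltP 0 p.2; last first.
  by rewrite /area_density invpos_le0 // expr0n mulr0 nneseries_ge0.
have [Ep|nEp] := pselect (E p); last first.
  by rewrite indicE memNset // mul0r nneseries_ge0.
have [n _ Fnp] := EF p (conj Hp Ep).
apply: le_trans (nneseries_lim_ge n.+1 _) => //.
rewrite big_nat_recr //= [X in (X <= _)%E](_ : _ = (\1_(F n) p * area_density p)%:E).
  by rewrite leeDr // sume_ge0.
by rewrite !indicE !mem_set.
Qed.

(** After exchanging sum and integral, this is the pointwise bound on the overlap of the sets. *)
Lemma series_area_le (A : nat -> set (R * R)) (D : set (R * R)) (M : nat) :
  measurable (D : set (T * T)) -> (forall n, measurable (A n : set (T * T))) ->
  (forall p K, H p -> \sum_(n < K) \1_(A n) p <= M%:R * \1_D p :> R) ->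
  (\sum_(n <oo) hyperbolic_area (H `&` A n) <= M%:R%:E * hyperbolic_area (H `&` D))%E.
Proof.
move=> mD mA HM; rewrite hyperbolic_areaE.
under eq_eseriesr do rewrite hyperbolic_areaE.
have mi B : measurable (B : set (T * T)) ->
    measurable_fun [set: T * T] (fun p : T * T => (\1_B p * area_density p)%:E).
  by move=> mB; exact: (measurable_area_integrand mB (@measurable_id _ _ setT) (@measurable_area_density R)).
have f0 B (p : T * T) : (0 <= (\1_B p * area_density p)%:E)%E.
  by rewrite lee_fin mulr_ge0 ?area_density_ge0.
rewrite -integral_nneseries //; last by move=> n; exact: mi.
rewrite -ge0_integralZl //; last exact: mi.
apply: ge0_le_integral => //.
- by move=> p _; exact: nneseries_ge0.
- by apply: ge0_emeasurable_sum => // n _; exact: mi.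
- by apply: measurable_funeM; exact: mi.
move=> p _; have [Hp|nHp] := ltP 0 p.2; last first.
  have d0 : area_density p = 0 by rewrite /area_density invpos_le0 // expr0n.
  by rewrite eseries0 ?mule_ge0 // => n _ _; rewrite d0 mulr0.
apply: lime_le; first exact: is_cvg_nneseries.
apply: nearW => K; rewrite sumEFin -EFinM lee_fin big_mkord -mulr_suml [X in _ <= X]mulrA.
by rewrite ler_wpM2r ?area_density_ge0 // HM.
Qed.

End Covolume.

Section FiniteOrbit.
Variable R : realType.
Local Notation T := (measurableTypeR R).
Local Notation H := [set p : R * R | 0 < p.2].
Implicit Types (g h : 'M[R]_2) (p : R * R) (Gamma : set 'M[R]_2).

(** Unfolding: E is covered by the pieces E n g^-1 D (n for intersection), each with the area of its
    image gE n D. The sum of these areas is the integral over D of the number of g with g^-1 p in E,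
    a number bounded by M. *)
Lemma area_le_multiplicity Gamma (D E : set (R * R)) (M : nat) :
  SL2_subgroup Gamma -> countable Gamma -> fundamental_domain Gamma D ->
  measurable (E : set (T * T)) ->
  (forall p (s : seq 'M[R]_2), H p -> uniq s ->
     (forall h, h \in s -> Gamma h /\ E (mobius2 h p)) -> (size s <= M)%N) ->
  (hyperbolic_area (H `&` E) <= M%:R%:E * hyperbolic_area D)%E.
Proof.
move=> [dG G1 GM GV] /countable_injP[f finj] [mD DH fD] mE HM.
have mD' : measurable (D : set (T * T)) := mD.
pose S n := [set g | Gamma g /\ f g = n].
(* The element of code n. Codes that are not attained get the default 1, and [F] and [A] are then
   empty, so that 1 is not counted repeatedly. *)
pose g n := xget 1%:M (S n).
have gG n : Gamma (g n) by rewrite /g; case: xgetP => [h _ []|].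
have gf n : (exists h, S n h) -> f (g n) = n.
  by move=> [h Sh]; rewrite /g; case: xgetP => [h' _ []//|/(_ h)].
pose F n := if `[< exists h, S n h >] then E `&` (H `&` mobius2 (g n) @^-1` D) else set0.
pose A n := if `[< exists h, S n h >] then D `&` (H `&` mobius2 (invmx (g n)) @^-1` E) else set0.
have mF n : measurable (F n : set (T * T)).
  rewrite /F; case: ifP => _; last exact: measurable0.
  by apply: measurableI => //; have [] := mobius2_area (dG _ (gG n)) mD'.
have mA n : measurable (A n : set (T * T)).
  rewrite /A; case: ifP => _; last exact: measurable0.
  by apply: measurableI => //; have [] := mobius2_area (det_inv1 (dG _ (gG n))) mE.
have FA n : hyperbolic_area (H `&` F n) = hyperbolic_area (H `&` A n).
  have [_ <-] := mobius2_area (dG _ (gG n)) (mA n).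
  congr (hyperbolic_area _); rewrite /F /A; case: ifP => _; last by rewrite preimage_set0.
  apply/seteqP; split => p.
    move=> [Hp [Ep [_ Dp]]]; split => //; split => //; split; first exact: DH.
    by rewrite /preimage /= mobius2K // dG.
  move=> [Hp [Dp [_ Ep]]]; split => //; split => //.
  by move: Ep; rewrite /preimage /= mobius2K // dG.
have HD : H `&` D = D by apply/setIidr.
rewrite -HD; apply: le_trans (series_area_le mD' mA _).
  under eq_eseriesr do rewrite -FA.
  apply: area_le_series => // p [Hp Ep].
  have [[x y] [[Dxy [h Gh Eh]] _]] := fD (p.1 +i* p.2) Hp.
  have Sh : exists h', S (f h) h' by exists h.
  exists (f h) => //; rewrite /F asboolT //; split => //; split => //.
  have -> : g (f h) = h.
    by apply: finj; rewrite ?inE //; exact: gf.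
  by rewrite /preimage /= /mobius2 -Eh.
move=> p K Hp; have [Dp|nDp] := pselect (D p); last first.
  rewrite [\1_D p]indicE memNset // mulr0 big1 // => n _; rewrite indicE memNset //.
  by rewrite /A; case: ifP => // _ [].
rewrite [\1_D p]indicE mem_set // mulr1.
pose s := [seq n <- iota 0 K | p \in A n].
have sA n : n \in s -> [/\ exists h, S n h, E (mobius2 (invmx (g n)) p) & Gamma (invmx (g n))].
  rewrite mem_filter => /andP[/set_mem + _]; rewrite /A; case: ifP => // /asboolP Sn.
  by move=> [_ [_ Ep]]; split => //; exact: GV.
have -> : \sum_(n < K) \1_(A n) p = (size s)%:R :> R.
  rewrite -sum1_size big_filter natr_sum -(big_mkord xpredT (fun n => \1_(A n) p)) [RHS]big_mkcond.
  by rewrite /index_iota subn0; apply: eq_bigr => n _; rewrite indicE; case: (p \in A n).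
rewrite ler_nat -(size_map (fun n => invmx (g n))); apply: (HM p) => //.
  rewrite map_inj_in_uniq ?filter_uniq ?iota_uniq // => a b /sA[Sa _ _] /sA[Sb _ _] E'.
  have : g a = g b by rewrite -(invmxK (g a)) E' invmxK.
  by move/(congr1 f); rewrite !gf.
by move=> h /mapP[n /sA[_ En Gn] ->].
Qed.

Lemma mobius2_triangular g p : \det g = 1 -> g 1 0 = 0 -> H p ->
  mobius2 g p = (g 0 0 ^+ 2 * p.1 + g 0 0 * g 0 1, g 0 0 ^+ 2 * p.2).
Proof.
move=> dg c0 Hp; have ad : g 0 0 * g 1 1 = 1 by move: dg; rewrite det2 c0 mulr0 subr0.
have a0 : g 0 0 != 0 by apply: contra_eqN ad => /eqP ->; rewrite mul0r eq_sym oner_eq0.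
rewrite /mobius2 /mobius /jfactor c0 mul0r add0r.
have -> : g 1 1 = (g 0 0)^-1 by apply: (mulfI a0); rewrite ad mulfV.
rewrite fmorphV invrK; case: p {Hp} => x y /=; simpc => /=.
by congr (_, _); ring.
Qed.

(** The infinite area lies near the real axis: for slope t in ]0, 1] the section is 0 < y < e/t, of
    infinite mass for dy/y. *)
Lemma area_strip_infinite (e : R) : 0 < e ->
  hyperbolic_area (H `&` [set p | 0 <= p.1 < e]) = +oo%E.
Proof.
move=> e0; have mE : measurable ([set p | 0 <= p.1 < e] : set (T * T)).
  have -> : [set p : T * T | 0 <= p.1 < e] = fst @^-1` (`[0, e[%classic : set R).
    by apply/seteqP; split => p /=; rewrite in_itv.
  by rewrite -[X in measurable X]setTI; apply: measurable_fst => //; exact: measurable_itv.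
rewrite (area_slope_coordinates mE); apply/eqP; rewrite eq_le leey /=.
have -> : +oo%E = (\int[@lebesgue_measure R]_(t in `]0%R, 1%R]%classic) (cst +oo%E) t)%E.
  have L : @lebesgue_measure R `]0%R, 1%R]%classic = 1%:E.
    by rewrite lebesgue_measure_itv /= lte_fin ltr01 sube0.
  rewrite integral_cst //; transitivity (+oo * 1%:E : \bar R)%E; first by rewrite mule1.
  by congr (_ * _)%E; exact/esym.
pose S := [set p : R * R | 0 <= p.1 < e].
pose F (t : T) : \bar R :=
  (\int[@lebesgue_measure R]_(y in [set y : R | S (t * y, y)%R]) (invpos y)%:E)%E.
have f0 (t : T) : (0 <= F t)%E by apply: integral_ge0 => y _; rewrite lee_fin invpos_ge0.
have mf : measurable_fun [set: T] F := measurable_slope_integral mE.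
have sub : (\int[@lebesgue_measure R]_(t in `]0%R, 1%R]%classic) F t <=
    \int[@lebesgue_measure R]_t F t)%E by apply: ge0_subset_integral.
apply: (le_trans _ sub); apply: ge0_le_integral => //; [by move=> ? _; exact: leey|exact: measurable_funTS|].
move=> t /=; rewrite in_itv /= => /andP[t0 _]; rewrite /F integral_invpos; last first.
  exact: (measurable_slope_section t mE).
have -> : expR @^-1` [set y : R | S (t * y, y)] = `]-oo, ln (e / t)[%classic.
  have E s : (0 <= (t : R) * expR s < e) = (s < ln (e / t)).
    rewrite mulr_ge0 ?expR_ge0 ?(ltW t0) //= mulrC -ltr_pdivlMr //.
    by rewrite -{1}(lnK (_ : e / t \is Num.pos)) ?posrE ?divr_gt0 // ltr_expR.
  by apply/seteqP; split => s; rewrite /preimage /= /S /= E in_itv.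
by rewrite lebesgue_measure_itv /= ltNyr.
Qed.

(** Every slope contributes the same positive mass ln(1 + e), and the slopes fill the line. *)
Lemma area_band_infinite (e : R) : 0 < e ->
  hyperbolic_area (H `&` [set p | 1 <= p.2 < 1 + e]) = +oo%E.
Proof.
move=> e0; have mE : measurable ([set p | 1 <= p.2 < 1 + e] : set (T * T)).
  have -> : [set p : T * T | 1 <= p.2 < 1 + e] = snd @^-1` (`[1, 1 + e[%classic : set R).
    by apply/seteqP; split => p /=; rewrite in_itv.
  by rewrite -[X in measurable X]setTI; apply: measurable_snd => //; exact: measurable_itv.
rewrite (area_slope_coordinates mE).
have c0 : 0 < ln (1 + e) by rewrite ln_gt0 // ltrDl.
transitivity (\int[@lebesgue_measure R]_(t in setT) (cst (ln (1 + e))%:E) t)%E.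
  apply: eq_integral => t _; rewrite integral_invpos; last first.
    exact: (measurable_slope_section t mE).
  have -> : expR @^-1` [set y : R | [set p : R * R | 1 <= p.2 < 1 + e] (t * y, y)] =
      `[0, ln (1 + e)[%classic.
    have E1 s : (1 <= expR s) = (0 <= s) :> bool by rewrite -{1}expR0 ler_expR.
    have E2 s : (expR s < 1 + e) = (s < ln (1 + e)) :> bool.
      by rewrite -{1}(lnK (_ : 1 + e \is Num.pos)) ?posrE ?addr_gt0 // ltr_expR.
    by apply/seteqP; split => s /=; rewrite in_itv /= E1 E2.
  by rewrite lebesgue_measure_itv /= lte_fin c0 sube0.
rewrite integral_cst //.
have L : @lebesgue_measure R [set: T] = +oo%E.
  have -> : [set: T] = `]-oo, +oo[%classic by rewrite set_itvNyy.
  by rewrite lebesgue_measure_itv.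
transitivity ((ln (1 + e))%:E * +oo)%E; first by congr (_ * _)%E; exact: L.
by rewrite gt0_muley // lte_fin.
Qed.

End FiniteOrbit.

(** * Discrete triangular groups and the bottom rows of a Fuchsian group *)

Section Directions.
Variable R : realType.
Local Notation T := (measurableTypeR R).
Local Notation H := [set p : R * R | 0 < p.2].
Implicit Types (g h : 'M[R]_2) (p : R * R) (Gamma : set 'M[R]_2).

Lemma invmx2 g : \det g = 1 ->
  [/\ invmx g 0 0 = g 1 1, invmx g 0 1 = - g 0 1, invmx g 1 0 = - g 1 0 & invmx g 1 1 = g 0 0].
Proof.
move=> dg; pose a : 'M[R]_2 := \matrix_(i, j) if i == 0 then (if j == 0 then g 1 1 else - g 0 1)
  else (if j == 0 then - g 1 0 else g 0 0).
have ga : g *m a = 1%:M.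
  by apply: mx2P; rewrite mul2E !mxE /= -?[RHS]dg ?det2; ring.
have ug : g \in unitmx by rewrite unitmxE dg unitr1.
have -> : invmx g = a by rewrite -[LHS]mulmx1 -ga mulKmx.
by rewrite !mxE.
Qed.

(** It is applied where discreteness can only be used on [g *m g]: squaring makes the diagonal
    positive, whereas [g] itself may be close to -1. *)
Lemma triangular_square1 g : \det g = 1 -> g 1 0 = 0 -> g *m g = 1%:M ->
  g = 1%:M \/ g = - 1%:M.
Proof.
move=> dg c0 gg; have ad : g 0 0 * g 1 1 = 1 by move: dg; rewrite det2 c0 mulr0 subr0.
have aa : g 0 0 * g 0 0 = 1.
  by have := congr1 (fun m : 'M[R]_2 => m 0 0) gg; rewrite /= mul2E c0 mulr0 addr0 !mxE.
have := congr1 (fun m : 'M[R]_2 => m 0 1) gg; rewrite /= mul2E !mxE /= => ab.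
have da : g 1 1 = g 0 0 by rewrite -[LHS]mul1r -aa -mulrA ad mulr1.
have a0 : g 0 0 != 0 by apply: contra_eqN ad => /eqP ->; rewrite mul0r eq_sym oner_eq0.
have b0 : g 0 1 = 0.
  by apply: (mulfI a0); move: ab; rewrite da mulr0; lra.
have : (g 0 0 - 1) * (g 0 0 + 1) = 0.
  by transitivity (g 0 0 * g 0 0 - 1); [ring|rewrite aa subrr].
move/eqP; rewrite mulf_eq0 => /orP[/eqP a1|/eqP a1]; [left|right]; apply: mx2P;
  rewrite ?mxE /= ?mulr1n ?mulr0n ?oppr0 ?da ?b0 ?c0 //; lra.
Qed.

Section Triangular.
Variable Gamma : set 'M[R]_2.
Hypotheses (sG : SL2_subgroup Gamma) (dG : discrete_subset Gamma).

Lemma near1_eq1 : exists2 e : R, 0 < e & forall g, Gamma g -> g 1 0 = 0 ->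
  `|g 0 0 - 1| < e -> `|g 1 1 - 1| < e -> `|g 0 1| < e -> g = 1%:M.
Proof.
have [_ G1 _ _] := sG; have [e e0 He] := dG G1; exists e => // g Gg c0 h0 h1 h2.
apply: He => // i j; have two (k : 'I_2) : k = 0 \/ k = 1.
  by case: k => [[|[|//]]] Hk; [left|right]; apply/val_inj.
by case: (two i) => ->; case: (two j) => ->; rewrite !mxE //= ?subr0 // c0 normr0.
Qed.

(* Conjugating a translation by a contracting element of the group makes it
   arbitrarily short. *)
Lemma translation_trivial h u : Gamma h -> h 1 0 = 0 -> `|h 0 0 ^+ 2| < 1 ->
  Gamma u -> u 1 0 = 0 -> u 0 0 = 1 -> u 1 1 = 1 -> u 0 1 = 0.
Proof.
move=> Gh hc ha Gu uc ua ud; have [detG G1 GM GV] := sG.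
have dh := detG _ Gh; have [i00 i01 i10 i11] := invmx2 dh.
have ad : h 0 0 * h 1 1 = 1 by move: dh; rewrite det2 hc mulr0 subr0.
have a0 : h 0 0 != 0 by apply: contra_eqN ad => /eqP ->; rewrite mul0r eq_sym oner_eq0.
have key n : exists v, [/\ Gamma v, v 1 0 = 0, v 0 0 = 1, v 1 1 = 1 &
    v 0 1 = (h 0 0 ^+ 2) ^+ n * u 0 1].
  elim: n => [|n [v [Gv vc va vd vb]]]; first by exists u; rewrite expr0 mul1r.
  exists (h *m v *m invmx h); split.
  - by apply GM; [apply GM|apply GV].
  - by rewrite !mul2E i00 i10 hc vc vd; ring.
  - by rewrite -[RHS]ad !mul2E i00 i10 hc vc va; ring.
  - by rewrite -[RHS]ad !mul2E i01 i11 hc vc vd; ring.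
  - rewrite !mul2E i01 i11 vc va vd vb (exprS (h 0 0 ^+ 2)).
    by rewrite !mulr1 mulr0 addr0; ring.
have [e e0 He] := near1_eq1.
have cv : (fun n => (h 0 0 ^+ 2) ^+ n * u 0 1) @ \oo --> 0.
  rewrite -(mul0r (u 0 1)); apply: cvgM; last exact: cvg_cst.
  exact: cvg_expr.
move/cvgr0Pnorm_lt : cv => /(_ e e0) [n _ Hn].
have [v [Gv vc va vd vb]] := key n.
have v1 : v = 1%:M.
  by apply: He; rewrite // ?va ?vd ?subrr ?normr0 // vb; exact: (Hn n (leqnn n)).
move: vb; rewrite v1 !mxE /= => /esym/eqP.
by rewrite mulf_eq0 !expf_eq0 (negPf a0) !andbF => /eqP.
Qed.

(** The commutator of two triangular matrices is a translation, hence trivial here. The resulting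
    relation says that [g] fixes the point b/(d - a) fixed by [g0]. *)
Lemma hyperbolic_triangular g0 g : Gamma g0 -> g0 1 0 = 0 -> g0 0 0 ^+ 2 != 1 ->
  Gamma g -> g 1 0 = 0 -> g 0 1 * (g0 1 1 - g0 0 0) = g0 0 1 * (g 1 1 - g 0 0).
Proof.
move=> G0 c0 a01 Gg gc; have [detG G1 GM GV] := sG.
have d0 := detG _ G0; have dg := detG _ Gg.
have [i00 i01 i10 i11] := invmx2 d0; have [j00 j01 j10 j11] := invmx2 dg.
have ad0 : g0 0 0 * g0 1 1 = 1 by move: d0; rewrite det2 c0 mulr0 subr0.
have ad : g 0 0 * g 1 1 = 1 by move: dg; rewrite det2 gc mulr0 subr0.
have a0 : g0 0 0 != 0 by apply: contra_eqN ad0 => /eqP ->; rewrite mul0r eq_sym oner_eq0.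
have a1 : g 0 0 != 0 by apply: contra_eqN ad => /eqP ->; rewrite mul0r eq_sym oner_eq0.
(* Either [g0] or its inverse is contracting. *)
have [h [Gh hc ha]] : exists h, [/\ Gamma h, h 1 0 = 0 & `|h 0 0 ^+ 2| < 1].
  have p0 : 0 < g0 0 0 ^+ 2 by rewrite exprn_even_gt0.
  have [lt1|gt1|eq1] := ltgtP (g0 0 0 ^+ 2) 1; last by rewrite eq1 eqxx in a01.
    by exists g0; rewrite gtr0_norm.
  exists (invmx g0); split; [exact: GV|by rewrite i10 c0 oppr0|].
  have -> : invmx g0 0 0 = (g0 0 0)^-1 by rewrite i00; apply: (mulfI a0); rewrite ad0 mulfV.
  by rewrite exprVn gtr0_norm ?invr_gt0 // invf_lt1.
pose u := (g *m g0) *m (invmx g *m invmx g0).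
have Gu : Gamma u by apply GM; apply GM => //; apply GV.
have uE : u 0 1 = g 0 0 * g0 0 0 * (g0 0 1 * (g 0 0 - g 1 1) + g 0 1 * (g0 1 1 - g0 0 0)).
  by rewrite /u !mul2E ?i00 ?i01 ?i10 ?i11 ?j00 ?j01 ?j10 ?j11 c0 gc; ring.
have : u 0 1 = 0.
  apply: (translation_trivial Gh hc ha Gu).
  - by rewrite /u !mul2E ?i00 ?i01 ?i10 ?i11 ?j00 ?j01 ?j10 ?j11 c0 gc; ring.
  - have -> : u 0 0 = (g 0 0 * g 1 1) * (g0 0 0 * g0 1 1).
      by rewrite /u !mul2E ?i00 ?i01 ?i10 ?i11 ?j00 ?j01 ?j10 ?j11 c0 gc; ring.
    by rewrite ad ad0 mulr1.
  - have -> : u 1 1 = (g 0 0 * g 1 1) * (g0 0 0 * g0 1 1).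
      by rewrite /u !mul2E ?i00 ?i01 ?i10 ?i11 ?j00 ?j01 ?j10 ?j11 c0 gc; ring.
    by rewrite ad ad0 mulr1.
rewrite uE => /eqP; rewrite !mulf_eq0 (negPf a0) (negPf a1) /= => /eqP E.
by rewrite -[RHS]addr0 -E; ring.
Qed.

(** If some triangular element is hyperbolic, all of them share its finite fixed point, so the
    scaling factor a^2 controls b, and a thin horizontal band meets its translate only under
    elements whose square is near 1. Otherwise a^2 = 1 throughout, all elements act as translations,
    and a narrow vertical strip serves. *)
Lemma triangular_wandering_set : exists E : set (R * R),
  [/\ measurable (E : set (T * T)), hyperbolic_area (H `&` E) = +oo%E &
   forall g p, Gamma g -> g 1 0 = 0 -> H p -> E p -> E (mobius2 g p) ->
     g = 1%:M \/ g = - 1%:M].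
Proof.
have [detG G1 GM GV] := sG; have [e e0 He] := near1_eq1.
have [[g0 [G0 c0 a01]]|nohyp] :=
    pselect (exists g0, [/\ Gamma g0, g0 1 0 = 0 & g0 0 0 ^+ 2 != 1]).
  have d0 := detG _ G0; have ad0 : g0 0 0 * g0 1 1 = 1 by move: d0; rewrite det2 c0 mulr0 subr0.
  have da0 : g0 1 1 - g0 0 0 != 0.
    by apply: contraNneq a01 => /eqP; rewrite subr_eq0 => /eqP E; rewrite expr2 -{2}E ad0.
  (* The common real fixed point of the triangular elements. *)
  pose kappa := g0 0 1 / (g0 1 1 - g0 0 0).
  (* The upper right entry of [g *m g] will be kappa (r - q) with |r - q| <= 2 d, whence the second
     constraint; the first one bounds the diagonal. *)
  have [d [dpos de dk]] : exists d : R, [/\ 0 < d, d < e & 2 * `|kappa| * d < e].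
    have k0 : 0 < 2 * `|kappa| + 2 by rewrite ltr_wpDl ?mulr_ge0.
    exists (e / (2 * `|kappa| + 2)); split; first exact: divr_gt0.
      rewrite ltr_pdivrMr // -subr_gt0.
      have -> : e * (2 * `|kappa| + 2) - e = e * (2 * `|kappa| + 1) by ring.
      by rewrite mulr_gt0 // ltr_wpDl ?mulr_ge0.
    rewrite mulrA ltr_pdivrMr // -subr_gt0.
    have -> : e * (2 * `|kappa| + 2) - 2 * `|kappa| * e = e * 2 by ring.
    by rewrite mulr_gt0.
  exists [set p | 1 <= p.2 < 1 + d]; split.
  - have -> : [set p : T * T | 1 <= p.2 < 1 + d] = snd @^-1` (`[1, 1 + d[%classic : set R).
      by apply/seteqP; split => p /=; rewrite in_itv.
    by rewrite -[X in measurable X]setTI; apply: measurable_snd => //; exact: measurable_itv.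
  - exact: area_band_infinite.
  move=> g p Gg gc Hp; have dg := detG _ Gg.
  have ad : g 0 0 * g 1 1 = 1 by move: dg; rewrite det2 gc mulr0 subr0.
  rewrite mobius2_triangular //= => /andP[y1 y2] /andP[y3 y4].
  have b : g 0 1 = kappa * (g 1 1 - g 0 0).
    by rewrite /kappa mulrAC -(hyperbolic_triangular G0 c0 a01 Gg gc) mulfK.
  have [q qE] : exists q, q = g 0 0 ^+ 2 by exists (g 0 0 ^+ 2).
  have [r rE] : exists r, r = g 1 1 ^+ 2 by exists (g 1 1 ^+ 2).
  have qr : q * r = 1 by rewrite qE rE -exprMn ad expr1n.
  rewrite -qE in y3 y4.
  have q0 : 0 < q by rewrite lt_neqAle eq_sym qE sqr_ge0 andbT -qE; apply: contra_eqN qr => /eqP ->; rewrite mul0r eq_sym oner_eq0.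
  have r0 : 0 < r by rewrite -(pmulr_rgt0 _ q0) qr.
  (* Both y and q y lie in [1, 1 + d[; hence q <= q y < 1 + d, and r = 1/q satisfies r <= r (q y) =
     y < 1 + d. *)
  have q1 : q < 1 + d by apply: le_lt_trans y4; rewrite ler_peMr // ltW.
  have r1 : r < 1 + d.
    apply: le_lt_trans y2; rewrite -[X in _ <= X]mul1r -qr [q * r]mulrC -mulrA ler_peMr // ltW //.
  (* For x < 1 the bound from below is 1 - x = x (y - 1) < y - 1 < d. *)
  have key (x y : R) : 0 < x -> 0 < y -> x * y = 1 -> x < 1 + d -> y < 1 + d -> `|x - 1| < d.
    move=> x0 yy0 xy x1 yy1; rewrite ltr_norml; apply/andP; split; last by lra.
    have [y1'|y1'] := leP y 1.
      have : 1 <= x by rewrite -xy ler_piMr // ltW.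
      by lra.
    have x1' : x < 1 by rewrite -xy ltr_pMr.
    have : x * (y - 1) < y - 1 by rewrite gtr_pMl // subr_gt0.
    by rewrite mulrBr xy; lra.
  have kq := key _ _ q0 r0 qr q1 r1.
  have kr : `|r - 1| < d by apply: key q0 _ r1 q1 => //; rewrite mulrC.
  apply: triangular_square1 => //; apply: He.
  - exact: GM.
  - by rewrite mul2E gc; ring.
  - by rewrite mul2E gc mulr0 addr0 -expr2 -qE (lt_trans kq).
  - by rewrite mul2E gc mul0r add0r -expr2 -rE (lt_trans kr).
  - have -> : (g *m g) 0 1 = kappa * (r - q) by rewrite mul2E qE rE b; ring.
    apply: le_lt_trans dk; rewrite normrM [2 * _]mulrC -mulrA ler_wpM2l //.
    have -> : r - q = (r - 1) - (q - 1) by ring.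
    by apply: (le_trans (ler_normB _ _)); rewrite mulr_natl mulr2n; apply: lerD; exact: ltW.
exists [set p | 0 <= p.1 < e / 2]; split.
- have -> : [set p : T * T | 0 <= p.1 < e / 2] = fst @^-1` (`[0, e / 2[%classic : set R).
    by apply/seteqP; split => p /=; rewrite in_itv.
  by rewrite -[X in measurable X]setTI; apply: measurable_fst => //; exact: measurable_itv.
- by apply: area_strip_infinite; rewrite divr_gt0.
move=> g p Gg gc Hp; have dg := detG _ Gg.
have ad : g 0 0 * g 1 1 = 1 by move: dg; rewrite det2 gc mulr0 subr0.
have aa : g 0 0 ^+ 2 = 1.
  by apply/eqP; apply: contra_notT nohyp => a1; exists g.
have da : g 1 1 = g 0 0 by rewrite -[LHS]mul1r -aa expr2 -mulrA ad mulr1.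
rewrite mobius2_triangular //= aa mul1r => /andP[x1 x2] /andP[x3 x4].
apply: triangular_square1 => //; apply: He.
- exact: GM.
- by rewrite mul2E gc; ring.
- by rewrite mul2E gc mulr0 addr0 -expr2 aa subrr normr0.
- by rewrite mul2E gc mul0r add0r da -expr2 aa subrr normr0.
(* The entry is 2ab, and |ab| < e/2 because x and x + ab both lie in the strip. *)
- rewrite mul2E da ltr_norml; apply/andP; split; lra.
Qed.

End Triangular.

(** The lexicographic sign of the bottom row, which tells g from -g. *)
Definition row_sign g : bool := (0 < g 1 0) || ((g 1 0 == 0) && (0 < g 1 1)).

Lemma row_signN g : \det g = 1 -> row_sign (- g) = ~~ row_sign g.
Proof.
rewrite det2 /row_sign !mxE !oppr_gt0 oppr_eq0 => dg.
case: (ltgtP (g 1 0) 0) => //= c0.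
case: (ltgtP (g 1 1) 0) => //= d0.
by move: dg; rewrite c0 d0 !mulr0 subrr => /eqP; rewrite eq_sym oner_eq0.
Qed.

(** If every bottom row were proportional to one from [L], two elements carrying p into the
    wandering set with the same class in [L] would differ by a triangular element, hence by a sign.
    At most 2 |L| elements could do so, and unfolding would bound an infinite area by a finite
    one. *)
Lemma fuchsian_new_direction Gamma (L : seq 'M[R]_2) : fuchsian Gamma ->
  (forall x, x \in L -> Gamma x) ->
  exists2 g, Gamma g & forall x, x \in L -> g 1 0 * x 1 1 != g 1 1 * x 1 0.
Proof.
move=> [sG dG [D fD areaD]] LG; have [detG G1 GM GV] := sG.
apply: contrapT => noG.
have allL g : Gamma g -> has (fun x : 'M[R]_2 => g 1 0 * x 1 1 == g 1 1 * x 1 0) L.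
  by move=> Gg; apply: contrapT => /negP /hasPn nh; apply: noG; exists g.
have [E [mE areaE wE]] := triangular_wandering_set sG dG.
have mult p (s : seq 'M[R]_2) : H p -> uniq s ->
    (forall h, h \in s -> Gamma h /\ E (mobius2 h p)) -> (size s <= size L * 2)%N.
  move=> Hp us sE; pose idx (h : 'M[R]_2) := find (fun x : 'M[R]_2 => h 1 0 * x 1 1 == h 1 1 * x 1 0) L.
  pose key (h : 'M[R]_2) := (idx h, row_sign h).
  have -> : (size L * 2 = size (allpairs pair (iota 0 (size L)) [:: true; false]))%N.
    by rewrite size_allpairs size_iota.
  rewrite -(size_map key); apply: uniq_leq_size.
    rewrite map_inj_in_uniq // => h h' /sE[Gh Eh] /sE[Gh' Eh'] [Ei Es].
    have dh := detG _ Gh; have dh' := detG _ Gh'.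
    have hasL : (idx h < size L)%N by rewrite -has_find; exact: allL.
    have hx := nth_find h (allL _ Gh); rewrite -/(idx h) /= in hx.
    have hx' := nth_find h (allL _ Gh'); rewrite -/(idx h') /= -Ei in hx'.
    have dx := detG _ (LG _ (mem_nth h hasL)).
    set x := nth h L (idx h) in hx hx' dx.
    have [i00 i01 i10 i11] := invmx2 dh.
    (* This entry is, up to order, the determinant of the two bottom rows. Both are proportional to
       the bottom row of x, which is nonzero as det x = 1: the determinant times either entry of
       that row vanishes. *)
    have g10 : (h' *m invmx h) 1 0 = 0.
      rewrite mul2E i00 i10; move: dx; rewrite det2; move/eqP: hx; move/eqP: hx' => e' e dx.
      have E1 : (h' 1 0 * h 1 1 - h' 1 1 * h 1 0) * x 1 0 = 0.
        transitivity (h' 1 0 * (h 1 1 * x 1 0) - (h' 1 1 * x 1 0) * h 1 0); first by ring.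
        by rewrite -e -e'; ring.
      have E2 : (h' 1 0 * h 1 1 - h' 1 1 * h 1 0) * x 1 1 = 0.
        transitivity ((h' 1 0 * x 1 1) * h 1 1 - h' 1 1 * (h 1 0 * x 1 1)); first by ring.
        by rewrite e e'; ring.
      rewrite mulrN -[LHS]mulr1 -dx.
      transitivity (x 0 0 * ((h' 1 0 * h 1 1 - h' 1 1 * h 1 0) * x 1 1) -
        x 0 1 * ((h' 1 0 * h 1 1 - h' 1 1 * h 1 0) * x 1 0)); first by ring.
      by rewrite E1 E2 !mulr0 subrr.
    have uh : h \in unitmx by rewrite unitmxE dh unitr1.
    have h'E : h' = (h' *m invmx h) *m h by rewrite mulmxKV.
    have Gg : Gamma (h' *m invmx h) by apply GM => //; apply GV.
    have dg := detG _ Gg.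
    have Eg : E (mobius2 (h' *m invmx h) (mobius2 h p)).
      by rewrite -mobius2M // -h'E.
    have [g1|gN1] := wE _ _ Gg g10 (mobius2_upper dh Hp) Eh Eg.
      by rewrite h'E g1 mul1mx.
    have : h' = - h by rewrite h'E gN1 mulNmx mul1mx.
    by move=> hN; move: Es; rewrite hN row_signN //; case: (row_sign h).
  move=> _ /mapP[h /sE[Gh _] ->]; apply/allpairsP; exists (key h); split => //=.
    by rewrite mem_iota /= add0n -has_find; exact: allL.
  by rewrite !inE; case: (row_sign h).
have := area_le_multiplicity sG (discrete_countable dG) fD mE mult.
by rewrite areaE leye_eq lt_eqF // lte_mul_pinfty // lee_fin.
Qed.

(** For every tau, c/(c tau + d) = c'/(c' tau + d') reduces to c d' = c' d, so non-proportional
    bottom rows give distinct values at all points simultaneously. *)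
Lemma fuchsian_directions Gamma (N : nat) : fuchsian Gamma ->
  exists s : seq 'M[R]_2, [/\ size s = N, forall g, g \in s -> Gamma g &
    forall tau, upper_half_plane R tau -> uniq [seq jprime g / jfactor g tau | g <- s]].
Proof.
move=> fG; have [[detG _ _ _] _ _] := fG.
elim: N => [|N [s [sN sG us]]]; first by exists [::].
have [g Gg gs] := fuchsian_new_direction fG sG.
exists (g :: s); split; first by rewrite /= sN.
  by move=> h; rewrite inE => /orP[/eqP ->|/sG].
move=> tau t0 /=; rewrite us // andbT; apply/negP => /mapP[x xs].
have jg := jfactor_neq0 (detG _ Gg) t0; have jx := jfactor_neq0 (detG _ (sG _ xs)) t0.
move/eqP; rewrite eqr_div // /jprime /jfactor => /eqP E.
have /eqP := gs _ xs; apply; apply: (@complexI R).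
rewrite !rmorphM; apply: (addrI ((g 1 0)%:C * (x 1 0)%:C * tau)).
transitivity ((g 1 0)%:C * ((x 1 0)%:C * tau + (x 1 1)%:C)); first by ring.
by rewrite E; ring.
Qed.

End Directions.

(** * Derivatives of Mobius maps and of integral powers of the automorphy factor *)

Section WirtMobius.
Variable R : realType.
Implicit Types (g : 'M[R]_2) (tau z t p q : R[i]) (u v : R[i] -> R[i]).

Lemma wirt_uniq u t p q p' q' : wirt u t p q -> wirt u t p' q' -> p = p' /\ q = q'.
Proof. by move=> /wirt_partial[<- <-] /wirt_partial[<- <-]. Qed.

Lemma wirt_eq u t p q p' q' : wirt u t p q -> p = p' -> q = q' -> wirt u t p' q'.
Proof. by move=> H <- <-. Qed.

Lemma wirt_continuous u t p q (e : R) : wirt u t p q -> 0 < e ->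
  locally t (fun s => `|u s - u t| < e%:C).
Proof.
move=> Hu e0; have [d d0 Hd] := wirtinger_smallo (@norm_conjc R) Hu (ltr01 : 0 < (1 : R[i])).
have [r r0 rE] := real_complex_gt0P d0.
have [M M0 ME] : exists2 M : R, 0 < M & `|p| + `|q| + 1 = M%:C.
  by apply: real_complex_gt0P; rewrite ltr_wpDl ?addr_ge0.
exists (Num.min r (e / M)); first by rewrite lt_min r0 divr_gt0.
move=> s hs; have [h hE] : exists h, h = s - t by exists (s - t).
have sE : s = t + h by rewrite hE addrC subrK.
rewrite -hE in hs; have h1 : `|h| < d.
  by apply: lt_le_trans hs _; rewrite rE lecR ge_min lexx.
have h2 : `|h| < (e / M)%:C.
  by apply: lt_le_trans hs _; rewrite lecR ge_min lexx orbT.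
apply: (@le_lt_trans _ _ (M%:C * `|h|)).
  rewrite -ME !mulrDl sE.
  have -> : u (t + h) - u t = p * h + q * conjc h + (u (t + h) - u t - p * h - q * conjc h) by ring.
  apply: (le_trans (ler_normD _ _)); apply: lerD; last exact: Hd.
  by apply: (le_trans (ler_normD _ _)); rewrite !normrM norm_conjc.
have M0' : 0 < M%:C by rewrite ltcR.
by move: h2; rewrite rmorphM fmorphV -(ltr_pM2l M0') mulrCA mulfV ?mulr1 // gt_eqF.
Qed.

Lemma wirt_affine (a b : R[i]) t : wirt (fun z => a * z + b) t a 0.
Proof.
have := wirtingerD (wirtingerM (@norm_conjc R) (wirtinger_cst _ a t) (wirtinger_id _ t)) (wirtinger_cst (@conjc R) b t).
by rewrite /wirt !mul0r !mulr0 mulr1 !add0r !addr0.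
Qed.

Lemma mobius_derivativeE (K : fieldType) (a b c d t : K) : c * t + d != 0 ->
  a * (c * t + d)^-1 + (a * t + b) * (- c / (c * t + d) ^+ 2) =
  (a * d - b * c) / (c * t + d) ^+ 2.
Proof. by move=> j0; field. Qed.

Lemma wirt_mobius g tau : \det g = 1 -> upper_half_plane R tau ->
  wirt (mobius g) tau ((jfactor g tau) ^- 2) 0.
Proof.
move=> dg t0; have j0 := jfactor_neq0 dg t0.
have Hj : wirt (jfactor g) tau (g 1 0)%:C 0 by exact: wirt_affine.
have := wirtingerM (@norm_conjc R) (wirt_affine (g 0 0)%:C (g 0 1)%:C tau)
  (wirtingerV (@norm_conjc R) Hj j0).
move=> H; apply: (wirt_eq H); last by rewrite mul0r mulr0 addr0.
rewrite mobius_derivativeE // -!rmorphM -rmorphB -det2 dg; exact: mul1r.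
Qed.

Lemma wirt_expn u t p n : wirt u t p 0 ->
  wirt (fun z => u z ^+ n) t (n%:R * p * u t ^+ n.-1) 0.
Proof.
move=> Hu; elim: n => [|n IH].
  rewrite !mul0r; exact: wirtinger_cst.
have H := wirtingerM (@norm_conjc R) Hu IH.
apply: (@wirt_ext R (fun z => u z * u z ^+ n)); first by exists 1 => // s _; rewrite exprS.
apply: (wirt_eq H); last by rewrite mul0r mulr0 addr0.
case: n {IH H} => [|n] /=; first by rewrite mulr0n !mul0r mulr0 addr0 mulr1n mul1r expr0 mulr1.
rewrite -(natr1 n.+1) !mulrDl mul1r [RHS]addrC; congr (_ + _).
by rewrite mulrCA -exprS.
Qed.

Lemma wirt_exprz u t p (w : int) : wirt u t p 0 -> u t != 0 ->
  wirt (fun z => u z ^ w) t (w%:~R * p * u t ^ (w - 1)) 0.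
Proof.
move=> Hu u0; case: w => [n|n].
  have -> : n%:Z%:~R * p * u t ^ (n%:Z - 1) = n%:R * p * u t ^+ n.-1.
    case: n => [|n]; first by rewrite !mul0r.
    by have -> : n.+1%:Z - 1 = n%:Z by rewrite -addn1 PoszD addrK.
  exact: wirt_expn.
have Hn := wirt_expn n.+1 Hu; have H := wirtingerV (@norm_conjc R) Hn (expf_neq0 n.+1 u0).
apply: (wirt_eq H) => //=; rewrite NegzE -opprD -PoszD addn1 mulrNz !mulNr -exprM -pmulrn.
congr (- _); rewrite -!mulrA; congr (_ * (_ * _)).
have -> : u t ^ (- n.+2%:Z) = (u t ^+ n.+2)^-1 by [].
have -> : (n.+1 * 2 = n + n.+2)%N by rewrite muln2 -addnn addSnnS.
rewrite exprD invfM mulrA mulfV ?mul1r //.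
exact: expf_neq0.
Qed.

End WirtMobius.

(** * Exceptional sets *)

Section Generic.
Variables (R : realType) (star : regularity).
Implicit Types (S : set R[i]) (tau : R[i]) (P Q : R[i] -> Prop) (g : 'M[R]_2).

Lemma exceptionalU S S' : exceptional star S -> exceptional star S' ->
  exceptional star (S `|` S').
Proof.
case: star => /= [-> ->|HS HS' tau t0]; first by rewrite setU0.
have [e e0 He] := HS _ t0; have [d d0 Hd] := HS' _ t0.
exists (Num.min e d); first by rewrite lt_min e0.
move=> s [Ss|Ss] hs; [apply: He|apply: Hd] => //; apply: lt_le_trans hs _;
  by rewrite lecR ge_min lexx ?orbT.
Qed.

(** Near tau the set can only contain tau itself, which is excluded; so identities valid off S hold
    on a full neighbourhood and can be differentiated. *)
Lemma exceptional_locally S tau : exceptional star S -> upper_half_plane R tau -> ~ S tau ->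
  locally tau (fun s => upper_half_plane R s /\ ~ S s).
Proof.
move=> HS t0 nS; apply: locally_and; first exact: locally_upper.
move: HS; case: star => /= [S0|/(_ _ t0)[e e0 He]]; first by exists 1 => // s _; rewrite S0.
by exists e => // s hs Ss; apply: nS; rewrite -(He s Ss hs).
Qed.

Lemma mobius_locally g tau P : \det g = 1 -> upper_half_plane R tau ->
  locally (mobius g tau) P -> locally tau (fun s => P (mobius g s)).
Proof.
move=> dg t0 [e e0 He]; have := wirt_continuous (wirt_mobius dg t0) e0.
by apply: locallyW => s; exact: He.
Qed.

(** By continuity, a point s near tau with g s in S has g s = g tau, and the action is injective. *)
Lemma exceptional_preimage S g : exceptional star S -> \det g = 1 ->
  exceptional star [set tau | upper_half_plane R tau /\ S (mobius g tau)].
Proof.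
move=> HS dg; move: HS; case: star => /= [->|HS tau t0].
  by apply/seteqP; split => // tau [].
have [e e0 He] := HS _ (mobius_upper dg t0).
have [d d0 Hd] : locally tau (fun s => S (mobius g s) -> mobius g s = mobius g tau).
  by apply: (@mobius_locally g tau (fun z => S z -> z = mobius g tau)) => //; exists e => // s hs Ss; exact: He.
by exists d => // s [s0 Ss] /Hd /(_ Ss) E; rewrite -(mobiusK dg s0) E mobiusK.
Qed.

Lemma exceptional_preimages S (s : seq 'M[R]_2) : exceptional star S ->
  (forall g, g \in s -> \det g = 1) -> exists2 S', exceptional star S' &
  forall tau, upper_half_plane R tau -> ~ S' tau ->
    ~ S tau /\ forall g, g \in s -> ~ S (mobius g tau).
Proof.
move=> HS; elim: s => [|g s IH] ds; first by exists S => // tau t0 nS; split.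
have [S' HS' H'] : exists2 S', exceptional star S' &
    forall tau, upper_half_plane R tau -> ~ S' tau ->
    ~ S tau /\ forall g, g \in s -> ~ S (mobius g tau).
  by apply: IH => h hs; apply: ds; rewrite inE hs orbT.
exists (S' `|` [set tau | upper_half_plane R tau /\ S (mobius g tau)]).
  apply: exceptionalU => //; apply: exceptional_preimage => //.
  by apply: ds; rewrite inE eqxx.
move=> tau t0 nS; have [nS1 nS2] := H' tau t0 (fun Ss => nS (or_introl Ss)).
split => // h; rewrite inE => /orP[/eqP ->|]; last exact: nS2.
by move=> Sg; apply: nS; right.
Qed.

End Generic.

(** * Families of homogeneous polynomials and their coefficientwise derivatives *)

Section PolynomialFamilies.
Variable R : realType.
Implicit Types (g : 'M[R]_2) (p q A B : SymAlg R) (tau t a b : R[i]) (m : nat).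
Implicit Types (P Q : R[i] -> SymAlg R) (L : SymAlg R -> R[i]).

Local Notation homog m p := (p \is @ishomog1 2 R[i] m mdeg).
Local Notation E1 := (mpolyX R[i] (mnm1 (0 : 'I_2))).
Local Notation E2 := (mpolyX R[i] (mnm1 (1 : 'I_2))).

Lemma homogP m p : homog m p <-> forall nu, mdeg nu != m -> mcoeff nu p = 0.
Proof.
split=> [hp nu nm|H].
  by apply/eqP; rewrite mcoeff_eq0; apply: contraNN nm => /(dhomog_mf hp) /eqP.
apply/dhomogP => nu hnu; apply/eqP; apply: contraTT hnu => /H /eqP.
by rewrite mcoeff_eq0.
Qed.

Lemma homog_msize m p : homog m p -> (msize p <= m.+1)%N.
Proof.
move=> hp; rewrite msizeE; apply/bigmax_leqP_seq => nu hnu _.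
by rewrite ltnS (dhomog_mf hp hnu).
Qed.

(** On polynomials of bounded degree such a functional is a finite combination of coefficients with
    constant weights; therefore it preserves analyticity and commutes with the derivatives.
    Evaluation, the coefficients of [symact g] and those of the formal derivatives are all treated
    this way. *)
Definition linear_form L : Prop :=
  (forall p q, L (p + q) = L p + L q) /\ (forall c p, L (c *: p) = c * L p).

Lemma linear_form_homog L m p : linear_form L -> homog m p ->
  L p = \sum_(mu : bmultinom 2 m.+1) mcoeff mu p * L (mpolyX R[i] mu).
Proof.
move=> [LD LZ] /homog_msize hp; rewrite {1}(mpolywE hp).
have L0 : L 0 = 0 by rewrite -[X in L X](scale0r 0) LZ mul0r.
by rewrite (big_morph L LD L0); apply: eq_bigr => mu _; rewrite LZ.
Qed.

Lemma linear_form_eval2 a b : linear_form (eval2 a b).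
Proof. by split=> *; rewrite ?eval2D ?eval2Z. Qed.
Lemma linear_form_symact nu g : linear_form (fun p => mcoeff nu (symact g p)).
Proof. by split=> *; rewrite ?symactD ?symactZ ?mcoeffD ?mcoeffZ. Qed.
Lemma linear_form_mderiv nu (i : 'I_2) : linear_form (fun p => mcoeff nu (mderiv i p)).
Proof. by split=> *; rewrite ?mderivD ?mderivZ ?mcoeffD ?mcoeffZ. Qed.

Definition panalytic P tau : Prop :=
  forall mu, real_analytic (fun t => mcoeff mu (P t)) tau.

Lemma linear_form_analytic L m P tau : linear_form L ->
  locally tau (fun s => homog m (P s)) -> panalytic P tau ->
  real_analytic (fun t => L (P t)) tau.
Proof.
move=> HL hP aP.
apply: (@real_analytic_ext R (fun t => \sum_(mu : bmultinom 2 m.+1) mcoeff mu (P t) * L (mpolyX R[i] mu))).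
  by apply: locallyW hP => s hs; rewrite (linear_form_homog HL hs).
apply: real_analytic_sum => mu; apply: real_analyticM; first exact: aP.
exact: real_analytic_cst.
Qed.

Lemma panalytic_ext P Q tau : locally tau (fun s => P s = Q s) ->
  panalytic P tau -> panalytic Q tau.
Proof.
move=> PQ aP mu; apply: real_analytic_ext (aP mu).
by apply: locallyW PQ => s ->.
Qed.

Lemma panalytic_cst p tau : panalytic (fun=> p) tau.
Proof. by move=> mu; exact: real_analytic_cst. Qed.

Lemma panalyticD P Q tau : panalytic P tau -> panalytic Q tau ->
  panalytic (fun t => P t + Q t) tau.
Proof.
move=> aP aQ mu; have := real_analyticD (aP mu) (aQ mu).
by under eq_fun do rewrite -mcoeffD.
Qed.

Lemma panalyticZ (u : R[i] -> R[i]) P tau : real_analytic u tau -> panalytic P tau ->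
  panalytic (fun t => u t *: P t) tau.
Proof.
move=> au aP mu; have := real_analyticM au (aP mu).
by under eq_fun do rewrite -mcoeffZ.
Qed.

Lemma panalytic_sum (I : Type) (s : seq I) (F : I -> R[i] -> SymAlg R) tau :
  (forall i, panalytic (F i) tau) -> panalytic (fun t => \sum_(i <- s) F i t) tau.
Proof.
move=> H; elim: s => [|i s IH].
  by under eq_fun do rewrite big_nil; exact: panalytic_cst.
by under eq_fun do rewrite big_cons; exact: panalyticD.
Qed.

Lemma panalyticM P Q tau : panalytic P tau -> panalytic Q tau ->
  panalytic (fun t => P t * Q t) tau.
Proof.
move=> aP aQ mu.
have -> : (fun t => mcoeff mu (P t * Q t)) =
    (fun t => \sum_(k : bmultinom 2 (mdeg mu).+1 * bmultinom 2 (mdeg mu).+1)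
       if mu == mnm_add k.1 k.2 then mcoeff k.1 (P t) * mcoeff k.2 (Q t) else 0).
  by apply/funext => t; rewrite mcoeffM big_mkcond.
apply: real_analytic_sum => k; case: (mu == _); last exact: real_analytic_cst.
by apply: real_analyticM; [exact: aP|exact: aQ].
Qed.

Lemma panalytic_vecX tau : panalytic (@vecX R) tau.
Proof.
have -> : @vecX R = fun t => t *: E1 + E2 by apply/funext => t; exact: vecXE.
apply: panalyticD; last exact: panalytic_cst.
by apply: panalyticZ; [exact: real_analytic_id|exact: panalytic_cst].
Qed.

Lemma panalytic_vecXbar tau : panalytic (@vecXbar R) tau.
Proof.
have -> : @vecXbar R = fun t => conjc t *: E1 + E2 by apply/funext => t; exact: vecXbarE.
apply: panalyticD; last exact: panalytic_cst.
by apply: panalyticZ; [exact: real_analytic_conj|exact: panalytic_cst].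
Qed.

Lemma panalytic_derX m P tau : locally tau (fun s => homog m (P s)) ->
  panalytic P tau -> panalytic (fun t => derX t (P t)) tau.
Proof.
move=> hP aP.
have aD (i : 'I_2) : panalytic (fun t => mderiv i (P t)) tau.
  by move=> mu; exact: (linear_form_analytic (linear_form_mderiv mu i) hP aP).
have -> : (fun t => derX t (P t)) =
    (fun t => mderiv 0 (P t) + (-1) *: (t *: mderiv 1 (P t))).
  by apply/funext => t; rewrite /derX scaleN1r.
apply: panalyticD => //; apply: panalyticZ; first exact: real_analytic_cst.
by apply: panalyticZ; first exact: real_analytic_id.
Qed.

Lemma mcoeff_E1M0 p (nu : multinom 2) : nu (0 : 'I_2) = 0%N -> mcoeff nu (p * E1) = 0.
Proof.
move=> nu0; rewrite mcoeffM big1 // => k /eqP nuE; rewrite mcoeffX.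
case: eqVneq => [E|_]; last by rewrite mulr0.
by have := congr1 (fun v : multinom 2 => v (0 : 'I_2)) nuE; rewrite mnmDE nu0 -E mnm1E eqxx addn1.
Qed.

(* The coefficients of P are recovered from those of X * P by division with respect to E2. *)
Lemma panalytic_divX P tau : panalytic (fun t => vecX t * P t) tau -> panalytic P tau.
Proof.
move=> aXP nu; move nE: (nu (0 : 'I_2)) => n; elim: n nu nE => [|n IH] nu nE.
  have := aXP (mnm_add (mnm1 1) nu); congr (real_analytic _ _); apply/funext => t.
  rewrite vecXE mulrC mulrDr mcoeffD -scalerAr mcoeffZ mcoeffMX mcoeff_E1M0 ?mulr0 ?add0r //.
  by rewrite mnmDE mnm1E nE.
pose nu' := mnm_sub (mnm_add (mnm1 1) nu) (mnm1 (0 : 'I_2)).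
have nuE : mnm_add (mnm1 1) nu = mnm_add (mnm1 (0 : 'I_2)) nu'.
  apply/mnmP => i; rewrite [RHS]mnmDE mnmBE subnKC // mnm1E mnmDE.
  by case: eqVneq => [<-|_] //; rewrite nE addnS.
have nE' : nu' (0 : 'I_2) = n by rewrite mnmBE mnmDE !mnm1E nE /= add0n subn1.
have := real_analyticD (aXP (mnm_add (mnm1 1) nu))
  (real_analyticZ (-1) (real_analyticM (@real_analytic_id R tau) (IH _ nE'))).
congr (real_analytic _ _); apply/funext => t /=.
rewrite vecXE mulrC mulrDr mcoeffD -scalerAr mcoeffZ mcoeffMX nuE mcoeffMX mulN1r.
by rewrite addrAC subrr add0r.
Qed.

Definition pwirt P t A B : Prop :=
  forall mu, wirt (fun s => mcoeff mu (P s)) t (mcoeff mu A) (mcoeff mu B).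

(** One entry of [coefwise]. *)
Definition pcoefs m (d : (R[i] -> R[i]) -> R[i] -> R[i]) P t : SymAlg R :=
  \sum_(mu : bmultinom 2 m.+1) d (fun s => mcoeff mu (P s)) t *: mpolyX R[i] mu.

Lemma mcoeff_pcoefs m d P t nu : mcoeff nu (pcoefs m d P t) =
  if (mdeg nu < m.+1)%N then d (fun s => mcoeff nu (P s)) t else 0.
Proof.
rewrite /pcoefs raddf_sum /=; case: ifP => hnu.
  rewrite (bigD1 (BMultinom hnu)) //= mcoeffZ mcoeffX eqxx mulr1 big1 ?addr0 // => mu nm.
  rewrite mcoeffZ mcoeffX; case: eqVneq => [E|_]; last by rewrite mulr0.
  by case/negP: nm; apply/eqP/val_inj.
rewrite big1 // => mu _; rewrite mcoeffZ mcoeffX; case: eqVneq => [E|_]; last by rewrite mulr0.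
by move: hnu; rewrite -E bmdeg.
Qed.

(** Coefficients in degrees other than m vanish on a neighbourhood, so their derivatives vanish too;
    hence differentiating all monomials of degree at most m preserves homogeneity. *)
Lemma pcoefs_wirt0 m P t nu : locally t (fun s => homog m (P s)) -> mdeg nu != m ->
  wirt (fun s => mcoeff nu (P s)) t 0 0.
Proof.
move=> hP nm; apply: (@wirt_ext R (fun=> 0)); last exact: wirtinger_cst.
by apply: locallyW hP => s /homogP ->.
Qed.

Lemma pcoefs_homog m P t : locally t (fun s => homog m (P s)) ->
  homog m (pcoefs m (@partial_tau R) P t) /\ homog m (pcoefs m (@partial_taubar R) P t).
Proof.
move=> hP; split; apply/homogP => nu nm; rewrite mcoeff_pcoefs;
  have [p0 q0] := wirt_partial (pcoefs_wirt0 hP nm); rewrite ?p0 ?q0; by case: ifP.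
Qed.

Lemma pcoefs_wirt m P t : locally t (fun s => homog m (P s)) -> panalytic P t ->
  pwirt P t (pcoefs m (@partial_tau R) P t) (pcoefs m (@partial_taubar R) P t).
Proof.
move=> hP aP nu; rewrite !mcoeff_pcoefs; case: ifP => hnu; first exact: real_analytic_wirt.
by apply: pcoefs_wirt0 hP _; apply: contraFN hnu => /eqP ->.
Qed.

Lemma pcoefs_delta m w P t : homog m (P t) ->
  pcoefs m (delta w) P t = pcoefs m (@partial_tau R) P t + (w / two_i_y t) *: P t.
Proof.
move=> hP; rewrite [X in _ = _ + _ *: X](mpolywE (homog_msize hP)) scaler_sumr -big_split /=.
by apply: eq_bigr => mu _; rewrite scalerA -scalerDl.
Qed.

Lemma linear_form_wirt L m P t A B : linear_form L ->
  locally t (fun s => homog m (P s)) -> homog m A -> homog m B -> pwirt P t A B ->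
  wirt (fun s => L (P s)) t (L A) (L B).
Proof.
move=> HL hP hA hB dP; rewrite (linear_form_homog HL hA) (linear_form_homog HL hB).
apply: (@wirt_ext R (fun s => \sum_(mu : bmultinom 2 m.+1) mcoeff mu (P s) * L (mpolyX R[i] mu))).
  by apply: locallyW hP => s hs; rewrite (linear_form_homog HL hs).
apply: wirtinger_sum => mu.
have := wirtingerM (@norm_conjc R) (dP mu) (wirtinger_cst (@conjc R) (L (mpolyX R[i] mu)) t).
by rewrite !mulr0 !addr0.
Qed.

Lemma panalytic_pcoefs m P (d : (R[i] -> R[i]) -> R[i] -> R[i]) t :
  (forall u, real_analytic u t -> real_analytic (d u) t) ->
  panalytic P t -> panalytic (pcoefs m d P) t.
Proof.
move=> Hd aP; apply: panalytic_sum => mu; apply: panalyticZ; last exact: panalytic_cst.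
by apply: Hd; exact: aP.
Qed.

End PolynomialFamilies.

(** * Evaluations of homogeneous forms and equivariance of the derivation that kills X *)

Section FormCombinations.
Variable R : realType.
Implicit Types (g : 'M[R]_2) (p q : SymAlg R) (tau : R[i]) (m : nat).

Local Notation homog m p := (p \is @ishomog1 2 R[i] m mdeg).

Lemma eval2_form_comb a b m Y Z c : eval2 a b (form_comb m Y Z c) =
  \sum_(r < m.+1) c r * (eval2 a b Y ^+ (m - r) * eval2 a b Z ^+ r) :> R[i].
Proof.
by rewrite eval2_sum; apply: eq_bigr => r _; rewrite eval2Z eval2M !eval2X.
Qed.

Lemma eval2_01_form_comb m tau c :
  eval2 0 1 (form_comb m (vecX tau) (vece R) c) = c 0%N.
Proof.
rewrite eval2_form_comb eval2_vecX eval2_vece mulr0 add0r big_ord_recl big1 => [|r _].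
  by rewrite !expr1n !mulr1 addr0.
by rewrite exprS mul0r !mulr0.
Qed.

(** (1, -tau) is the zero of X, and e takes the value 1 there: the coefficient obtained is the
    obstruction to divisibility by X. *)
Lemma eval2_root_form_comb m tau c :
  eval2 1 (- tau) (form_comb m (vecX tau) (vece R) c) = c m.
Proof.
rewrite eval2_form_comb eval2_vecX eval2_vece mulr1 subrr big_ord_recr /= big1 => [|r _].
  by rewrite subnn !expr0 expr1n !mulr1 add0r.
by rewrite -(@subnSK r m) // exprS mul0r mul0r mulr0.
Qed.

Lemma vecX_neq0 tau : vecX tau != 0.
Proof.
apply/eqP => /(congr1 (eval2 0 1)); rewrite eval2_vecX mulr0 add0r.
by rewrite -[X in eval2 _ _ X](scale0r 0) eval2Z mul0r => /eqP; rewrite oner_eq0.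
Qed.

Lemma symact_vecXbar g tau : jfactor g tau != 0 ->
  symact g (vecXbar tau) = conjc (jfactor g tau) *: vecXbar (mobius g tau).
Proof.
move=> j0; have E t : vecXbar t = vecX (conjc t) by rewrite vecXE vecXbarE.
by rewrite !E jfactor_conj mobius_conj symact_vecX // -jfactor_conj conjc_eq0.
Qed.

Lemma derX_form_comb m tau c : vecX tau * derX tau (form_comb m (vecX tau) (vece R) c) =
  \sum_(r < m.+1) (c r * r%:R) *: (vecX tau ^+ (m - r).+1 * vece R ^+ r.-1).
Proof.
rewrite /form_comb derX_sum mulr_sumr; apply: eq_bigr => r _.
rewrite derXZ derXM !derX_exp derX_vecX derX_vece !mulr0 scaler0 mul0r add0r mulr1.
by rewrite -!scalerAr scalerA mulrA -exprS.
Qed.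

Lemma homog_X_derX m tau p : homog m p -> homog m (vecX tau * derX tau p).
Proof.
move=> /(homog_X_e tau)[c ->]; rewrite derX_form_comb; apply: rpred_sum => r _.
(* For r = 0 the product would have degree m + 1, but its coefficient is 0. *)
case: r => [[|r] /= rm]; first by rewrite mulr0 scale0r rpred0.
have hm : homog ((m - r) + r)%N (vecX tau ^+ (m - r) * vece R ^+ r).
by apply: dhomogM; apply: homog_exp; [exact: homog_vecX|exact: homog_vece].
by rewrite subnSK //; apply: rpredZ; move: hm; rewrite subnK // ltnW.
Qed.

Lemma eval2_01_X_derX m tau c : (0 < m)%N ->
  eval2 0 1 (vecX tau * derX tau (form_comb m (vecX tau) (vece R) c)) = c 1%N.
Proof.
case: m => // m _; rewrite derX_form_comb eval2_sum big_ord_recl big_ord_recl /= big1 => [|r _].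
  rewrite !eval2Z mulr0 mul0r add0r addr0 eval2M !eval2X eval2_vecX mulr0 add0r expr1n.
  by rewrite addn0 expr0 !mulr1.
by rewrite eval2Z eval2M !eval2X eval2_vece add0n /bump /= add1n [0 ^+ _]exprS mul0r !mulr0.
Qed.

Lemma mpoly2_ind (Q : SymAlg R -> Prop) :
  (forall p q, Q p -> Q q -> Q (p + q)) -> (forall p q, Q p -> Q q -> Q (p * q)) ->
  (forall c p, Q p -> Q (c *: p)) -> Q 1 ->
  Q (mpolyX R[i] (mnm1 (0 : 'I_2))) -> Q (mpolyX R[i] (mnm1 (1 : 'I_2))) ->
  forall p, Q p.
Proof.
move=> QD QM QZ Q1 QE1 QE2 p; have Q0 : Q 0 by rewrite -(scale0r 1); exact: QZ.
have QX q n : Q q -> Q (q ^+ n) by move=> Hq; elim: n => // n IH; rewrite exprS; exact: QM.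
rewrite [p]mpolyE; apply: (big_ind Q) => // mu _; apply: QZ; rewrite mpolyX2.
by apply: QM; exact: QX.
Qed.

Lemma scaler_leibniz (K : comNzRingType) (A : comAlgType K) (c : K) (a b d e : A) :
  c *: (a * b + d * e) = (c *: a) * b + d * (c *: e).
Proof. by rewrite scalerDr scalerAl scalerAr. Qed.

#[local] Opaque symact derX.

Lemma twisted_derivation_eq (s D D' : SymAlg R -> SymAlg R) :
  (forall p q, D (p + q) = D p + D q) -> (forall p q, D' (p + q) = D' p + D' q) ->
  (forall p q, D (p * q) = D p * s q + s p * D q) ->
  (forall p q, D' (p * q) = D' p * s q + s p * D' q) ->
  (forall c p, D (c *: p) = c *: D p) -> (forall c p, D' (c *: p) = c *: D' p) ->
  D 1 = D' 1 -> D (mpolyX R[i] (mnm1 (0 : 'I_2))) = D' (mpolyX R[i] (mnm1 (0 : 'I_2))) ->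
  D (mpolyX R[i] (mnm1 (1 : 'I_2))) = D' (mpolyX R[i] (mnm1 (1 : 'I_2))) -> D =1 D'.
Proof.
move=> DD DD' DM DM' DZ DZ' D1 DE1 DE2; apply: mpoly2_ind => //.
- by move=> p q Hp Hq; rewrite DD DD' Hp Hq.
- by move=> p q Hp Hq; rewrite DM DM' Hp Hq.
- by move=> c p Hp; rewrite DZ DZ' Hp.
Qed.

(* Both sides are derivations along symact g, so that it suffices to compare them on the
   basis of C^2. *)
Lemma derX_symact g tau p : \det g = 1 -> upper_half_plane R tau ->
  derX (mobius g tau) (symact g p) = (jfactor g tau)^-1 *: symact g (derX tau p).
Proof.
move=> dg t0; have j0 := jfactor_neq0 dg t0.
have dgC : (g 0 0)%:C * (g 1 1)%:C - (g 0 1)%:C * (g 1 0)%:C = 1 :> R[i].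
  by rewrite -!rmorphM -rmorphB -det2 dg.
have id1 (a b c d t : R[i]) : a * (c * t + d) - c * (a * t + b) = a * d - b * c by ring.
have id2 (a b c d t : R[i]) : b * (c * t + d) - d * (a * t + b) = (a * d - b * c) * - t by ring.
have s1 : symact g 1 = 1 by rewrite -(expr0 (0 : SymAlg R)) symactX expr0.
(* [e1] and [e2] say that the row (1, - g tau) times g is j^-1 (1, - tau): the zero of X at g tau is
   carried to the zero of X at tau. *)
have e1 : (g 0 0)%:C - (g 1 0)%:C * mobius g tau = (jfactor g tau)^-1.
  apply: (mulIf j0); rewrite mulVf // mulrBl -mulrA /mobius divfK // -dgC; exact: id1.
have e2 : (g 0 1)%:C - (g 1 1)%:C * mobius g tau = (jfactor g tau)^-1 * - tau.
  by apply: (mulIf j0); rewrite mulrAC mulVf // mulrBl -mulrA /mobius divfK // -dgC; exact: id2.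
have affine (a c z : R[i]) : derX z (a *: mpolyX R[i] (mnm1 (0 : 'I_2)) +
    c *: mpolyX R[i] (mnm1 (1 : 'I_2))) = (a - c * z) *: 1.
  by rewrite derXD 2!derXZ derX_E1 derX_E2 scalerN scalerA -(@scalerBl _ (SymAlg R)).
apply: (@twisted_derivation_eq (symact g) (fun p => derX (mobius g tau) (symact g p))
  (fun p => (jfactor g tau)^-1 *: symact g (derX tau p))).
- by move=> q r; rewrite symactD; exact: derXD.
- by move=> q r; rewrite derXD symactD; exact: scalerDr.
- by move=> q r; rewrite symactM; exact: derXM.
- move=> q r; rewrite derXM symactD (symactM g (derX tau q) r) (symactM g q (derX tau r)).
  exact: scaler_leibniz.
- by move=> c q; rewrite symactZ; exact: derXZ.
- by move=> c q; rewrite derXZ symactZ scalerA mulrC -scalerA.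
- by rewrite s1 2!derX1 -[X in symact g X](scale0r 1) symactZ scale0r scaler0.
- by rewrite symact_E1 affine e1 derX_E1 s1.
- by rewrite symact_E2 affine e2 derX_E2 -scaleNr symactZ s1 scalerA.
Qed.

End FormCombinations.

(** * Tensor-valued forms read on coordinates *)

Section Tensors.
Variables (R : realType) (n : nat).
Implicit Types (g : 'M[R]_2) (tau : R[i]) (v : 'cV[SymAlg R]_n) (F : R[i] -> 'cV[SymAlg R]_n).

Lemma colP0 (T : Type) (u v : 'cV[T]_n) : (forall i, u i 0 = v i 0) -> u = v.
Proof. by move=> H; apply/matrixP => i j; rewrite ord1. Qed.

Lemma colDE (T : nmodType) (u v : 'cV[T]_n) i : (u + v) i 0 = u i 0 + v i 0.
Proof. by rewrite mxE. Qed.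

Lemma tensor_actE g (rg : 'M[R[i]]_n) v i :
  tensor_act g rg v i 0 = \sum_l rg i l *: symact g (v l 0).
Proof. by rewrite mxE; apply: eq_bigr => l _; rewrite !mxE mul_mpolyC. Qed.

Lemma pure_tensorE (p : SymAlg R) (c : 'cV[R[i]]_n) i : pure_tensor p c i 0 = c i 0 *: p.
Proof. by rewrite !mxE mulrC mul_mpolyC. Qed.

Lemma scale_tensorE (c : R[i]) v i : scale_tensor c v i 0 = c *: v i 0.
Proof. by rewrite mxE mul_mpolyC. Qed.

Lemma mulXE F tau i : mulX F tau i 0 = vecX tau * F tau i 0.
Proof. by rewrite mxE. Qed.

Lemma mulXbarE F tau i : mulXbar F tau i 0 = vecXbar tau * F tau i 0.
Proof. by rewrite mxE. Qed.

Lemma coefwiseE m d F tau i : coefwise m d F tau i 0 = pcoefs m d (fun t => F t i 0) tau.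
Proof. by rewrite mxE. Qed.

Lemma sum_pure_tensorE m (Y Z : SymAlg R) (c : nat -> 'cV[R[i]]_n) i :
  (\sum_(r < m.+1) pure_tensor (Y ^+ (m - r) * Z ^+ r) (c r)) i 0 =
  form_comb m Y Z (fun r => c r i 0).
Proof. by rewrite summxE; apply: eq_bigr => r _; rewrite pure_tensorE. Qed.

Lemma scaler_collect (K : comNzRingType) (A : comAlgType K) (x y k : K) (p q : A) :
  (- y * k * x) *: (p * q) = x *: (p * (k *: (q * (- y)%:A))).
Proof.
rewrite -!scalerAr mulr1 !scalerA; congr (_ *: _).
by rewrite mulrC [k * _]mulrC.
Qed.

#[local] Opaque symact derX.

(** [derX] kills X and multiplies by -2iy when it removes a factor Xbar, so applied to any expansion
    in X and Xbar it produces the defining sum. This frees [Dop] from the choice of coefficients. *)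
Lemma DopE m F tau i : upper_half_plane R tau -> in_tensor m (F tau) ->
  Dop m F tau i 0 = derX tau (F tau i 0).
Proof.
move=> t0 hF.
have : [set c : {ffun 'I_m.+1 -> 'cV[R[i]]_n} | F tau = \sum_(j < m.+1)
    pure_tensor (vecX tau ^+ (m - j) * vecXbar tau ^+ j) (c j)] (Xbar_coefs m tau (F tau)).
  apply: xgetPex.
  have /choice[e He] : forall l, exists e, F tau l 0 = form_comb m (vecX tau) (vecXbar tau) e.
    by move=> l; exact: homog_X_Xbar (hF l).
  exists [ffun j : 'I_m.+1 => \col_l e l j]; apply: colP0 => l /=; rewrite He summxE.
  by apply: eq_bigr => j _; rewrite pure_tensorE ffunE mxE.
rewrite /Dop; move: (Xbar_coefs _ _ _) => c /= FE.
have -> : F tau i 0 = \sum_(j < m.+1) c j i 0 *: (vecX tau ^+ (m - j) * vecXbar tau ^+ j).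
  by rewrite FE summxE; apply: eq_bigr => j _; rewrite pure_tensorE.
rewrite summxE derX_sum; apply: eq_bigr => j _.
rewrite pure_tensorE mxE derXZ derXM !derX_exp derX_vecX derX_vecXbar.
rewrite mulr0 (@scaler0 _ (SymAlg R)) mul0r add0r.
move: (vecX tau ^+ _) (vecXbar tau ^+ _) (two_i_y tau) (c j i 0) => p q y x.
exact: scaler_collect.
Qed.

End Tensors.

(** * Modular forms, their operators, and divisibility by X *)

Section ModularForms.
Variables (R : realType) (star : regularity) (Gamma : set 'M[R]_2).
Variables (n : nat) (rho : 'M[R]_2 -> 'M[R[i]]_n).
Hypothesis detG : forall g, Gamma g -> \det g = 1.
Implicit Types (S : set R[i]) (g : 'M[R]_2) (tau : R[i]) (w k : int) (m : nat).
Implicit Types (F G : R[i] -> 'cV[SymAlg R]_n) (f : R[i] -> 'cV[R[i]]_n).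
Implicit Types (v : 'I_n -> SymAlg R).

Local Notation homog m p := (p \is @ishomog1 2 R[i] m mdeg).
Local Notation upper tau := (upper_half_plane R tau).

#[local] Opaque symact derX.

Lemma scaler_swap (K : comNzRingType) (V : lmodType K) (a b : K) (x : V) :
  a *: (b *: x) = b *: (a *: x).
Proof. by rewrite !scalerA mulrC. Qed.

Definition rep_act g v i : SymAlg R := \sum_l rho g i l *: symact g (v l).

Lemma eq_rep_act g v v' i : v =1 v' -> rep_act g v i = rep_act g v' i.
Proof. by move=> E; apply: eq_bigr => l _; rewrite E. Qed.

Lemma rep_actD g v v' i : rep_act g (fun l => v l + v' l) i = rep_act g v i + rep_act g v' i.
Proof.
rewrite /rep_act -big_split; apply: eq_bigr => l _ /=.
by rewrite symactD (@scalerDr _ (SymAlg R)).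
Qed.

Lemma rep_actZ g (c : R[i]) v i : rep_act g (fun l => c *: v l) i = c *: rep_act g v i.
Proof.
rewrite /rep_act (@scaler_sumr _ (SymAlg R)); apply: eq_bigr => l _.
rewrite symactZ; exact: scaler_swap.
Qed.

Lemma rep_actM g p v i : rep_act g (fun l => p * v l) i = symact g p * rep_act g v i.
Proof.
rewrite /rep_act mulr_sumr; apply: eq_bigr => l _.
by rewrite symactM (@scalerAr _ (SymAlg R)).
Qed.

Lemma rep_act_derX g tau v i : \det g = 1 -> upper tau ->
  derX (mobius g tau) (rep_act g v i) =
  (jfactor g tau)^-1 *: rep_act g (fun l => derX tau (v l)) i.
Proof.
move=> dg t0; rewrite /rep_act derX_sum (@scaler_sumr _ (SymAlg R)); apply: eq_bigr => l _.
rewrite (derXZ (mobius g tau) (rho g i l) (symact g (v l))) (derX_symact (v l) dg t0).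
exact: scaler_swap.
Qed.

Lemma mcoeff_rep_act nu g v i :
  mcoeff nu (rep_act g v i) = \sum_l rho g i l * mcoeff nu (symact g (v l)).
Proof. by rewrite raddf_sum; apply: eq_bigr => l _; exact: mcoeffZ. Qed.

Lemma eval2_rep_act a b g v i :
  eval2 a b (rep_act g v i) = \sum_l rho g i l * eval2 a b (symact g (v l)).
Proof. by rewrite eval2_sum; apply: eq_bigr => l _; exact: eval2Z. Qed.

Lemma jfactor_mulrC g tau : tau * (g 1 0)%:C + (g 1 1)%:C = jfactor g tau.
Proof. by rewrite /jfactor mulrC. Qed.

#[local] Opaque rep_act jfactor mobius pcoefs coefwise scale_tensor Dop mulX mulXbar.

(** A single exceptional set serves the three requirements of [modular], with equivariance written
    entry by entry. *)
Definition modular_off S w m F : Prop :=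
  [/\ exceptional star S,
      forall tau, upper tau -> ~ S tau ->
        forall i, homog m (F tau i 0) /\ panalytic (fun t => F t i 0) tau
    & forall g tau i, Gamma g -> upper tau -> ~ S tau -> ~ S (mobius g tau) ->
        F (mobius g tau) i 0 = jfactor g tau ^ w *: rep_act g (fun l => F tau l 0) i].

Lemma modularP w m F : modular star Gamma rho w m F <-> exists S, modular_off S w m F.
Proof.
split=> [[[S1 e1 H1] [[S2 e2 H2] [S3 e3 H3]]]|[S [eS HS HG]]].
  exists (S1 `|` (S2 `|` S3)); split.
  - by apply: exceptionalU => //; exact: exceptionalU.
  - move=> tau t0 nS i; split; first by apply: H1 => // Ss; apply: nS; left.
    by apply: H2 => // Ss; apply: nS; right; left.
  - move=> g tau i Gg t0 nS nS'; rewrite (H3 g tau) //.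
    + by rewrite scale_tensorE tensor_actE.
    + by move=> Ss; apply: nS; right; right.
    + by move=> Ss; apply: nS'; right; right.
split; first by exists S => // tau t0 nS i; have [] := HS tau t0 nS i.
split; first by exists S => // tau t0 nS i; have [] := HS tau t0 nS i.
exists S => // g tau Gg t0 nS nS'; apply: colP0 => i.
by rewrite HG // scale_tensorE tensor_actE.
Qed.

Lemma modular_off_mono S S' w m F : exceptional star S' -> S `<=` S' ->
  modular_off S w m F -> modular_off S' w m F.
Proof.
move=> eS' sub [eS HS HG]; split=> // [tau t0 nS|g tau i Gg t0 nS nS'].
  by apply: HS => // /sub.
by apply: HG => // /sub.
Qed.

Lemma modular_off_homog S w m F tau i : modular_off S w m F -> upper tau -> ~ S tau ->
  locally tau (fun s => homog m (F s i 0)).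
Proof.
move=> [eS HS _] t0 nS; apply: locallyW (exceptional_locally eS t0 nS) => s [s0 nSs].
by have [] := HS s s0 nSs i.
Qed.

(** The functions f_r are the coefficients of F on X^(m-r) e^r, chosen point by point; their
    regularity is required only for r = 0, where evaluation at (0, 1) supplies it. *)
Lemma associated_intro k m F f : modular star Gamma rho (k - m%:Z) m F ->
  generically star (fun tau => forall i, f tau i 0 = eval2 0 1 (F tau i 0)) ->
  associated star Gamma rho k m F f.
Proof.
move=> hF [S' eS' Hf]; have [S0 hS0] := (modularP _ _ _).1 hF.
have eS0 : exceptional star S0 by case: hS0.
pose S := S0 `|` S'; have eS : exceptional star S by exact: exceptionalU.
have {}hS : modular_off S (k - m%:Z) m F.
  by apply: modular_off_mono hS0 => // tau; left.
have [_ HS HG] := hS.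
have {}Hf tau : upper tau -> ~ S tau -> forall i, f tau i 0 = eval2 0 1 (F tau i 0).
  by move=> t0 nS; apply: Hf => // Ss; apply: nS; right.
have /choice[e He] : forall ti : R[i] * 'I_n, exists e, homog m (F ti.1 ti.2 0) ->
    F ti.1 ti.2 0 = form_comb m (vecX ti.1) (vece R) e.
  move=> [t i] /=; case: (boolP (homog m (F t i 0))) => [/(homog_X_e t)[e eE]|nh].
    by exists e.
  by exists (fun=> 0).
(* Association demands that term 0 be f as a function, while f agrees with the value of F only off
   an exceptional set; so f is inserted by definition and the other terms come from the
   expansion. *)
pose f_ r tau := if r is 0%N then f tau else \col_i e (tau, i) r.
have FE tau i : upper tau -> ~ S tau ->
    F tau i 0 = form_comb m (vecX tau) (vece R) (fun r => f_ r tau i 0).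
  move=> t0 nS; have [hFi _] := HS tau t0 nS i; rewrite (He (tau, i)) //=.
  apply: eq_bigr => -[[|r] hr] _ /=; last by rewrite mxE.
  by rewrite Hf // (He (tau, i)) //= eval2_01_form_comb.
exists f_ => //; split => //.
- split.
    exists S => // tau t0 nS i; have [_ aF] := HS tau t0 nS i.
    apply: (@real_analytic_ext R (fun t => eval2 0 1 (F t i 0))).
      by apply: locallyW (exceptional_locally eS t0 nS) => s [s0 nSs]; rewrite /f_ Hf.
    exact: (linear_form_analytic (linear_form_eval2 0 1) (modular_off_homog i hS t0 nS) aF).
  exists S => // g tau Gg t0 nS nS'; apply: colP0 => i.
  have dg := detG Gg; have j0 := jfactor_neq0 dg t0.
  have jE := jfactor_mulrC g tau.
  rewrite [LHS](Hf _ (mobius_upper dg t0) nS') HG // eval2Z eval2_rep_act summxE mulr_sumr.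
  under eq_bigr => l _.
    rewrite eval2_symact !mulr0 !mulr1 !add0r (FE tau l t0 nS) eval2_form_comb.
    rewrite eval2_vecX eval2_vece jE 2!mulr_sumr.
    over.
  rewrite exchange_big /=; apply: eq_bigr => r _; rewrite !mxE mulr_sumr; apply: eq_bigr => l _.
  (* The weight k - m of F and the m - r factors X, each worth j at (c, d), add up to k - r. *)
  have -> : jfactor g tau ^ (k - r%:Z) = jfactor g tau ^ (k - m%:Z) * jfactor g tau ^+ (m - r).
    rewrite exprnP -expfzDr // -subzn; last by rewrite -ltnS.
    by rewrite addrA subrK.
  by rewrite -!mulrA; congr (_ * _); rewrite mulrA mulrC -!mulrA.
- exists S => // tau t0 nS; apply: colP0 => i; rewrite (sum_pure_tensorE _ _ _ (fun r => f_ r tau)).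
  exact: FE.
Qed.

Lemma associated_viaP k m F (f_ : nat -> R[i] -> 'cV[R[i]]_n) : associated_via star Gamma rho k m F f_ ->
  generically star (fun tau => forall i,
    F tau i 0 = form_comb m (vecX tau) (vece R) (fun r => f_ r tau i 0)).
Proof.
move=> [_ _ [S eS HS]]; exists S => // tau t0 nS i.
by rewrite HS // (sum_pure_tensorE _ _ _ (fun r => f_ r tau)).
Qed.

Lemma modularD w m F G : modular star Gamma rho w m F -> modular star Gamma rho w m G ->
  modular star Gamma rho w m (fun tau => F tau + G tau).
Proof.
move=> /modularP[S hS] /modularP[S' hS']; apply/modularP; exists (S `|` S').
have eU : exceptional star (S `|` S') by case: hS hS' => ? _ _ [? _ _]; exact: exceptionalU.
have [|_ H1 H2] := modular_off_mono eU _ hS; first by move=> t; left.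
have [|_ H1' H2'] := modular_off_mono eU _ hS'; first by move=> t; right.
have DE t i : (F t + G t) i 0 = F t i 0 + G t i 0 by rewrite mxE.
split => [//|tau t0 nS i|g tau i Gg t0 nS nS'].
  have [h a] := H1 tau t0 nS i; have [h' a'] := H1' tau t0 nS i; split.
    by rewrite DE; exact: rpredD.
  have := panalyticD a a'; apply: panalytic_ext; exists 1 => // s _; by rewrite DE.
rewrite DE (H2 g tau i Gg t0 nS nS') (H2' g tau i Gg t0 nS nS').
rewrite (@eq_rep_act g _ (fun l => F tau l 0 + G tau l 0) i (DE tau)) rep_actD.
exact: (esym (@scalerDr _ (SymAlg R) _ _ _)).
Qed.

Lemma wirtZ (c : R[i]) (u : R[i] -> R[i]) t p q :
  wirt u t p q -> wirt (fun z => c * u z) t (c * p) (c * q).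
Proof.
move=> Hu; apply: (wirt_eq (wirtingerM (@norm_conjc R) (wirtinger_cst _ c t) Hu));
  by rewrite mul0r add0r.
Qed.

(* Differentiating F(g tau) = j^w g F(tau), where tau |-> g tau is holomorphic of
   derivative j^-2. *)
Lemma modular_off_wirt S w m F g tau i : modular_off S w m F ->
  Gamma g -> upper tau -> ~ S tau -> ~ S (mobius g tau) ->
  jfactor g tau ^- 2 *: pcoefs m (@partial_tau R) (fun t => F t i 0) (mobius g tau) =
    (w%:~R * jprime g * jfactor g tau ^ (w - 1)) *: rep_act g (fun l => F tau l 0) i +
    jfactor g tau ^ w *:
      rep_act g (fun l => pcoefs m (@partial_tau R) (fun t => F t l 0) tau) i /\
  conjc (jfactor g tau ^- 2) *: pcoefs m (@partial_taubar R) (fun t => F t i 0) (mobius g tau) =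
    jfactor g tau ^ w *:
      rep_act g (fun l => pcoefs m (@partial_taubar R) (fun t => F t l 0) tau) i.
Proof.
move=> hS Gg t0 nS nS'; have dg := detG Gg; have j0 := jfactor_neq0 dg t0.
have gt0 := mobius_upper dg t0; have [eS HS HG] := hS.
pose A s l := pcoefs m (@partial_tau R) (fun t => F t l 0) s.
pose B s l := pcoefs m (@partial_taubar R) (fun t => F t l 0) s.
have AB s l : upper s -> ~ S s ->
    [/\ pwirt (fun t => F t l 0) s (A s l) (B s l), homog m (A s l) & homog m (B s l)].
  move=> s0 nSs; have hF := modular_off_homog l hS s0 nSs.
  by have [hA hB] := pcoefs_homog hF; have [_ aF] := HS s s0 nSs l; split => //; exact: pcoefs_wirt.
have near_tau : locally tau (fun s => [/\ upper s, ~ S s & ~ S (mobius g s)]).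
  have H1 := exceptional_locally eS t0 nS.
  have H2 := mobius_locally dg t0 (exceptional_locally eS gt0 nS').
  by apply: locallyW (locally_and H1 H2) => s [[? ?] [? ?]].
(* For each monomial, the coefficient of F(g s) is differentiated both by the chain rule and through
   equivariance; uniqueness of Wirtinger coefficients equates the results. *)
suff key nu : mcoeff nu (A (mobius g tau) i) * jfactor g tau ^- 2 =
      w%:~R * jprime g * jfactor g tau ^ (w - 1) * mcoeff nu (rep_act g (fun l => F tau l 0) i) +
      jfactor g tau ^ w * mcoeff nu (rep_act g (A tau) i) /\
    mcoeff nu (B (mobius g tau) i) * conjc (jfactor g tau ^- 2) =
      jfactor g tau ^ w * mcoeff nu (rep_act g (B tau) i).
  split; apply/mpolyP => nu; have [k1 k2] := key nu.
    apply: (etrans (mcoeffZ _ _ _)); apply: (etrans (mulrC _ _)); apply: (etrans k1).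
    by rewrite mcoeffD; congr (_ + _); exact: (esym (mcoeffZ _ _ _)).
  apply: (etrans (mcoeffZ _ _ _)); apply: (etrans (mulrC _ _)); apply: (etrans k2).
  exact: (esym (mcoeffZ _ _ _)).
have [dF _ _] := AB _ i gt0 nS'.
have H1 := wirtinger_comp_holo (@norm_conjc R) (wirt_mobius dg t0) (dF nu).
have Hl l : wirt (fun s => rho g i l * mcoeff nu (symact g (F s l 0))) tau
    (rho g i l * mcoeff nu (symact g (A tau l))) (rho g i l * mcoeff nu (symact g (B tau l))).
  have [dFl hA hB] := AB tau l t0 nS; apply: wirtZ.
  exact: (linear_form_wirt (linear_form_symact nu g) (modular_off_homog l hS t0 nS) hA hB dFl).
have Hs := @wirtinger_sum _ (@conjc R) 'I_n (index_enum _)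
  (fun l s => rho g i l * mcoeff nu (symact g (F s l 0))) tau _ _ Hl.
have Hj : wirt (jfactor g) tau (jprime g) 0 by exact: wirt_affine.
have H2 := wirtingerM (@norm_conjc R) (wirt_exprz w Hj j0) Hs.
have loc : locally tau (fun s => jfactor g s ^ w *
    (\sum_(l <- index_enum _) rho g i l * mcoeff nu (symact g (F s l 0))) =
    mcoeff nu (F (mobius g s) i 0)).
  by apply: locallyW near_tau => s [s0 nSs nSg]; rewrite (HG g s i Gg s0 nSs nSg) mcoeffZ mcoeff_rep_act.
have [p1 q1] := wirt_uniq H1 (wirt_ext loc H2); split.
  by apply: (etrans p1); congr (_ * _ + _ * _); exact: (esym (mcoeff_rep_act _ _ _ _)).
apply: (etrans q1); rewrite mul0r add0r; congr (_ * _).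
exact: (esym (mcoeff_rep_act _ _ _ _)).
Qed.

Lemma scaler_delta (K : fieldType) (V : lmodType K) (a b c d e x : K) (A P Q : V) :
  a != 0 -> a^-1 *: A = b *: P + c *: Q -> a * c = e -> a * b + d * c = e * x ->
  A + d *: (c *: P) = e *: (Q + x *: P).
Proof.
move=> a0 H E1 E2; have -> : A = a *: (a^-1 *: A) by rewrite scalerA mulfV // scale1r.
by rewrite H !scalerDr !scalerA addrAC -scalerDl E1 E2 addrC.
Qed.

(** With c = (j - conj j) / (2iy), the derivative of j^w contributes w j^(w+1) (j - conj j) / (2iy)
    and the weight term at g tau contributes w j^(w+1) conj(j) / (2iy); the sum is w j^(w+2) /
    (2iy). *)
Lemma delta_weightE (K : fieldType) (j cj y J W c : K) : j != 0 -> cj != 0 -> y != 0 ->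
  j - cj = c * y ->
  j ^+ 2 * (W * c * (J / j)) + W / (y / (j * cj)) * J = J * j ^+ 2 * (W / y).
Proof.
move=> j0 cj0 y0 E; have -> : c = (j - cj) / y by rewrite E mulfK.
by field; rewrite j0 cj0 y0.
Qed.

Lemma modular_delta w m F : modular star Gamma rho w m F ->
  modular star Gamma rho (w + 2) m (coefwise m (delta w%:~R) F).
Proof.
move=> /modularP[S hS]; apply/modularP; exists S; have [eS HS HG] := hS; split=> [//|tau t0 nS i|].
  have [hF aF] := HS tau t0 nS i; have [hA _] := pcoefs_homog (modular_off_homog i hS t0 nS).
  split; first by rewrite coefwiseE pcoefs_delta //; apply: rpredD => //; exact: rpredZ.
  apply: panalytic_ext (panalytic_pcoefs m (fun u => @real_analytic_delta R w%:~R u tau t0) aF).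
  by exists 1 => // s _; rewrite coefwiseE.
move=> g tau i Gg t0 nS nS'; have dg := detG Gg; have j0 := jfactor_neq0 dg t0.
have gt0 := mobius_upper dg t0; have [hFg _] := HS _ gt0 nS' i.
have [EA _] := modular_off_wirt i hS Gg t0 nS nS'.
rewrite coefwiseE (pcoefs_delta _ hFg) (HG g tau i Gg t0 nS nS').
have -> : rep_act g (fun l => coefwise m (delta w%:~R) F tau l 0) i =
    rep_act g (fun l => pcoefs m (@partial_tau R) (fun t => F t l 0) tau) i +
    (w%:~R / two_i_y tau) *: rep_act g (fun l => F tau l 0) i.
  rewrite -rep_actZ -rep_actD; apply: eq_rep_act => l.
  by rewrite coefwiseE pcoefs_delta //; have [] := HS tau t0 nS l.
have cj0 : conjc (jfactor g tau) != 0 by rewrite conjc_eq0.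
apply: (scaler_delta (expf_neq0 2 j0) EA); first by rewrite expfzDr // mulrC.
rewrite two_i_y_mobius // !expfzDr //.
exact: delta_weightE j0 cj0 (two_i_y_neq0 t0) (jfactor_two_i_y g tau).
Qed.

Lemma Im_mobius g tau : \det g = 1 -> upper tau ->
  (complex.Im (mobius g tau))%:C = (complex.Im tau)%:C / (jfactor g tau * conjc (jfactor g tau)).
Proof.
move=> dg t0; have := two_i_y_mobius dg t0; rewrite /two_i_y -[RHS]mulrA.
apply: mulfI; rewrite mulf_neq0 ?pnatr_eq0 // eq_complex /= oner_eq0 andbF //.
Qed.

Lemma scaler_eq2 (K : comNzRingType) (V : lmodType K) (a b c d : K) (x : V) :
  a * b = c * d -> a *: (b *: x) = c *: (d *: x).
Proof. by move=> E; rewrite !scalerA E. Qed.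

Lemma taubar_weightE (K : fieldType) (j cj y J : K) : j != 0 -> cj != 0 ->
  (y / (j * cj)) ^+ 2 * (cj ^+ 2 * J) = J / j ^+ 2 * y ^+ 2.
Proof. by move=> j0 cj0; field; rewrite j0 cj0. Qed.

(** The factor y^2 contributes |j|^-4 and the antiholomorphic chain rule conj(j)^2, so that conj(j)
    disappears and j^(w-2) remains. *)
Lemma modular_taubar w m F : modular star Gamma rho w m F ->
  modular star Gamma rho (w - 2) m (fun tau => scale_tensor ((complex.Im tau)%:C ^+ 2)
    (coefwise m (@partial_taubar R) F tau)).
Proof.
move=> /modularP[S hS]; apply/modularP; exists S; have [eS HS HG] := hS; split=> [//|tau t0 nS i|].
  have [hF aF] := HS tau t0 nS i; have [_ hB] := pcoefs_homog (modular_off_homog i hS t0 nS).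
  split; first by rewrite scale_tensorE coefwiseE; exact: rpredZ.
  have aY : real_analytic (fun t : R[i] => (complex.Im t)%:C ^+ 2) tau.
    by apply: real_analyticM; exact: real_analytic_Im.
  apply: panalytic_ext (panalyticZ aY (panalytic_pcoefs m (@real_analytic_partial_taubar R ^~ tau) aF)).
  by exists 1 => // s _; rewrite scale_tensorE coefwiseE.
move=> g tau i Gg t0 nS nS'; have dg := detG Gg; have j0 := jfactor_neq0 dg t0.
have [_ EB] := modular_off_wirt i hS Gg t0 nS nS'.
have cj0 : conjc (jfactor g tau) != 0 by rewrite conjc_eq0.
have cE : conjc (jfactor g tau ^- 2) = (conjc (jfactor g tau) ^+ 2)^-1 by rewrite fmorphV rmorphXn.
have BE : pcoefs m (@partial_taubar R) (fun t => F t i 0) (mobius g tau) =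
    (conjc (jfactor g tau) ^+ 2 * jfactor g tau ^ w) *:
      rep_act g (fun l => pcoefs m (@partial_taubar R) (fun t => F t l 0) tau) i.
  rewrite -(@scalerA _ (SymAlg R)) -EB cE (@scalerA _ (SymAlg R)) mulfV ?expf_neq0 //.
  by rewrite (@scale1r _ (SymAlg R)).
have L : scale_tensor ((complex.Im (mobius g tau))%:C ^+ 2)
      (coefwise m (@partial_taubar R) F (mobius g tau)) i 0 =
    ((complex.Im (mobius g tau))%:C ^+ 2) *: ((conjc (jfactor g tau) ^+ 2 * jfactor g tau ^ w) *:
      rep_act g (fun l => pcoefs m (@partial_taubar R) (fun t => F t l 0) tau) i).
  apply: (etrans (scale_tensorE _ _ _)).
  exact: (congr1 (fun p => _ *: p) (etrans (coefwiseE _ _ _ _ _) BE)).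
have Rr : rep_act g (fun l => scale_tensor ((complex.Im tau)%:C ^+ 2)
      (coefwise m (@partial_taubar R) F tau) l 0) i = ((complex.Im tau)%:C ^+ 2) *:
      rep_act g (fun l => pcoefs m (@partial_taubar R) (fun t => F t l 0) tau) i.
  rewrite -rep_actZ; apply: eq_rep_act => l; apply: (etrans (scale_tensorE _ _ _)).
  exact: (congr1 (fun p => _ *: p) (coefwiseE _ _ _ _ _)).
apply: (etrans L); apply: (etrans _ (congr1 (fun p => _ *: p) (esym Rr))).
apply: scaler_eq2; rewrite (Im_mobius dg t0) expfzDr //.
exact: taubar_weightE.
Qed.

Lemma scaler_mul_eq2 (K : comNzRingType) (V : comAlgType K) (a b c d : K) (x y : V) :
  a * b = c * d -> x * (a *: (b *: y)) = c *: ((d *: x) * y).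
Proof. by move=> E; rewrite scalerA -scalerAr -scalerAl scalerA E. Qed.

(** The derivation and the multiplication by X contribute a factor j^-1 each. *)
Lemma modular_X_Dop w m F : modular star Gamma rho w m F ->
  modular star Gamma rho (w - 2) m (mulX (Dop m F)).
Proof.
move=> /modularP[S hS]; apply/modularP; exists S; have [eS HS HG] := hS.
have DE tau i : upper tau -> ~ S tau -> mulX (Dop m F) tau i 0 = vecX tau * derX tau (F tau i 0).
  by move=> t0 nS; rewrite mulXE DopE // => l; have [] := HS tau t0 nS l.
split=> [//|tau t0 nS i|].
  have [hF aF] := HS tau t0 nS i; split; first by rewrite DE //; exact: homog_X_derX.
  apply: panalytic_ext (panalyticM (@panalytic_vecX R tau)
    (panalytic_derX (modular_off_homog i hS t0 nS) aF)).
  by apply: locallyW (exceptional_locally eS t0 nS) => s [s0 nSs]; rewrite DE.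
move=> g tau i Gg t0 nS nS'; have dg := detG Gg; have j0 := jfactor_neq0 dg t0.
have L : derX (mobius g tau) (F (mobius g tau) i 0) = jfactor g tau ^ w *:
    ((jfactor g tau)^-1 *: rep_act g (fun l => derX tau (F tau l 0)) i).
  apply: (etrans (congr1 (derX _) (HG g tau i Gg t0 nS nS'))); apply: (etrans (derXZ _ _ _)).
  exact: (congr1 (fun p => _ *: p) (rep_act_derX _ i dg t0)).
have Rr : rep_act g (fun l => mulX (Dop m F) tau l 0) i =
    jfactor g tau *: vecX (mobius g tau) * rep_act g (fun l => derX tau (F tau l 0)) i.
  rewrite -(symact_vecX j0) -rep_actM; apply: eq_rep_act => l; exact: DE.
apply: (etrans (DE _ i (mobius_upper dg t0) nS')); rewrite L Rr.
apply: scaler_mul_eq2; rewrite expfzDr // -mulrA; congr (_ * _).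
by rewrite -[(- 2 : int)]/(Negz 1) /exprz expr2 invfM mulfVK.
Qed.

Lemma Xbar_weightE (K : fieldType) (j cj y J c : K) : j != 0 -> cj != 0 -> y != 0 ->
  c / - (y / (j * cj)) * J = J * j * (c / - y * cj).
Proof. by move=> j0 cj0 y0; field; rewrite j0 cj0 oppr_eq0 y0. Qed.

Lemma scaler_mul_eq3 (K : comNzRingType) (V : comAlgType K) (a b c d e : K) (x y : V) :
  a * b = c * (d * e) -> a *: (x * (b *: y)) = c *: (d *: ((e *: x) * y)).
Proof. by move=> E; rewrite -scalerAr -scalerAl !scalerA E mulrA. Qed.

(** Xbar contributes conj(j)^-1 and 1/y contributes j conj(j), leaving one factor j. The free
    constant covers (ii) and (iii) together. *)
Lemma modular_Xbar w m (c : R[i]) G : modular star Gamma rho w m G ->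
  modular star Gamma rho (w + 1) m.+1
    (fun tau => scale_tensor (c / - two_i_y tau) (mulXbar G tau)).
Proof.
move=> /modularP[S hS]; apply/modularP; exists S; have [eS HS HG] := hS.
have GE tau i : scale_tensor (c / - two_i_y tau) (mulXbar G tau) i 0 =
    (c / - two_i_y tau) *: (vecXbar tau * G tau i 0) by rewrite scale_tensorE mulXbarE.
split=> [//|tau t0 nS i|].
  have [hF aF] := HS tau t0 nS i; split.
    rewrite GE; apply: rpredZ; exact: (dhomogM (homog_vecXbar tau) hF).
  have aY : real_analytic (fun t : R[i] => c / - two_i_y t) tau.
    apply: real_analyticZ; have := real_analyticZ (-1) (real_analytic_inv_two_i_y t0).
    by congr (real_analytic _ _); apply/funext => t; rewrite invrN mulN1r.
  apply: panalytic_ext (panalyticZ aY (panalyticM (@panalytic_vecXbar R tau) aF)).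
  by exists 1 => // s _; rewrite GE.
move=> g tau i Gg t0 nS nS'; have dg := detG Gg; have j0 := jfactor_neq0 dg t0.
have cj0 : conjc (jfactor g tau) != 0 by rewrite conjc_eq0.
have -> : rep_act g (fun l => scale_tensor (c / - two_i_y tau) (mulXbar G tau) l 0) i =
    (c / - two_i_y tau) *: (conjc (jfactor g tau) *: vecXbar (mobius g tau) *
      rep_act g (fun l => G tau l 0) i).
  rewrite -(symact_vecXbar j0) -rep_actM -rep_actZ; apply: eq_rep_act => l; exact: GE.
apply: (etrans (GE _ _)); rewrite (HG g tau i Gg t0 nS nS'); apply: scaler_mul_eq3.
rewrite (two_i_y_mobius dg t0) expfzDr // expr1z.
exact: Xbar_weightE j0 cj0 (two_i_y_neq0 t0).
Qed.

Lemma associated_off k m F (f_ : nat -> R[i] -> 'cV[R[i]]_n) :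
  associated_via star Gamma rho k m F f_ ->
  exists2 S, modular_off S (k - m%:Z) m F & forall tau, upper tau -> ~ S tau ->
    forall i, F tau i 0 = form_comb m (vecX tau) (vece R) (fun r => f_ r tau i 0).
Proof.
move=> hF; have [S' eS' H'] := associated_viaP hF.
have [S hS] : exists S, modular_off S (k - m%:Z) m F by apply/modularP; case: hF.
have eU : exceptional star (S `|` S') by case: hS => ? _ _; exact: exceptionalU.
exists (S `|` S'); first by apply: modular_off_mono hS => // tau; left.
by move=> tau t0 nS; apply: H' => // Ss; apply: nS; right.
Qed.

(** Evaluation at a point independent of tau is a fixed linear functional, so it commutes with both
    partial derivatives. *)
Lemma modular_off_eval_partial S w m F (u : R[i] -> R[i]) tau i : modular_off S w m F ->
  (forall s, upper s -> ~ S s -> u s = eval2 0 1 (F s i 0)) -> upper tau -> ~ S tau ->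
  partial_tau u tau = eval2 0 1 (pcoefs m (@partial_tau R) (fun t => F t i 0) tau) /\
  partial_taubar u tau = eval2 0 1 (pcoefs m (@partial_taubar R) (fun t => F t i 0) tau).
Proof.
move=> hS hu t0 nS; have [eS HS _] := hS; have [_ aF] := HS tau t0 nS i.
have hF := modular_off_homog i hS t0 nS; have [hA hB] := pcoefs_homog hF.
apply: wirt_partial; apply: wirt_ext (linear_form_wirt (linear_form_eval2 0 1) hF hA hB (pcoefs_wirt hF aF)).
by apply: locallyW (exceptional_locally eS t0 nS) => s [s0 nSs]; rewrite hu.
Qed.

Lemma eval2_01_mulXbar (c : R[i]) G tau i :
  eval2 0 1 (scale_tensor c (mulXbar G tau) i 0) = c * eval2 0 1 (mulX G tau i 0).
Proof.
have E : eval2 0 1 (vecXbar tau) = eval2 0 1 (vecX tau).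
  by rewrite eval2_vecX eval2_vecXbar !mulr0.
have XE : eval2 0 1 (mulX G tau i 0) = eval2 0 1 (vecX tau) * eval2 0 1 (G tau i 0).
  exact: (etrans (congr1 (eval2 0 1) (mulXE G tau i)) (eval2M _ _ _ _)).
have XbarE : eval2 0 1 (mulXbar G tau i 0) = eval2 0 1 (vecXbar tau) * eval2 0 1 (G tau i 0).
  exact: (etrans (congr1 (eval2 0 1) (mulXbarE G tau i)) (eval2M _ _ _ _)).
apply: (etrans (congr1 (eval2 0 1) (scale_tensorE c (mulXbar G tau) i))).
apply: (etrans (eval2Z _ _ _ _)).
exact: (congr1 (fun x => c * x) (etrans XbarE (etrans (congr1 (fun x => x * _) E) (esym XE)))).
Qed.

Lemma form_comb_top0 m (Y Z : SymAlg R) c : c m.+1 = 0 ->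
  form_comb m.+1 Y Z c = Y * form_comb m Y Z c.
Proof.
move=> c0; rewrite /form_comb big_ord_recr /= c0 (@scale0r _ (SymAlg R)) addr0 mulr_sumr.
apply: eq_bigr => r _ /=; rewrite subSn; last by rewrite -ltnS.
by rewrite exprS -mulrA (@scalerAr _ (SymAlg R)).
Qed.

Lemma form_comb_homog m (Y Z : SymAlg R) c : homog 1 Y -> homog 1 Z ->
  homog m (form_comb m Y Z c).
Proof.
move=> hY hZ; apply: rpred_sum => r _; apply: rpredZ.
have := dhomogM (homog_exp (m - r) hY) (homog_exp r hZ); rewrite subnK //.
by rewrite -ltnS.
Qed.

(** Evaluation at the zero (1, -tau) of X shows that f_(m+1) vanishes, so the last term of the
    expansion drops. *)
Lemma mulX_quasimodular k m F (f_ : nat -> R[i] -> 'cV[R[i]]_n) G :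
  associated_via star Gamma rho k m.+1 F f_ ->
  generically star (fun tau => F tau = mulX G tau) ->
  quasimodular star Gamma rho k m (f_ 0%N).
Proof.
move=> hF [S2 e2 H2]; have [S3 e3 H3] := associated_viaP hF.
case: hF => [[aF [S1 e1 H1]] _ _]; exists f_ => //; split => //.
exists (S1 `|` (S2 `|` S3)); first by apply: exceptionalU => //; exact: exceptionalU.
move=> g tau Gg t0 nS nS'.
rewrite (H1 g tau Gg t0 (fun Ss => nS (or_introl Ss)) (fun Ss => nS' (or_introl Ss))).
have top0 : f_ m.+1 tau = 0.
  apply: colP0 => i; rewrite mxE -(eval2_root_form_comb m.+1 tau (fun r => f_ r tau i 0)).
  rewrite -(H3 tau t0 (fun Ss => nS (or_intror (or_intror Ss)))).
  rewrite (H2 tau t0 (fun Ss => nS (or_intror (or_introl Ss)))) mulXE eval2M eval2_vecX.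
  by rewrite mulr1 subrr mul0r.
by rewrite big_ord_recr /= top0 mulmx0 scaler0 addr0.
Qed.

(* The difference of the two expansions of f(g tau) is a polynomial in c / (c tau + d) of
   degree at most m + 1, which vanishes at m + 2 distinct points. *)
Lemma quasimodular_top0 k m (f_ : nat -> R[i] -> 'cV[R[i]]_n) :
  fuchsian Gamma -> representation Gamma rho -> quasimodular_via star Gamma rho k m.+1 f_ ->
  quasimodular star Gamma rho k m (f_ 0%N) -> generically star (fun tau => f_ m.+1 tau = 0).
Proof.
move=> hG [rho1 rhoM] [_ [S1 e1 H1]] [h_ h0 [_ [S2 e2 H2]]].
have [[_ _ _ Ginv] _ _] := hG.
have [s [size_s Gs us]] := fuchsian_directions m.+2 hG.
have [S' eS' HS'] := exceptional_preimages (exceptionalU e1 e2) (fun g gs => detG (Gs g gs)).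
exists S' => // tau t0 /(HS' tau t0)[nS nSg]; apply: colP0 => i; rewrite mxE.
(* The shorter expansion is padded by 0 in degree m + 1, so that the top coefficient of the
   difference is f_(m+1) itself. *)
pose h' r := if (r < m.+1)%N then h_ r tau else 0.
pose p := \poly_(r < m.+2) ((f_ r tau - h' r) i 0).
(* A nonzero polynomial with m + 2 coefficients has at most m + 1 distinct roots. *)
have p0 : p = 0.
  apply/eqP; apply: contraTT isT => pn0.
  suff /(max_poly_roots pn0) /(_ (us tau t0)) :
      all (root p) [seq jprime g / jfactor g tau | g <- s].
    by rewrite size_map size_s ltnNge size_poly.
  apply/allP => x /mapP[g gs ->]; have Gg := Gs g gs; have dg := detG Gg.
  have j0 := jfactor_neq0 dg t0; have nSt := nSg g gs.
  have E1 := H1 g tau Gg t0 (fun Ss => nS (or_introl Ss)) (fun Ss => nSt (or_introl Ss)).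
  have E2 := H2 g tau Gg t0 (fun Ss => nS (or_intror Ss)) (fun Ss => nSt (or_intror Ss)).
  have E3 : rho g *m \sum_(r < m.+2)
      (jfactor g tau ^ (k - r%:Z) * jprime g ^+ r) *: (f_ r tau - h' r) = 0.
    transitivity (f_ 0%N (mobius g tau) - h_ 0%N (mobius g tau)); last by rewrite h0 subrr.
    rewrite E1 E2 mulmx_sumr.
    have -> : \sum_(r < m.+1) (jfactor g tau ^ (k - r%:Z) * jprime g ^+ r) *: (rho g *m h_ r tau) =
        \sum_(r < m.+2) (jfactor g tau ^ (k - r%:Z) * jprime g ^+ r) *: (rho g *m h' r).
      rewrite [RHS]big_ord_recr /= /h' ltnn mulmx0 scaler0 addr0.
      by apply: eq_bigr => r _; rewrite ltn_ord.
    by rewrite -sumrB; apply: eq_bigr => r _; rewrite -scalemxAr mulmxBr scalerBr.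
  (* [rho g] is cancelled with [rho] of the inverse. *)
  have E4 : \sum_(r < m.+2) (jfactor g tau ^ (k - r%:Z) * jprime g ^+ r) *: (f_ r tau - h' r) = 0.
    have := congr1 (mulmx (rho (invmx g))) E3; rewrite mulmx0 mulmxA -rhoM //; last exact: Ginv.
    by rewrite mulVmx ?rho1 ?mul1mx // unitmxE dg unitr1.
  (* Factoring j^(k-r) c^r as j^k (c/j)^r turns the relation into the vanishing of the polynomial at
     c/j. *)
  have jk0 : jfactor g tau ^ k != 0 by rewrite expfz_neq0.
  rewrite /root horner_poly -(inj_eq (mulfI jk0)) mulr0 mulr_sumr.
  have E5 : \sum_(r < m.+2) ((jfactor g tau ^ (k - r%:Z) * jprime g ^+ r) *: (f_ r tau - h' r)) i 0 = 0.
    by rewrite -summxE E4 mxE.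
  apply/eqP; rewrite -[RHS]E5; apply: eq_bigr => r _.
  rewrite [RHS]mxE expfzDr // expr_div_n (exprnN (jfactor g tau) r).
  by rewrite -!mulrA; congr (_ * _); rewrite mulrC -mulrA mulrCA.
have := congr1 (fun q : {poly R[i]} => q`_m.+1) p0.
by rewrite coef_poly ltnSn coef0 /h' ltnn subr0.
Qed.

Lemma scaler_mul_eq1 (K : comNzRingType) (V : comAlgType K) (a b c : K) (x y : V) :
  a * b = c -> a *: ((b *: x) * y) = x * (c *: y).
Proof. by move=> <-; rewrite -scalerAl -scalerAr scalerA. Qed.

(** Once f_(m+1) vanishes, F is X times the combination of the remaining terms. Equivariance of the
    quotient follows by cancelling X in an integral domain, and analyticity by [panalytic_divX]. *)
Lemma quasimodular_mulX k m F (f_ : nat -> R[i] -> 'cV[R[i]]_n) :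
  fuchsian Gamma -> representation Gamma rho -> associated_via star Gamma rho k m.+1 F f_ ->
  quasimodular star Gamma rho k m (f_ 0%N) -> exists G,
  modular star Gamma rho (k - m.+1%:Z + 1) m G /\ generically star (fun tau => F tau = mulX G tau).
Proof.
move=> hG hrho hF hq; have [S1 hS1 H1] := associated_off hF.
have [S2 e2 H2] : generically star (fun tau => f_ m.+1 tau = 0).
  by apply: quasimodular_top0 hq => //; case: hF.
have eU : exceptional star (S1 `|` S2) by case: hS1 => ? _ _; exact: exceptionalU.
pose G tau := \sum_(r < m.+1) pure_tensor (vecX tau ^+ (m - r) * vece R ^+ r) (f_ r tau).
have GE tau i : G tau i 0 = form_comb m (vecX tau) (vece R) (fun r => f_ r tau i 0).
  exact: (sum_pure_tensorE _ _ _ (fun r => f_ r tau)).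
have FG tau i : upper tau -> ~ (S1 `|` S2) tau -> F tau i 0 = vecX tau * G tau i 0.
  move=> t0 nS; rewrite (H1 tau t0 (fun Ss => nS (or_introl Ss))) GE form_comb_top0 //.
  by rewrite (H2 tau t0 (fun Ss => nS (or_intror Ss))) mxE.
have [|_ HS HG] := modular_off_mono eU _ hS1; first by move=> t; left.
exists G; split; last first.
  by exists (S1 `|` S2) => // tau t0 nS; apply: colP0 => i; rewrite mulXE; exact: FG.
apply/modularP; exists (S1 `|` S2); split=> [//|tau t0 nS i|g tau i Gg t0 nS nS'].
  split; first by rewrite GE; apply: form_comb_homog; [exact: homog_vecX|exact: homog_vece].
  have [_ aF] := HS tau t0 nS i; apply: panalytic_divX; apply: panalytic_ext aF.
  by apply: locallyW (exceptional_locally eU t0 nS) => s [s0 nSs]; exact: FG.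
have dg := detG Gg; have j0 := jfactor_neq0 dg t0.
have Rr : rep_act g (fun l => F tau l 0) i =
    jfactor g tau *: vecX (mobius g tau) * rep_act g (fun l => G tau l 0) i.
  rewrite -(symact_vecX j0) -rep_actM; apply: eq_rep_act => l; exact: FG.
apply: (mulfI (vecX_neq0 (mobius g tau))).
apply: (etrans (esym (FG _ i (mobius_upper dg t0) nS'))).
rewrite (HG g tau i Gg t0 nS nS') Rr; apply: scaler_mul_eq1.
by rewrite [RHS]expfzDr // expr1z.
Qed.

End ModularForms.

Theorem theorem1p6 (R : realType) (Gamma : set 'M[R]_2) (n : nat)
    (rho : 'M[R]_2 -> 'M[R[i]]_n) (k : int) (m : nat) (star : regularity)
    (F : R[i] -> 'cV[SymAlg R]_n) (f_ : nat -> R[i] -> 'cV[R[i]]_n)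
    (hGamma : fuchsian Gamma) (hrho : representation Gamma rho)
    (hm : (1 <= m)%N) (hF : associated_via star Gamma rho k m F f_) :
  let f := f_ 0%N in
  let w : R[i] := (k - m%:Z)%:~R in
  let is_mulX (G : R[i] -> 'cV[SymAlg R]_n) : Prop :=
    modular star Gamma rho (k + 1 - m%:Z) (m - 1) G /\
    generically star (fun tau => F tau = mulX G tau) in
  [/\ associated star Gamma rho (k + 2) m
        (coefwise m (delta w) F) (entrywise (delta w) f),
      ((exists G, is_mulX G) <-> quasimodular star Gamma rho k (m - 1) f) /\
      (forall G, is_mulX G ->
        associated star Gamma rho (k + 2) m
          (fun tau => scale_tensor (- two_i_y tau)^-1 (mulXbar G tau))
          (fun tau => (- two_i_y tau)^-1 *: f tau)),
      forall G, is_mulX G ->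
        (forall l : R[i],
          associated star Gamma rho (k + 2) m
            (fun tau => coefwise m (delta w) F tau +
               scale_tensor ((w - l) / (- two_i_y tau)) (mulXbar G tau))
            (entrywise (delta l) f)) /\
        associated star Gamma rho (k + 2) m
          (fun tau => coefwise m (delta w) F tau +
             scale_tensor (w / (- two_i_y tau)) (mulXbar G tau))
          (entrywise (@partial_tau R) f),
      associated star Gamma rho (k - 2) m
        (fun tau => scale_tensor ((complex.Im tau)%:C ^+ 2)
           (coefwise m (@partial_taubar R) F tau))
        (fun tau => (complex.Im tau)%:C ^+ 2 *:
           entrywise (@partial_taubar R) f tau)
    & associated star Gamma rho (k - 2) m (mulX (Dop m F)) (f_ 1%N)].
Proof.
  Proof.
case: m hm hF => // m _ hF f w is_mulX; rewrite /is_mulX {is_mulX}.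
have [[detG _ _ _] _ _] := hGamma.
have [S hS FE] := associated_off hF.
have fE tau : upper_half_plane R tau -> ~ S tau -> forall i, f tau i 0 = eval2 0 1 (F tau i 0).
  by move=> t0 nS i; rewrite (FE tau t0 nS) eval2_01_form_comb.
have eS : exceptional star S by case: hS.
have mF : modular star Gamma rho (k - m.+1%:Z) m.+1 F by case: hF.
have part tau i : upper_half_plane R tau -> ~ S tau ->
    partial_tau (fun t => f t i 0) tau =
      eval2 0 1 (pcoefs m.+1 (@partial_tau R) (fun t => F t i 0) tau) /\
    partial_taubar (fun t => f t i 0) tau =
      eval2 0 1 (pcoefs m.+1 (@partial_taubar R) (fun t => F t i 0) tau).
  by move=> t0 nS; apply: modular_off_eval_partial hS _ t0 nS => s s0 nSs; exact: fE.
have deltaE tau i : upper_half_plane R tau -> ~ S tau ->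
    eval2 0 1 (coefwise m.+1 (delta w) F tau i 0) = delta w (fun t => f t i 0) tau.
  move=> t0 nS; have hFi : F tau i 0 \is @ishomog1 2 R[i] m.+1 mdeg.
    by case: hS => _ /(_ tau t0 nS i)[].
  rewrite coefwiseE (pcoefs_delta w hFi) eval2D eval2Z -(part tau i t0 nS).1 -fE //.
have wt2 : k + 2 - m.+1%:Z = k - m.+1%:Z + 2 by rewrite addrAC.
have wtm2 : k - 2 - m.+1%:Z = k - m.+1%:Z - 2 by rewrite addrAC.
have wt1 : k + 1 - m.+1%:Z = k - m.+1%:Z + 1 by rewrite addrAC.
have wt11 : k - m.+1%:Z + 2 = k + 1 - m.+1%:Z + 1 by rewrite wt1 -[RHS]addrA.
have mdelta : modular star Gamma rho (k + 2 - m.+1%:Z) m.+1 (coefwise m.+1 (delta w) F).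
  by rewrite wt2; exact: modular_delta.
have mXbar c G : modular star Gamma rho (k + 1 - m.+1%:Z) m G ->
    modular star Gamma rho (k + 2 - m.+1%:Z) m.+1
      (fun tau => scale_tensor (c / - two_i_y tau) (mulXbar G tau)).
  by move=> mG; rewrite wt2 wt11; exact: modular_Xbar.
have XbarE c G tau i : F tau = mulX G tau ->
    eval2 0 1 (scale_tensor c (mulXbar G tau) i 0) = c * eval2 0 1 (F tau i 0).
  move=> ->; exact: eval2_01_mulXbar.
rewrite subn1 /=.
have hiii G l : modular star Gamma rho (k + 1 - m.+1%:Z) m G ->
    generically star (fun tau => F tau = mulX G tau) ->
    associated star Gamma rho (k + 2) m.+1
      (fun tau => coefwise m.+1 (delta w) F tau +
         scale_tensor ((w - l) / (- two_i_y tau)) (mulXbar G tau))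
      (entrywise (delta l) f).
  move=> mG [S' eS' hG]; apply: (associated_intro detG).
    exact: (modularD mdelta (mXbar (w - l) G mG)).
  exists (S `|` S'); first exact: exceptionalU.
  move=> tau t0 nS i; have nS1 : ~ S tau by move=> Ss; apply: nS; left.
  have FG : F tau = mulX G tau by apply: hG => // Ss; apply: nS; right.
  apply: esym; apply: (etrans (congr1 (eval2 0 1) (colDE _ _ i))).
  apply: (etrans (eval2D _ _ _ _)).
  apply: (etrans (f_equal2 +%R (deltaE tau i t0 nS1) (XbarE _ G tau i FG))).
  (* At (0, 1) the weight terms are w / (2iy) and (w - l) / (-2iy), whose sum is l / (2iy), the
     weight term of delta_l. *)
  rewrite -(fE tau t0 nS1 i) [RHS]mxE /delta -addrA -mulrDl; congr (_ + _ * _).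
  by rewrite invrN mulrN -mulNr -mulrDl opprB addrC subrK.
split.
- apply: (associated_intro detG mdelta); exists S => [//|tau t0 nS i].
  by apply: etrans (esym (deltaE tau i t0 nS)); rewrite mxE.
- split.
    split=> [[G [_ hG]]|hq]; first exact: mulX_quasimodular hF hG.
    by rewrite wt1; exact: (quasimodular_mulX detG hGamma hrho hF hq).
  move=> G [mG [S' eS' hG]]; apply: (associated_intro detG).
    have -> : (fun tau => scale_tensor (- two_i_y tau)^-1 (mulXbar G tau)) =
        (fun tau => scale_tensor (1 / - two_i_y tau) (mulXbar G tau)).
      by apply/funext => tau; rewrite mul1r.
    exact: mXbar.
  exists (S `|` S'); first exact: exceptionalU.
  move=> tau t0 nS i; have nS1 : ~ S tau by move=> Ss; apply: nS; left.
  have FG : F tau = mulX G tau by apply: hG => // Ss; apply: nS; right.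
  by rewrite [LHS]mxE (XbarE _ G tau i FG) (fE tau t0 nS1 i).
- move=> G [mG hG]; split=> [l|]; first exact: (hiii G l mG hG).
  have -> : entrywise (@partial_tau R) f = entrywise (delta 0) f.
    apply/funext => tau; apply: colP0 => i; rewrite [LHS]mxE [RHS]mxE /delta mul0r mul0r.
    exact: (esym (addr0 _)).
  by have := hiii G 0 mG hG; rewrite subr0.
- apply: (associated_intro detG); first by rewrite wtm2; exact: (modular_taubar detG mF).
  exists S => [//|tau t0 nS i]; rewrite [LHS]mxE [X in _ * X]mxE (part tau i t0 nS).2 -eval2Z.
  apply: (congr1 (eval2 0 1)); apply: esym; apply: (etrans (scale_tensorE _ _ _)).
  exact: (congr1 (fun p => _ *: p) (coefwiseE _ _ _ _ _)).
- apply: (associated_intro detG); first by rewrite wtm2; exact: (modular_X_Dop detG mF).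
  exists S => [//|tau t0 nS i].
  have hFt : in_tensor m.+1 (F tau) by move=> l; case: hS => _ /(_ tau t0 nS l)[].
  have XD := etrans (mulXE _ _ _) (congr1 (fun p => vecX tau * p) (DopE i t0 hFt)).
  by rewrite XD (FE tau t0 nS) eval2_01_X_derX.
Qed.
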